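(* Let $\mathbb{K}$ be an algebraically closed field of characteristic $p>0$ and let $n\ge 2$ with $p\mid n$. Let $\chi\in\mathfrak{sl}_n(\mathbb{K})^*$ be the regular nilpotent $p$-character given by $\chi(X_{-\alpha_i})=1$ for $1\le i\le n-1$, $\chi(\mathfrak{h})=0$ and $\chi(X_\alpha)=0$ for all other roots $\alpha\in R\setminus\{-\alpha_1,\dots,-\alpha_{n-1}\}$. Let $\lambda\in\mathscr{X}_p$, and regard the baby Verma module $Z_\chi(\lambda)$ as a $U_\chi(\mathfrak{sl}_n)$-module. (1) If $\lambda\in W.0$, then $Z_\chi(\lambda)$ is reducible and admits a composition series of length $p$; all of its composition factors are isomorphic to its unique simple quotient $L_\chi(\lambda)$. (2) If $\lambda\notin W.0$, then $Z_\chi(\lambda)$ is an irreducible $U_\chi(\mathfrak{sl}_n)$-module.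
   Context: For a restricted Lie algebra $\mathfrak{g}$ with $p$-map $x\mapsto x^{[p]}$ and $\chi\in\mathfrak{g}^*$, $U_\chi(\mathfrak{g})$ is the quotient of $U(\mathfrak{g})$ by the ideal generated by $x^p-x^{[p]}-\chi(x)^p$, $x\in\mathfrak{g}$. Here $\mathfrak{g}=\mathfrak{sl}_n(\mathbb{K})$ with $x^{[p]}$ the $p$-th matrix power. $\mathfrak{h}$ is the subalgebra of diagonal trace-zero matrices, $\varepsilon_i\in\mathfrak{h}^*$ takes the $i$-th diagonal entry, $R=\{\varepsilon_i-\varepsilon_j\mid i\ne j\}$, $R^+=\{\varepsilon_i-\varepsilon_j\mid i<j\}$, $\alpha_i=\varepsilon_i-\varepsilon_{i+1}$ (roots are regarded as elements of the abstract root system of type $A_{n-1}$). For $\alpha=\varepsilon_i-\varepsilon_j$ put $X_\alpha=E_{ij}$. $\mathfrak{b}=\mathfrak{h}\oplus\bigoplus_{\alpha\in R^+}\mathbb{K}X_\alpha$ is the subalgebra of upper triangular matrices. $\mathscr{X}_p=\{\lambda\in\mathfrak{h}^*\mid \lambda(H)^p=\lambda(H^{[p]})\ \forall H\in\mathfrak{h}\}$, i.e. those $\lambda$ with $\lambda(E_{ii}-E_{i+1,i+1})\in\mathbb{F}_p$ for all $i$. For $\lambda\in\mathscr{X}_p$, $\mathbb{K}_\lambda$ is the one-dimensional $U_0(\mathfrak{b})$-module on which the $X_\alpha$, $\alpha\in R^+$, act by $0$ and $\mathfrak{h}$ acts via $\lambda$; since $\chi(\mathfrak{b})=0$ one has $U_\chi(\mathfrak{b})=U_0(\mathfrak{b})$,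 and $Z_\chi(\lambda)=U_\chi(\mathfrak{g})\otimes_{U_\chi(\mathfrak{b})}\mathbb{K}_\lambda$. For the given $\chi$, $Z_\chi(\lambda)$ has a unique simple quotient, denoted $L_\chi(\lambda)$. $W=\mathfrak{S}_n$ is the Weyl group, acting on $\mathfrak{h}^*$ by permuting the $\varepsilon_i$, with dot action $w.\lambda=w(\lambda+\rho)-\rho$, where $\rho\in\mathfrak{h}^*$ satisfies $\rho(E_{ii}-E_{i+1,i+1})=1$ for all $i$ (i.e. $\rho=\sum_j(n-j)\varepsilon_j$). $W.0$ is the orbit of $0\in\mathfrak{h}^*$ under the dot action. *)

(* Defs.v *)
From HB Require Import structures.
From mathcomp Require Import all_boot all_order perm all_algebra.
From mathcomp.classical Require Import boolp.
From mathcomp Require Import finmap.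
From mathcomp.multinomials Require Import monalg.

Set Implicit Arguments.
Unset Strict Implicit.
Unset Printing Implicit Defensive.

Import GRing.Theory.
Local Open Scope ring_scope.
Local Open Scope quotient_scope.

(* Rings and modules are allowed to be trivial (pzRingType) throughout: that
   U(g) and U_chi(g) are nonzero is a consequence of the PBW theorem.
   The projections and operations of the quotients are locked, so that
   unification does not unfold iterated quotients. *)

Section Submodules.
Variables (A : pzRingType) (V : lmodType A).

Record submodule := Submodule {
  submod_pred :> {pred V};
  submod_closedP : submod_closed submod_pred }.

Variable S : submodule.

Fact submodule_zmod_closed : zmod_closed (submod_pred S).
Proof. exact/GRing.submod_closedB/submod_closedP. Qed.
HB.instance Definition _ :=
  GRing.isZmodClosed.Build V (submod_pred S) submodule_zmod_closed.
Fact submodule_scale_closed : GRing.scaler_closed (submod_pred S).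
Proof. by have [] := GRing.submod_closed_semi (submod_closedP S). Qed.
HB.instance Definition _ :=
  GRing.isScaleClosed.Build A V (submod_pred S) submodule_scale_closed.

Record sub_of : predArgType := SubOf { sub_val : V; sub_valP : sub_val \in S }.
HB.instance Definition _ := [isSub for sub_val].
HB.instance Definition _ := [Choice of sub_of by <:].
HB.instance Definition _ := [SubChoice_isSubZmodule of sub_of by <:].
HB.instance Definition _ := [SubZmodule_isSubLmodule of sub_of by <:].

Definition quo_by := {ideal_quot (submod_pred S)}.
HB.instance Definition _ := GRing.Zmodule.on quo_by.
Definition quo_pi (v : V) : quo_by := \pi_({ideal_quot (submod_pred S)}) v.

Lemma quo_piP u v : quo_pi u = quo_pi v <-> u - v \in S.
Proof.
rewrite (Quotient.idealrBE (submod_pred S)).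
by split=> [/eqP|/eqP].
Qed.

Lemma quo_pi_zmod : zmod_morphism quo_pi.
Proof. by move=> u v; rewrite /quo_pi raddfB. Qed.

Lemma quo_piK (x : quo_by) : quo_pi (repr x) = x.
Proof. exact: reprK. Qed.

Fact quo_key : unit. Proof. by []. Qed.
Definition quo_scale : A -> quo_by -> quo_by :=
  locked_with quo_key (fun a x => quo_pi (a *: repr x)).

Lemma quo_scaleE a v : quo_scale a (quo_pi v) = quo_pi (a *: v).
Proof.
rewrite /quo_scale locked_withE; apply/quo_piP.
rewrite -scalerBr rpredZ //; exact/quo_piP/quo_piK.
Qed.

Fact quo_scalerA a b x : quo_scale a (quo_scale b x) = quo_scale (a * b) x.
Proof. by rewrite -(quo_piK x) !quo_scaleE scalerA. Qed.
Fact quo_scale1r : left_id 1 quo_scale.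
Proof. by move=> x; rewrite -(quo_piK x) quo_scaleE scale1r. Qed.
Fact quo_scalerDr : right_distributive quo_scale +%R.
Proof.
move=> a x y; rewrite -(quo_piK x) -(quo_piK y).
have piD u v : quo_pi u + quo_pi v = quo_pi (u + v) by rewrite /quo_pi raddfD.
by rewrite piD !quo_scaleE piD scalerDr.
Qed.
Fact quo_scalerDl x : {morph quo_scale^~ x : a b / a + b}.
Proof.
move=> a b /=; rewrite -(quo_piK x) !quo_scaleE.
by rewrite scalerDl /quo_pi raddfD.
Qed.
HB.instance Definition _ := GRing.Zmodule_isLmodule.Build A quo_by
  quo_scalerA quo_scale1r quo_scalerDr quo_scalerDl.

Fact quo_pi_linear : linear quo_pi.
Proof.
move=> a u v; rewrite -[a *: quo_pi u]/(quo_scale a (quo_pi u)) quo_scaleE.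
by rewrite /quo_pi raddfD.
Qed.
HB.instance Definition _ :=
  GRing.isSemilinear.Build A V quo_by _ quo_pi
    (GRing.semilinear_linear quo_pi_linear).

End Submodules.

Section CompositionSeries.
Variable A : pzRingType.

Definition isomorphic (V W : lmodType A) : Prop :=
  exists f : {linear V -> W}, bijective f.

Definition simple (V : lmodType A) : Prop :=
  (exists v : V, v != 0) /\
  forall S : submodule V, (forall v, v \in S -> v = 0) \/ (forall v, v \in S).

Definition reducible (V : lmodType A) : Prop :=
  exists S : submodule V,
    (exists2 v, v \in S & v != 0) /\ (exists v, v \notin S).

Variable V : lmodType A.

Definition maximal (N : submodule V) : Prop :=
  (exists v, v \notin N) /\
  forall S : submodule V, {subset N <= S} -> S =i N \/ (forall v, v \in S).

(* quo_by N is then the unique simple quotient of V *)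
Definition unique_maximal (N : submodule V) : Prop :=
  maximal N /\ forall N', maximal N' -> N' =i N.

Fact sub_inter_closed (S T : submodule V) :
  submod_closed [pred x : sub_of T | sub_val x \in S].
Proof.
split=> [|a x y]; rewrite !inE /= ?rpred0 // => xS yS.
by rewrite rpredD // rpredZ.
Qed.
Definition sub_inter (S T : submodule V) : submodule (sub_of T) :=
  Submodule (sub_inter_closed S T).

(* T / S, meant for submodules S \subset T *)
Definition factor (S T : submodule V) : lmodType A := quo_by (sub_inter S T).

Definition composition_series (l : nat) (M : nat -> submodule V) : Prop :=
  [/\ forall v, (v \in M 0%N) = (v == 0),
      forall v, v \in M l
    & forall i, (i < l)%N ->
        {subset M i <= M i.+1} /\ simple (factor (M i) (M i.+1))].

End CompositionSeries.

Section RingQuotient.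
Variables (A : pzRingType) (S : A -> Prop).

Inductive ideal_gen : A -> Prop :=
| IdealIn x of S x : ideal_gen x
| Ideal0 : ideal_gen 0
| IdealB x y of ideal_gen x & ideal_gen y : ideal_gen (x - y)
| IdealMl a x of ideal_gen x : ideal_gen (a * x)
| IdealMr a x of ideal_gen x : ideal_gen (x * a).

Definition ideal : {pred A} := fun x => `[< ideal_gen x >].

Lemma idealP x : reflect (ideal_gen x) (x \in ideal).
Proof. exact: asboolP. Qed.

Fact ideal_zmod_closed : zmod_closed ideal.
Proof.
split=> [|x y /idealP Ix /idealP Iy]; apply/idealP; first exact: Ideal0.
exact: IdealB.
Qed.
HB.instance Definition _ := GRing.isZmodClosed.Build A ideal ideal_zmod_closed.

Definition rquo := {ideal_quot ideal}.
HB.instance Definition _ := GRing.Zmodule.on rquo.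
Fact rquo_key : unit. Proof. by []. Qed.
Definition rquo_pi : A -> rquo :=
  locked_with rquo_key \pi_({ideal_quot ideal}).

Lemma rquo_piP x y : rquo_pi x = rquo_pi y <-> ideal_gen (x - y).
Proof.
have := Quotient.idealrBE ideal x y => E; rewrite /rquo_pi locked_withE; split.
  by move/eqP; rewrite -[_ == _]E => /idealP.
by move/idealP; rewrite E => /eqP.
Qed.

Lemma rquo_piK (x : rquo) : rquo_pi (repr x) = x.
Proof. by rewrite /rquo_pi locked_withE; exact: reprK. Qed.

Lemma rquo_piB x y : rquo_pi (x - y) = rquo_pi x - rquo_pi y.
Proof. by rewrite /rquo_pi locked_withE raddfB. Qed.

Lemma rquo_piD x y : rquo_pi (x + y) = rquo_pi x + rquo_pi y.
Proof. by rewrite /rquo_pi locked_withE raddfD. Qed.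

Lemma rquo_pi_in x : S x -> rquo_pi x = 0.
Proof.
move=> Sx; rewrite -(subrr (rquo_pi 0)) -rquo_piB subr0.
by apply/rquo_piP; rewrite subr0; apply: IdealIn.
Qed.

Definition rquo_one : rquo := rquo_pi 1.
Definition rquo_mul : rquo -> rquo -> rquo :=
  locked_with rquo_key (fun x y => rquo_pi (repr x * repr y)).

Lemma rquo_mulE x y : rquo_mul (rquo_pi x) (rquo_pi y) = rquo_pi (x * y).
Proof.
rewrite /rquo_mul locked_withE; apply/rquo_piP; set x' := repr _; set y' := repr _.
have -> : x' * y' - x * y = x' * (y' - y) - (x - x') * y.
  by rewrite mulrBr mulrBl opprB addrA subrK.
by apply: IdealB; [apply: IdealMl|apply: IdealMr]; apply/rquo_piP;
  rewrite rquo_piK.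
Qed.

Fact rquo_mulA : associative rquo_mul.
Proof.
move=> x y z; rewrite -(rquo_piK x) -(rquo_piK y) -(rquo_piK z).
by rewrite !rquo_mulE mulrA.
Qed.
Fact rquo_mul1r : left_id rquo_one rquo_mul.
Proof. by move=> x; rewrite -(rquo_piK x) rquo_mulE mul1r. Qed.
Fact rquo_mulr1 : right_id rquo_one rquo_mul.
Proof. by move=> x; rewrite -(rquo_piK x) rquo_mulE mulr1. Qed.
Fact rquo_mulDl : left_distributive rquo_mul +%R.
Proof.
move=> x y z; rewrite -(rquo_piK x) -(rquo_piK y) -(rquo_piK z).
by rewrite -rquo_piD !rquo_mulE -rquo_piD mulrDl.
Qed.
Fact rquo_mulDr : right_distributive rquo_mul +%R.
Proof.
move=> x y z; rewrite -(rquo_piK x) -(rquo_piK y) -(rquo_piK z).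
by rewrite -rquo_piD !rquo_mulE -rquo_piD mulrDr.
Qed.
HB.instance Definition _ := GRing.Zmodule_isPzRing.Build rquo
  rquo_mulA rquo_mul1r rquo_mulr1 rquo_mulDl rquo_mulDr.

HB.instance Definition _ := GRing.isZmodMorphism.Build A rquo rquo_pi rquo_piB.
Fact rquo_pi_monoid : monoid_morphism rquo_pi.
Proof. by split=> // x y; rewrite -rquo_mulE. Qed.
HB.instance Definition _ :=
  GRing.isMonoidMorphism.Build A rquo rquo_pi rquo_pi_monoid.

Lemma rquo_piM x y : rquo_pi (x * y) = rquo_pi x * rquo_pi y.
Proof. exact: rmorphM. Qed.

Section Lift.
Variables (B : pzRingType) (f : {rmorphism A -> B}).
Hypothesis fS : forall x, S x -> f x = 0.

Lemma ideal_gen_ker x : ideal_gen x -> f x = 0.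
Proof.
elim=> {x} [x /fS //||x y _ fx _ fy|a x _ fx|a x _ fx]; first exact: rmorph0.
- by rewrite rmorphB fx fy subrr.
- by rewrite rmorphM fx mulr0.
- by rewrite rmorphM fx mul0r.
Qed.

Definition rquo_lift of (forall x, S x -> f x = 0) := fun x : rquo => f (repr x).

Lemma rquo_liftE x : rquo_lift fS (rquo_pi x) = f x.
Proof.
apply/eqP; rewrite -subr_eq0 -rmorphB; apply/eqP/ideal_gen_ker.
by apply/rquo_piP; rewrite rquo_piK.
Qed.

Fact rquo_lift_zmod : zmod_morphism (rquo_lift fS).
Proof.
move=> x y; rewrite -(rquo_piK x) -(rquo_piK y) -rquo_piB !rquo_liftE.
exact: rmorphB.
Qed.
Fact rquo_lift_monoid : monoid_morphism (rquo_lift fS).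
Proof.
split=> [|x y]; first by rewrite -[1]/(rquo_pi 1) rquo_liftE rmorph1.
rewrite -(rquo_piK x) -(rquo_piK y) -rmorphM !rquo_liftE.
exact: rmorphM.
Qed.
HB.instance Definition _ := GRing.isZmodMorphism.Build rquo B
  (rquo_lift fS) rquo_lift_zmod.
HB.instance Definition _ := GRing.isMonoidMorphism.Build rquo B
  (rquo_lift fS) rquo_lift_monoid.
End Lift.
End RingQuotient.

Section LinearExtension.
Variables (T : choiceType) (G V : zmodType) (F : T -> G -> V).
Hypothesis Fadd : forall t, zmod_morphism (F t).

Definition malg_ext (x : {malg G[T]}) : V := \sum_(t <- msupp x) F t x@_t.

Let F0 t : F t 0 = 0.
Proof. by rewrite -(subrr 0) Fadd subrr. Qed.

Lemma malg_extw (d : {fset T}) x :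
  (msupp x `<=` d)%fset -> malg_ext x = \sum_(t <- d) F t x@_t.
Proof.
by move=> le; rewrite [LHS](big_fset_incl _ le) => //= t _ /mcoeff_outdom ->.
Qed.

Lemma malg_extU t c : malg_ext << c *g t >> = F t c.
Proof. by rewrite (malg_extw msuppU_le) big_seq_fset1 mcoeffUU. Qed.

Lemma malg_ext_zmod : zmod_morphism malg_ext.
Proof.
move=> x y; set d := (msupp x `|` msupp y)%fset.
rewrite (@malg_extw d x) ?fsubsetUl // (@malg_extw d y) ?fsubsetUr //.
rewrite (@malg_extw d (x - y)) ?msuppB_le // -sumrB.
by apply: eq_bigr => t _; rewrite mcoeffB Fadd.
Qed.
End LinearExtension.

Section ExtensionOfScalars.
Variables (B A : pzRingType) (f : {rmorphism B -> A}) (M : lmodType B).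

(* The free abelian group on the symbols << (a, m) >>, i.e. a (x) m. *)
Let F := {malg int[(A * M)%type]}.

Inductive tensor_rel : F -> Prop :=
| TensorDl a a' m :
    tensor_rel (<< (a + a', m) >> - << (a, m) >> - << (a', m) >>)
| TensorDr a m m' :
    tensor_rel (<< (a, m + m') >> - << (a, m) >> - << (a, m') >>)
| TensorBalanced a b m :
    tensor_rel (<< (a * f b, m) >> - << (a, b *: m) >>).

Inductive tensor_gen : F -> Prop :=
| TensorIn x of tensor_rel x : tensor_gen x
| Tensor0 : tensor_gen 0
| TensorB x y of tensor_gen x & tensor_gen y : tensor_gen (x - y).

Definition tensor_ker : {pred F} := fun x => `[< tensor_gen x >].

Lemma tensor_kerP x : reflect (tensor_gen x) (x \in tensor_ker).
Proof. exact: asboolP. Qed.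

Fact tensor_ker_zmod_closed : zmod_closed tensor_ker.
Proof.
split=> [|x y /tensor_kerP Ix /tensor_kerP Iy]; apply/tensor_kerP.
  exact: Tensor0.
exact: TensorB.
Qed.
HB.instance Definition _ :=
  GRing.isZmodClosed.Build F tensor_ker tensor_ker_zmod_closed.

Definition tensor := {ideal_quot tensor_ker}.
HB.instance Definition _ := GRing.Zmodule.on tensor.

Fact tensor_key : unit. Proof. by []. Qed.
Definition tensor_pi : F -> tensor :=
  locked_with tensor_key \pi_({ideal_quot tensor_ker}).
Definition pure_tensor : A -> M -> tensor :=
  locked_with tensor_key (fun a m => tensor_pi << (a, m) >>).

Lemma tensor_piP x y : tensor_pi x = tensor_pi y <-> tensor_gen (x - y).
Proof.
have := Quotient.idealrBE tensor_ker x y => E.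
rewrite /tensor_pi locked_withE; split.
  by move/eqP; rewrite -[_ == _]E => /tensor_kerP.
by move/tensor_kerP; rewrite E => /eqP.
Qed.

Lemma tensor_piK (x : tensor) : tensor_pi (repr x) = x.
Proof. by rewrite /tensor_pi locked_withE; exact: reprK. Qed.

Lemma pure_tensorE a m : pure_tensor a m = tensor_pi << (a, m) >>.
Proof. by rewrite /pure_tensor locked_withE. Qed.

Lemma tensor_piB x y : tensor_pi (x - y) = tensor_pi x - tensor_pi y.
Proof. by rewrite /tensor_pi locked_withE raddfB. Qed.
Fact tensor_pi_zmod : zmod_morphism tensor_pi.
Proof. exact: tensor_piB. Qed.
HB.instance Definition _ :=
  GRing.isZmodMorphism.Build F tensor tensor_pi tensor_pi_zmod.

Lemma tensor_pi_in x : tensor_rel x -> tensor_pi x = 0.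
Proof.
move=> Sx; rewrite -(raddf0 tensor_pi); apply/tensor_piP.
by rewrite subr0; apply: TensorIn.
Qed.

Lemma pure_tensorDl a a' m :
  pure_tensor (a + a') m = pure_tensor a m + pure_tensor a' m.
Proof.
apply/eqP; rewrite -subr_eq0 !pure_tensorE opprD addrA -!tensor_piB.
by rewrite tensor_pi_in //; exact: TensorDl.
Qed.

Lemma pure_tensorDr a m m' :
  pure_tensor a (m + m') = pure_tensor a m + pure_tensor a m'.
Proof.
apply/eqP; rewrite -subr_eq0 !pure_tensorE opprD addrA -!tensor_piB.
by rewrite tensor_pi_in //; exact: TensorDr.
Qed.

Lemma pure_tensor_balanced a b m :
  pure_tensor (a * f b) m = pure_tensor a (b *: m).
Proof.
apply/eqP; rewrite -subr_eq0 !pure_tensorE -tensor_piB.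
by rewrite tensor_pi_in //; exact: TensorBalanced.
Qed.

Lemma tensor_ind (P : tensor -> Prop) :
    P 0 -> (forall x y, P x -> P y -> P (x - y)) ->
    (forall a m, P (pure_tensor a m)) ->
  forall x, P x.
Proof.
move=> P0 PB Pp x; rewrite -(tensor_piK x); move: (repr x) => {}x.
have PN y : P y -> P (- y) by move=> Py; rewrite -sub0r; apply: (PB).
have PD y z : P y -> P z -> P (y + z).
  by move=> Py Pz; rewrite -[z]opprK; apply: (PB) => //; apply: (PN).
rewrite (monalgE x) raddf_sum; elim/big_rec: _ => //= t y _ Py.
apply: (PD) => //; case: t => a m.
have PMn n : P (tensor_pi << n%:Z *g (a, m) >>).
  elim: n => [|n IHn]; first by rewrite monalgU0 raddf0.
  rewrite -addn1 PoszD raddfD /= raddfD /=.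
  by apply: (PD) => //; rewrite -pure_tensorE; apply: (Pp).
case: (x@_(a, m)) => n //.
by rewrite NegzE !raddfN /=; apply: (PN).
Qed.

Definition tensor_smul_sym (a : A) (t : A * M) (c : int) : F :=
  << c *g (a * t.1, t.2) >>.

Fact tensor_smul_sym_zmod a t : zmod_morphism (tensor_smul_sym a t).
Proof. by move=> c d; rewrite /tensor_smul_sym raddfB. Qed.

Definition tensor_smul : A -> tensor -> tensor := locked_with tensor_key
  (fun a x => tensor_pi (malg_ext (tensor_smul_sym a) (repr x))).

Lemma tensor_smul_gen a x :
  tensor_gen x -> tensor_gen (malg_ext (tensor_smul_sym a) x).
Proof.
pose g := malg_ext (tensor_smul_sym a).
have gB y z : g (y - z) = g y - g z.
  exact/malg_ext_zmod/tensor_smul_sym_zmod.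
have gU t : g << t >> = << (a * t.1, t.2) >>.
  by rewrite /g malg_extU //; exact: tensor_smul_sym_zmod.
rewrite -/(g x); elim=> {x} [_ [a1 a2 m|a1 m m'|a1 b m]||x y _ gx _ gy].
- by rewrite !gB !gU /= mulrDr; apply/TensorIn/TensorDl.
- by rewrite !gB !gU /=; apply/TensorIn/TensorDr.
- by rewrite !gB !gU /= mulrA; apply/TensorIn/TensorBalanced.
- by rewrite -(subrr 0) gB subrr; apply: Tensor0.
- by rewrite gB; apply: TensorB.
Qed.

Lemma tensor_smul_pi a x :
  tensor_smul a (tensor_pi x) = tensor_pi (malg_ext (tensor_smul_sym a) x).
Proof.
rewrite /tensor_smul locked_withE; apply/tensor_piP.
rewrite -malg_ext_zmod; last exact: tensor_smul_sym_zmod.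
by apply/tensor_smul_gen/tensor_piP; rewrite tensor_piK.
Qed.

Lemma tensor_smulE a a' m :
  tensor_smul a (pure_tensor a' m) = pure_tensor (a * a') m.
Proof.
by rewrite !pure_tensorE tensor_smul_pi malg_extU //; exact: tensor_smul_sym_zmod.
Qed.

Fact tensor_smulB a : zmod_morphism (tensor_smul a).
Proof.
move=> x y; rewrite -(tensor_piK x) -(tensor_piK y) -tensor_piB !tensor_smul_pi.
by rewrite malg_ext_zmod ?tensor_piB //; exact: tensor_smul_sym_zmod.
Qed.
Let tensor_smul0 a : tensor_smul a 0 = 0.
Proof. by rewrite -(subrr 0) tensor_smulB !subrr. Qed.

Fact tensor_smulA a b x :
  tensor_smul a (tensor_smul b x) = tensor_smul (a * b) x.
Proof.
elim/tensor_ind: x => [|x y Ex Ey|a' m]; first by rewrite !tensor_smul0.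
  by rewrite !tensor_smulB Ex Ey.
by rewrite !tensor_smulE mulrA.
Qed.
Fact tensor_smul1 : left_id 1 tensor_smul.
Proof.
elim/tensor_ind=> [|x y Ex Ey|a' m]; first by rewrite !tensor_smul0.
  by rewrite !tensor_smulB Ex Ey.
by rewrite !tensor_smulE mul1r.
Qed.
Fact tensor_smulDr : right_distributive tensor_smul +%R.
Proof.
move=> a x y; have tN z : tensor_smul a (- z) = - tensor_smul a z.
  by rewrite -sub0r tensor_smulB tensor_smul0 sub0r.
by rewrite -{1}[y]opprK tensor_smulB tN opprK.
Qed.
Fact tensor_smulDl x : {morph tensor_smul^~ x : a b / a + b}.
Proof.
move=> a b /=; elim/tensor_ind: x => [|x y Ex Ey|a' m].
- by rewrite !tensor_smul0 addr0.
- by rewrite !tensor_smulB Ex Ey opprD addrACA.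
- by rewrite !tensor_smulE mulrDl pure_tensorDl.
Qed.
HB.instance Definition _ := GRing.Zmodule_isLmodule.Build A tensor
  tensor_smulA tensor_smul1 tensor_smulDr tensor_smulDl.

End ExtensionOfScalars.

Section RestrictedLie.
Variables (K : fieldType) (n p : nat).

(* A restricted Lie subalgebra of gl_n(K), for p the characteristic of K: its
   bracket is the commutator and its p-map is the p-th matrix power. *)
Record rLieAlg := RLieAlg {
  rl_space :> {vspace 'M[K]_n};
  rl_brP : forall x y, x \in rl_space -> y \in rl_space ->
    x *m y - y *m x \in rl_space;
  rl_powP : forall x, x \in rl_space -> x ^+ p \in rl_space }.

Variable g : rLieAlg.
Implicit Types x y : subvs_of g.

Definition bracket x y : subvs_of g := Subvs (rl_brP (subvsP x) (subvsP y)).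
Definition ppow x : subvs_of g := Subvs (rl_powP (subvsP x)).

(* U(g) = T(g) / (x y - y x - [x, y]) is presented as the quotient of the free
   associative unital K-algebra on the set g by the relations making g -> U(g)
   K-linear and compatible with brackets. *)
Definition free_alg := {malg K[{fmonom (subvs_of g)}]}.
HB.instance Definition _ := GRing.NzRing.on free_alg.
Fact free_key : unit. Proof. by []. Qed.
Definition free_gen : subvs_of g -> free_alg :=
  locked_with free_key (fun x => << fmu x >>).
Definition free_scal : K -> free_alg := locked_with free_key malgC.

Lemma free_genE x : free_gen x = << fmu x >>.
Proof. by rewrite /free_gen locked_withE. Qed.
Lemma free_scalE c : free_scal c = c%:MP.
Proof. by rewrite /free_scal locked_withE. Qed.

Inductive U_rel : free_alg -> Prop :=
| U_linear c x y :
    U_rel (free_gen (c *: x + y) - (free_scal c * free_gen x + free_gen y))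
| U_bracket x y :
    U_rel (free_gen x * free_gen y - free_gen y * free_gen x
           - free_gen (bracket x y)).

Definition U := rquo U_rel.
HB.instance Definition _ := GRing.PzRing.on U.
Definition U_gen x : U := rquo_pi U_rel (free_gen x).
Definition U_scal (c : K) : U := rquo_pi U_rel (free_scal c).

Variable chi : 'Hom(subvs_of g, K^o).

Inductive Uchi_rel : U -> Prop :=
| Uchi_ppow x :
    Uchi_rel (U_gen x ^+ p - U_gen (ppow x) - U_scal ((chi x : K) ^+ p)).

Definition Uchi := rquo Uchi_rel.
HB.instance Definition _ := GRing.PzRing.on Uchi.
Definition Uchi_gen x : Uchi := rquo_pi Uchi_rel (U_gen x).
Definition Uchi_scal (c : K) : Uchi := rquo_pi Uchi_rel (U_scal c).

Fact Uchi_scal_zmod : zmod_morphism Uchi_scal.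
Proof. by move=> c d; rewrite /Uchi_scal /U_scal !free_scalE !rmorphB. Qed.
HB.instance Definition _ :=
  GRing.isZmodMorphism.Build K Uchi Uchi_scal Uchi_scal_zmod.
Fact Uchi_scal_monoid : monoid_morphism Uchi_scal.
Proof.
by split=> [|c d]; rewrite /Uchi_scal /U_scal !free_scalE;
  [rewrite !rmorph1|rewrite !rmorphM].
Qed.
HB.instance Definition _ :=
  GRing.isMonoidMorphism.Build K Uchi Uchi_scal Uchi_scal_monoid.

Lemma U_gen_linear c x y : U_gen (c *: x + y) = U_scal c * U_gen x + U_gen y.
Proof.
rewrite /U_gen /U_scal -rquo_piM -rquo_piD.
by apply/rquo_piP/IdealIn/U_linear.
Qed.

Lemma U_gen_bracket x y :
  U_gen (bracket x y) = U_gen x * U_gen y - U_gen y * U_gen x.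
Proof.
rewrite /U_gen -!rquo_piM -rquo_piB.
by apply/esym/rquo_piP/IdealIn/U_bracket.
Qed.

Lemma U_scal_central c x : U_scal c * U_gen x = U_gen x * U_scal c.
Proof.
have E : free_scal c * free_gen x = free_gen x * free_scal c.
  rewrite free_genE free_scalE [LHS]fgmulUU [RHS]fgmulUU mul1r mulr1.
  by rewrite mul1m mulm1.
by rewrite /U_gen /U_scal -rquo_piM E rquo_piM.
Qed.

Lemma Uchi_gen_linear c x y :
  Uchi_gen (c *: x + y) = Uchi_scal c * Uchi_gen x + Uchi_gen y.
Proof. by rewrite /Uchi_gen U_gen_linear rquo_piD rquo_piM. Qed.

Lemma Uchi_gen_bracket x y :
  Uchi_gen (bracket x y) = Uchi_gen x * Uchi_gen y - Uchi_gen y * Uchi_gen x.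
Proof.
rewrite /Uchi_gen U_gen_bracket rquo_piB.
by rewrite (rquo_piM _ (U_gen x)) (rquo_piM _ (U_gen y)).
Qed.

Lemma Uchi_gen_ppow x :
  Uchi_gen x ^+ p - Uchi_gen (ppow x) = Uchi_scal ((chi x : K) ^+ p).
Proof.
rewrite /Uchi_gen -rmorphXn -rquo_piB.
by apply/rquo_piP/IdealIn/Uchi_ppow.
Qed.

Lemma Uchi_scal_central c x :
  Uchi_scal c * Uchi_gen x = Uchi_gen x * Uchi_scal c.
Proof.
rewrite /Uchi_scal /Uchi_gen -(rquo_piM _ (U_scal c)) U_scal_central.
by rewrite (rquo_piM _ (U_gen x)).
Qed.

Section Lift.
Variables (S : pzRingType) (phi : {rmorphism K -> S}) (h : subvs_of g -> S).

Definition Uchi_compatible : Prop :=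
  [/\ forall c x, phi c * h x = h x * phi c,
      forall c x y, h (c *: x + y) = phi c * h x + h y,
      forall x y, h (bracket x y) = h x * h y - h y * h x
    & forall x, h x ^+ p - h (ppow x) = phi ((chi x : K) ^+ p)].

Hypothesis hP : Uchi_compatible.

Definition free_term (m : {fmonom (subvs_of g)}) (c : K) : S :=
  phi c * \prod_(x <- fmonom_val m) h x.

Fact free_term_zmod m : zmod_morphism (free_term m).
Proof. by move=> c d; rewrite /free_term rmorphB mulrBl. Qed.

Definition free_lift of Uchi_compatible : free_alg -> S := malg_ext free_term.

Fact free_lift_zmod : zmod_morphism (free_lift hP).
Proof. exact/malg_ext_zmod/free_term_zmod. Qed.
HB.instance Definition _ := GRing.isZmodMorphism.Build free_alg S
  (free_lift hP) free_lift_zmod.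

Fact free_lift_monoid : monoid_morphism (free_lift hP).
Proof.
have liftU m c : free_lift hP << c *g m >> = free_term m c.
  exact/malg_extU/free_term_zmod.
split=> [|x y].
  by rewrite liftU /free_term rmorph1 mul1r fm1 big_nil.
rewrite [in LHS]malgME raddf_sum /= [in RHS]/free_lift /malg_ext.
rewrite mulr_suml; apply: eq_bigr => k _.
rewrite raddf_sum /= mulr_sumr; apply: eq_bigr => l _.
rewrite liftU /free_term rmorphM fmM big_cat /= !mulrA; congr (_ * _).
rewrite -!mulrA; congr (_ * _).
have [cP _ _ _] := hP.
elim/big_rec: _ => [|z u _ Eu]; first by rewrite mulr1 mul1r.
by rewrite mulrA cP -!mulrA Eu.
Qed.
HB.instance Definition _ := GRing.isMonoidMorphism.Build free_alg S
  (free_lift hP) free_lift_monoid.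

Lemma free_lift_gen x : free_lift hP (free_gen x) = h x.
Proof.
rewrite free_genE /free_lift malg_extU; last exact: free_term_zmod.
by rewrite /free_term rmorph1 mul1r fmU big_seq1.
Qed.

Lemma free_lift_scal c : free_lift hP (free_scal c) = phi c.
Proof.
rewrite free_scalE /free_lift malg_extU; last exact: free_term_zmod.
by rewrite /free_term fm1 big_nil mulr1.
Qed.

Fact free_lift_rel (x : free_alg) : U_rel x -> free_lift hP x = 0.
Proof.
have [_ linP brP _] := hP; pose f : {rmorphism _ -> _} := free_lift hP.
have fM a b : f (free_gen a * free_gen b) = h a * h b.
  by rewrite rmorphM; congr (_ * _); exact: free_lift_gen.
case=> [c y z|y z].
  have E : f (free_scal c * free_gen y + free_gen z) = phi c * h y + h z.
    rewrite rmorphD rmorphM; congr (_ * _ + _).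
    + exact: free_lift_scal.
    + exact: free_lift_gen.
    + exact: free_lift_gen.
  transitivity (f (free_gen (c *: y + z))
                - f (free_scal c * free_gen y + free_gen z)).
    exact: (rmorphB f).
  by rewrite E -linP -free_lift_gen subrr.
transitivity (f (free_gen y * free_gen z - free_gen z * free_gen y)
              - f (free_gen (bracket y z))); first exact: (rmorphB f).
transitivity (h y * h z - h z * h y - h (bracket y z)); last first.
  by rewrite brP subrr.
congr (_ - _); last exact: free_lift_gen.
by rewrite (rmorphB f); congr (_ - _); apply: fM.
Qed.

Definition U_lift : {rmorphism U -> S} := rquo_lift free_lift_rel.

Fact U_lift_rel (x : U) : Uchi_rel x -> U_lift x = 0.
Proof.
have [_ _ _ powP] := hP.
have lE u : U_lift (rquo_pi U_rel u) = free_lift hP u by exact: rquo_liftE.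
case=> y; rewrite !rmorphB rmorphXn [U_lift (U_gen y)]lE.
rewrite [U_lift (U_gen (ppow y))]lE [U_lift (U_scal _)]lE.
by rewrite !free_lift_gen free_lift_scal powP subrr.
Qed.

Definition Uchi_lift : {rmorphism Uchi -> S} := rquo_lift U_lift_rel.

Lemma Uchi_lift_gen x : Uchi_lift (Uchi_gen x) = h x.
Proof.
transitivity (U_lift (U_gen x)); first exact: rquo_liftE.
transitivity (free_lift hP (free_gen x)); first exact: rquo_liftE.
exact: free_lift_gen.
Qed.

Lemma Uchi_lift_scal c : Uchi_lift (Uchi_scal c) = phi c.
Proof.
transitivity (U_lift (U_scal c)); first exact: rquo_liftE.
transitivity (free_lift hP (free_scal c)); first exact: rquo_liftE.
exact: free_lift_scal.
Qed.

End Lift.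
End RestrictedLie.

Section Restriction.
Variables (K : fieldType) (n p : nat) (b g : rLieAlg K n p).
Hypothesis sub_bg : (b <= g)%VS.
Variable chi : 'Hom(subvs_of g, K^o).

Definition incl (x : subvs_of b) : subvs_of g := vsproj g (vsval x).

Lemma inclK x : vsval (incl x) = vsval x.
Proof. by rewrite vsprojK //; apply: subvP (subvsP x). Qed.

Hypothesis chi_b : forall x : subvs_of b, chi (incl x) = 0.

Fact incl_compatible :
  Uchi_compatible (0 : 'Hom(subvs_of b, K^o))
    (Uchi_scal chi) (fun x => Uchi_gen chi (incl x)).
Proof.
split=> [c x|c x y|x y|x].
- exact: Uchi_scal_central.
- by rewrite /incl !linearP /= Uchi_gen_linear.
- rewrite -Uchi_gen_bracket; congr Uchi_gen.
  by apply: val_inj; rewrite /= inclK /= !inclK.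
- have -> : incl (ppow x) = ppow (incl x).
    by apply: val_inj; rewrite /= inclK /= !inclK.
  by rewrite Uchi_gen_ppow chi_b lfunE.
Qed.

(* The morphism U_0(b) -> U_chi(g) induced by b \subset g; it exists because
   chi vanishes on b. *)
Definition U0_incl :
    {rmorphism Uchi (0 : 'Hom(subvs_of b, K^o)) -> Uchi chi} :=
  Uchi_lift incl_compatible.

End Restriction.

Section TracePower.
Variables (K : fieldType) (p : nat).
Hypothesis hp : p \in [pchar K].

Lemma poly_ppow (P : {poly K}) :
  P ^+ p = (map_poly (fun c => c ^+ p) P) \Po 'X^p.
Proof.
have hP : p \in [pchar {poly K}] by exact: (rmorph_pchar (polyC : {rmorphism K -> {poly K}}) hp).
have -> : P ^+ p = pFrobenius_aut hP P by [].
rewrite -{1}[P]coefK poly_def rmorph_sum /map_poly poly_def linear_sum /=.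
apply: eq_bigr => i _.
rewrite pFrobenius_autE exprZn -exprM mulnC exprM.
by rewrite linearZ /= comp_Xn_poly.
Qed.

Lemma mxtrace_ppow n (A : 'M[K]_n) : \tr (A ^+ p) = (\tr A) ^+ p.
Proof.
have p_gt0 := prime_gt0 (pcharf_prime hp); case: n A => [|n] A.
  by rewrite /mxtrace !big_ord0 expr0n gtn_eqF.
have hM : p \in [pchar 'M[{poly K}]_n.+1].
  have hP : p \in [pchar {poly K}] by exact: (rmorph_pchar (polyC : {rmorphism K -> {poly K}}) hp).
  exact: (rmorph_pchar (scalar_mx : {rmorphism {poly K} -> 'M[{poly K}]_n.+1}) hP).
have detX (B : 'M[{poly K}]_n.+1) k : \det (B ^+ k) = (\det B) ^+ k.
  by elim: k => [|k IHk]; rewrite ?expr0 ?det1 // !exprS det_mulmx IHk.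
have E : char_poly A ^+ p = char_poly (A ^+ p) \Po 'X^p.
  rewrite /char_poly -detX -[RHS]/(comp_poly 'X^p _) -det_map_mx.
  congr (\det _); rewrite -(pFrobenius_autE hM) pFrobenius_autB_comm; last first.
    exact/esym/scalar_mxC.
  rewrite !pFrobenius_autE /char_poly_mx map_mxB map_scalar_mx /= comp_polyX.
  rewrite -!rmorphXn /=; congr (_ - _).
  by apply/matrixP => i j; rewrite !mxE comp_polyC.
have /(congr1 (fun P : {poly K} => P`_(n * p))) := E.
rewrite poly_ppow !coef_comp_poly_Xn // dvdn_mull // mulnK //.
rewrite coef_map_id0 ?expr0n ?gtn_eqF //.
rewrite -[n in _`_n]/(n.+1.-1) !char_poly_trace //.
by rewrite -!(pFrobenius_autE hp) rmorphN => /oppr_inj.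
Qed.

End TracePower.

Section SpecialLinear.
Variables (K : fieldType) (n p : nat).

Definition sl_space : {vspace 'M[K]_n} :=
  lker (linfun (mxtrace : 'M[K]_n -> K^o)).
Definition diag_space : {vspace 'M[K]_n} :=
  limg (linfun (diag_mx : 'rV[K]_n -> 'M[K]_n)).
Definition h_space : {vspace 'M[K]_n} := (sl_space :&: diag_space)%VS.
Definition b_space : {vspace 'M[K]_n} :=
  (h_space + \sum_(i < n) \sum_(j < n | (i < j)%N) <[delta_mx i j]>)%VS.

Lemma mem_sl A : (A \in sl_space) = (\tr A == 0).
Proof. by rewrite memv_ker lfunE. Qed.

Lemma mem_diag A : (A \in diag_space) = is_diag_mx A.
Proof.
apply/memv_imgP/is_diag_mxP => [[d _ ->]|Ad].
  by move=> i j ij; rewrite lfunE mxE (_ : (i == j) = false) //; apply/negbTE.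
exists (\row_i A i i); rewrite ?memvf // lfunE /=.
apply/matrixP => i j; rewrite !mxE.
by case: eqP => [->|/eqP ij]; rewrite ?mulr1n // mulr0n Ad.
Qed.

Lemma mem_h A : (A \in h_space) = (\tr A == 0) && is_diag_mx A.
Proof. by rewrite memv_cap mem_sl mem_diag. Qed.

Lemma mem_b A : (A \in b_space) = (\tr A == 0) && is_trig_mx A^T.
Proof.
apply/memv_addP/andP => [[D hD [N /memv_sumP[f fP ->] ->]]|[trA /is_trig_mxP tA]].
  have {}fP i : exists2 c : 'I_n -> K, True &
      f i = \sum_(j < n | (i < j)%N) c j *: delta_mx i j.
    have /memv_sumP[e eP ->] := fP i isT.
    have /fin_all_exists[c cP] : forall j : 'I_n, exists c : K,
        (i < j)%N -> e j = c *: delta_mx i j.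
      move=> j; case: (boolP (i < j)%N) => [ij|_]; last by exists 0.
      by have /vlineP[c ->] := eP j ij; exists c.
    by exists c => //; apply: eq_bigr => j /cP.
  move: hD; rewrite mem_h => /andP[/eqP trD /is_diag_mxP dD].
  have f0 i (k l : 'I_n) : (l <= k)%N -> f i k l = 0.
    move=> lk; have [c _ ->] := fP i; rewrite summxE big1 // => j ij.
    rewrite !mxE; case: eqP => [ki|]; last by rewrite mulr0.
    case: eqP => [lj|]; last by rewrite mulr0.
    by move: lk; rewrite ki lj leqNgt ij.
  split.
    rewrite mxtraceD trD add0r raddf_sum big1 // => i _ /=.
    by rewrite /mxtrace big1 // => k _; apply: f0.
  apply/is_trig_mxP => k l kl; rewrite !mxE dD ?gtn_eqF // add0r.
  by rewrite summxE big1 // => i _; apply: f0; apply: ltnW.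
pose D := diag_mx (\row_i A i i).
exists D.
  rewrite mem_h diag_mx_is_diag andbT (_ : \tr D = \tr A) //.
  by apply: eq_bigr => i _; rewrite !mxE eqxx.
exists (\sum_(i < n) \sum_(j < n | (i < j)%N) A i j *: delta_mx i j).
  apply: memv_sumr => i _; apply: memv_sumr => j ij.
  exact/vlineP/ex_intro.
rewrite {1}[A]matrix_sum_delta /D diag_mx_sum_delta -big_split /=.
apply: eq_bigr => i _; rewrite mxE (bigD1 i) //=; congr (_ + _).
rewrite (bigID (fun j : 'I_n => (i < j)%N)) /= [X in _ + X]big1 ?addr0.
  by apply: eq_bigl => j; apply: andb_idl => ij; rewrite -val_eqE /= gtn_eqF.
move=> j /andP[ji]; rewrite -leqNgt leq_eqVlt -[(_ == _ :> nat)]/(j == i).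
rewrite (negbTE ji) /= => /tA; rewrite mxE => ->.
by rewrite scale0r.
Qed.

Lemma h_sub_b : (h_space <= b_space)%VS.
Proof. exact: addvSl. Qed.

Lemma b_sub_sl : (b_space <= sl_space)%VS.
Proof. by apply/subvP => A; rewrite mem_b mem_sl => /andP[]. Qed.

Lemma mxtrace_commutator (A B : 'M[K]_n) : \tr (A *m B - B *m A) = 0.
Proof. by rewrite raddfB /= mxtrace_mulC subrr. Qed.

Lemma uptri_mul (A B : 'M[K]_n) :
  is_trig_mx A^T -> is_trig_mx B^T -> is_trig_mx (A *m B)^T.
Proof.
move=> /is_trig_mxP tA /is_trig_mxP tB; apply/is_trig_mxP => i j ij.
rewrite !mxE big1 // => k _; case: (ltnP k j) => [kj|jk].
  by have := tA _ _ kj; rewrite mxE => ->; rewrite mul0r.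
by have := tB _ _ (leq_trans ij jk); rewrite mxE => ->; rewrite mulr0.
Qed.

Lemma uptri_mul_diag (A B : 'M[K]_n) i :
  is_trig_mx A^T -> is_trig_mx B^T -> (A *m B) i i = A i i * B i i.
Proof.
move=> /is_trig_mxP tA /is_trig_mxP tB; rewrite mxE (bigD1 i) //= big1 ?addr0 //.
move=> k; rewrite neq_ltn => /orP[ki|ik].
  by have := tA _ _ ki; rewrite mxE => ->; rewrite mul0r.
by have := tB _ _ ik; rewrite mxE => ->; rewrite mulr0.
Qed.

Lemma uptri_exp (A : 'M[K]_n) k :
  is_trig_mx A^T ->
  is_trig_mx (A ^+ k)^T /\ forall i, (A ^+ k) i i = A i i ^+ k.
Proof.
move=> tA; elim: k => [|k [tAk dAk]].
  split=> [|i]; last by rewrite !expr0 mxE eqxx.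
  by rewrite expr0 trmx1; apply/is_diag_mx_is_trig/scalar_mx_is_diag.
rewrite exprS; split=> [|i]; first exact: uptri_mul.
by rewrite uptri_mul_diag // dAk exprS.
Qed.

Hypothesis hp : p \in [pchar K].

Fact sl_br x y : x \in sl_space -> y \in sl_space ->
  x *m y - y *m x \in sl_space.
Proof. by rewrite !mem_sl mxtrace_commutator. Qed.
Fact sl_pow x : x \in sl_space -> x ^+ p \in sl_space.
Proof.
rewrite !mem_sl (mxtrace_ppow hp) => /eqP ->.
by rewrite expr0n gtn_eqF ?prime_gt0 ?(pcharf_prime hp).
Qed.
Definition sl : rLieAlg K n p := RLieAlg sl_br sl_pow.

Fact b_br x y : x \in b_space -> y \in b_space ->
  x *m y - y *m x \in b_space.
Proof.
rewrite !mem_b mxtrace_commutator eqxx /= => /andP[_ tx] /andP[_ ty].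
have /is_trig_mxP t1 := uptri_mul tx ty.
have /is_trig_mxP t2 := uptri_mul ty tx.
apply/is_trig_mxP => i j ij; have := t2 _ _ ij; have := t1 _ _ ij.
by rewrite mxE => E1; rewrite mxE => E2; rewrite mxE mxE E1 mxE E2 subrr.
Qed.
Fact b_pow x : x \in b_space -> x ^+ p \in b_space.
Proof.
move=> xb; have := sl_pow (subvP b_sub_sl _ xb); move: xb.
by rewrite !mem_b mem_sl => /andP[_ tx] ->; have [] := uptri_exp p tx.
Qed.
Definition borel : rLieAlg K n p := RLieAlg b_br b_pow.

Lemma diag_uptri (A : 'M[K]_n) : is_diag_mx A -> is_trig_mx A^T.
Proof. by rewrite is_diag_mxEtrig => /andP[]. Qed.

Fact h_br x y : x \in h_space -> y \in h_space ->
  x *m y - y *m x \in h_space.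
Proof.
rewrite !mem_h mxtrace_commutator eqxx /=.
move=> /andP[_ /diag_mxP[d ->]] /andP[_ /diag_mxP[e ->]].
apply/is_diag_mxP => i j ij.
rewrite !mul_diag_mx !mxE (_ : (i == j) = false); last exact/negbTE.
by rewrite !mulr0n !mulr0 subrr.
Qed.
Fact h_pow x : x \in h_space -> x ^+ p \in h_space.
Proof.
move=> xh; have := b_pow (subvP h_sub_b _ xh); move: xh.
rewrite mem_b !mem_h => /andP[_ dx] /andP[-> tx] /=.
rewrite is_diag_mxEtrig tx andbT -[x ^+ p]trmxK.
have -> : (x ^+ p)^T = (x^T) ^+ p.
  by elim: (p) => [|k IHk]; rewrite ?expr0 ?trmx1 // exprS exprSr trmx_mul IHk.
by have [] := @uptri_exp x^T p; rewrite // trmxK; apply: is_diag_mx_is_trig.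
Qed.
Definition cartan : rLieAlg K n p := RLieAlg h_br h_pow.

Definition eps (i : 'I_n) : 'Hom(subvs_of cartan, K^o) :=
  linfun (fun H : subvs_of cartan => (vsval H i i : K^o)).

Lemma epsE i (H : subvs_of cartan) : eps i H = vsval H i i.
Proof.
have lin : linear (fun H : subvs_of cartan => (vsval H i i : K^o)).
  by move=> c x y; rewrite linearP /= !mxE.
pose f := GRing.isLinear.Build _ _ _ _ _ lin.
pose g : {linear _ -> _} := HB.pack (fun H : subvs_of cartan => (vsval H i i : K^o)) f.
exact: (lfunE g).
Qed.

(* rho = \sum_j (n - j) eps_j, with indices j starting at 1 on paper *)
Definition rho : 'Hom(subvs_of cartan, K^o) :=
  \sum_(j < n) (n - j.+1)%:R *: eps j.

Lemma rhoE (i j : 'I_n) (H : subvs_of cartan) :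
  j = i.+1 :> nat -> vsval H = delta_mx i i - delta_mx j j -> rho H = 1.
Proof.
move=> ji EH; have ne : i != j by rewrite -val_eqE /= ji ltn_eqF.
rewrite /rho sum_lfunE (bigD1 i) //= (bigD1 j) 1?eq_sym //= big1 => [|k /andP[ki kj]].
  rewrite !scale_lfunE !epsE EH !mxE !eqxx (negbTE ne) eq_sym (negbTE ne).
  have jn : (i.+1 < n)%N by rewrite -ji.
  rewrite subr0 sub0r addr0 -![_ *: _]/(_ * _) mulr1 mulrN mulr1 ji.
  by rewrite -(subnSK jn) mulrS addrK.
rewrite scale_lfunE epsE EH !mxE (negbTE ki) (negbTE kj) subrr.
exact: scaler0.
Qed.

(* The permutation w acts on h by moving the w(i)-th diagonal entry of H to the
   i-th place, and on h^* by transport, so that w eps_i = eps_(w i). *)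
Definition weyl_conj (w : 'S_n) (H : subvs_of cartan) : subvs_of cartan :=
  vsproj cartan (row_perm w (col_perm w (vsval H))).
Definition weyl (w : 'S_n) (lam : 'Hom(subvs_of cartan, K^o)) :
    'Hom(subvs_of cartan, K^o) :=
  linfun (fun H => lam (weyl_conj w H)).

Lemma weyl_conjE w (H : subvs_of cartan) i :
  vsval (weyl_conj w H) i i = vsval H (w i) (w i).
Proof.
rewrite vsprojK ?mxE //; have := subvsP H; rewrite /= !mem_h.
move=> /andP[/eqP trH /is_diag_mxP dH]; apply/andP; split; last first.
  by apply/is_diag_mxP => k l kl; rewrite !mxE dH // (inj_eq val_inj) (inj_eq perm_inj).
rewrite -trH /mxtrace [X in _ == X](reindex_inj (@perm_inj _ w)).
by apply/eqP/eq_bigr => k _; rewrite !mxE.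
Qed.

Lemma weylE w lam H : weyl w lam H = lam (weyl_conj w H).
Proof.
have lin : linear (fun H => lam (weyl_conj w H)).
  move=> c x y; rewrite -linearP; congr (lam _); rewrite /weyl_conj -linearP.
  by congr (vsproj _ _); apply/matrixP => k l; rewrite !mxE.
pose f := GRing.isLinear.Build _ _ _ _ _ lin.
pose g : {linear _ -> _} := HB.pack (fun H => lam (weyl_conj w H)) f.
exact: (lfunE g).
Qed.

Lemma weyl_eps w i : weyl w (eps i) = eps (w i).
Proof. by apply/lfunP => H; rewrite weylE !epsE weyl_conjE. Qed.

Definition dot (w : 'S_n) (lam : 'Hom(subvs_of cartan, K^o)) :=
  weyl w (lam + rho) - rho.

Definition in_dot_orbit0 (lam : 'Hom(subvs_of cartan, K^o)) : Prop :=
  exists w : 'S_n, lam = dot w 0.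

(* lam \in X_p *)
Definition restricted_weight (lam : 'Hom(subvs_of cartan, K^o)) : Prop :=
  forall H : subvs_of cartan, (lam H : K) ^+ p = lam (ppow H).

(* The diagonal part of x, i.e. its h-component along the strictly upper
   triangular matrices. *)
Definition diag_part (x : subvs_of borel) : subvs_of cartan :=
  vsproj cartan (diag_mx (\row_i vsval x i i)).

Lemma diag_partK x : vsval (diag_part x) = diag_mx (\row_i vsval x i i).
Proof.
have := subvsP x; rewrite mem_b => /andP[/eqP trx _].
rewrite vsprojK // mem_h diag_mx_is_diag andbT -trx.
by apply/eqP/eq_bigr => i _; rewrite !mxE eqxx.
Qed.

Lemma diag_part_linear : linear diag_part.
Proof.
move=> c x y; apply: val_inj; rewrite [RHS]linearP /= !diag_partK linearP.
apply/matrixP => i j; rewrite !mxE.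
by case: eqP; rewrite ?mulr1n // !mulr0n mulr0 addr0.
Qed.

Lemma diag_part_bracket x y : diag_part (bracket x y) = 0.
Proof.
have := subvsP x; rewrite mem_b => /andP[_ tx].
have := subvsP y; rewrite mem_b => /andP[_ ty].
apply: val_inj; transitivity (0 : 'M[K]_n); last exact/esym/(raddf0 vsval).
rewrite [LHS]diag_partK; apply/matrixP => i j; rewrite 3!mxE /= [RHS]mxE.
rewrite [X in _ + X]mxE !uptri_mul_diag // [X in _ - X]mulrC subrr.
by rewrite mul0rn.
Qed.

Lemma diag_part_ppow x : diag_part (ppow x) = ppow (diag_part x).
Proof.
have := subvsP x; rewrite mem_b => /andP[_ tx].
apply: val_inj; rewrite /= !diag_partK /=.
have [_ dA] := uptri_exp p tx.
have tD : is_trig_mx (diag_mx (\row_i vsval x i i))^T.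
  by apply/diag_uptri/diag_mx_is_diag.
have := h_pow (subvsP (diag_part x)).
rewrite diag_partK mem_h => /andP[_ /is_diag_mxP dD].
have [_ dAD] := uptri_exp p tD.
apply/matrixP => i j; have [<-|ij] := eqVneq i j.
  by rewrite dAD !mxE eqxx !mulr1n dA.
by rewrite dD // !mxE (negbTE ij).
Qed.

Section Klambda.
Variable lam : 'Hom(subvs_of cartan, K^o).
Hypothesis lamP : restricted_weight lam.

Definition b_char (x : subvs_of borel) : K := lam (diag_part x).

Fact b_char_compatible :
  Uchi_compatible (0 : 'Hom(subvs_of borel, K^o)) (idfun : {rmorphism K -> K})
    b_char.
Proof.
split=> [c x|c x y|x y|x] /=.
- exact: mulrC.
- by rewrite /b_char diag_part_linear linearP.
- by rewrite /b_char diag_part_bracket linear0 mulrC subrr.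
- by rewrite /b_char diag_part_ppow -lamP lfunE subrr expr0n gtn_eqF
    ?prime_gt0 ?(pcharf_prime hp).
Qed.

Definition Klambda of restricted_weight lam : Type := K.
HB.instance Definition _ := GRing.Zmodule.copy (Klambda lamP) K.

Definition Klambda_scale
    (u : Uchi (0 : 'Hom(subvs_of borel, K^o))) (k : Klambda lamP) :
    Klambda lamP :=
  (Uchi_lift b_char_compatible u * k : K).

Fact Klambda_scalerA u v k :
  Klambda_scale u (Klambda_scale v k) = Klambda_scale (u * v) k.
Proof. by rewrite /Klambda_scale rmorphM mulrA. Qed.
Fact Klambda_scale1 : left_id 1 Klambda_scale.
Proof. by move=> k; rewrite /Klambda_scale rmorph1; exact: mul1r. Qed.
Fact Klambda_scalerDr : right_distributive Klambda_scale +%R.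
Proof. by move=> u k l; exact: mulrDr. Qed.
Fact Klambda_scalerDl k : {morph Klambda_scale^~ k : u v / u + v}.
Proof. by move=> u v; rewrite /Klambda_scale rmorphD; exact: mulrDl. Qed.
HB.instance Definition _ := GRing.Zmodule_isLmodule.Build _ (Klambda lamP)
  Klambda_scalerA Klambda_scale1 Klambda_scalerDr Klambda_scalerDl.

Lemma Klambda_genE (x : subvs_of borel) (k : Klambda lamP) :
  Uchi_gen 0 x *: k = (b_char x * k : K).
Proof. by rewrite -[LHS]/(Klambda_scale _ _) /Klambda_scale Uchi_lift_gen. Qed.

End Klambda.

(* The root vector X_(eps_i - eps_j) = E_ij of sl_n, for i != j. *)
Definition root_vec (i j : 'I_n) : subvs_of sl := vsproj sl (delta_mx i j).

Lemma root_vecE i j : i != j -> vsval (root_vec i j) = delta_mx i j.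
Proof.
move=> ij; rewrite vsprojK // mem_sl /mxtrace big1 // => k _; rewrite mxE.
by case: eqP => //= ->; rewrite (negbTE ij).
Qed.

(* X_(-alpha_i) = E_(i+1, i) *)
Definition regular_nilpotent (chi : 'Hom(subvs_of sl, K^o)) : Prop :=
  [/\ forall i j : 'I_n, j = i.+1 :> nat -> chi (root_vec j i) = 1,
      forall H : subvs_of sl, vsval H \in h_space -> chi H = 0
    & forall i j : 'I_n, i != j -> i <> j.+1 :> nat -> chi (root_vec i j) = 0].

Fact regular_nilpotent_b0 chi : regular_nilpotent chi ->
  forall x : subvs_of borel, chi (incl sl x) = 0.
Proof.
case=> _ chiH chiX x.
suff : (b_space <= lker (chi \o linfun (vsproj sl)))%VS.
  move/subvP/(_ _ (subvsP x)); rewrite memv_ker => /eqP <-.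
  by rewrite comp_lfunE lfunE.
rewrite subv_add; apply/andP; split.
  apply/subvP => H hH; rewrite memv_ker comp_lfunE lfunE /=; apply/eqP/chiH.
  by rewrite vsprojK //; apply: subvP hH; exact: capvSl.
apply/subv_sumP => i _; apply/subv_sumP => j ij.
rewrite -memvE memv_ker comp_lfunE lfunE /=; apply/eqP/chiX.
  by rewrite -val_eqE /= ltn_eqF.
by move=> E; move: ij; rewrite E ltnNge leqnSn.
Qed.

Fact borel_sub_sl : (borel <= sl)%VS.
Proof. exact: b_sub_sl. Qed.

Section BabyVerma.
Variables (chi : 'Hom(subvs_of sl, K^o)).
Hypothesis chi_b0 : forall x : subvs_of borel, chi (incl sl x) = 0.
Variable lam : 'Hom(subvs_of cartan, K^o).
Hypothesis lamP : restricted_weight lam.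

(* Z_chi(lambda) = U_chi(sl_n) (x)_(U_0(b)) K_lambda *)
Definition baby_verma : lmodType (Uchi chi) :=
  tensor (U0_incl borel_sub_sl chi_b0) (Klambda lamP).

End BabyVerma.
End SpecialLinear.

(* Main.v *)
Require Import Defs.
From HB Require Import structures.
From mathcomp Require Import all_boot all_order perm all_algebra.
From mathcomp.classical Require Import boolp.
From mathcomp.multinomials Require Import monalg.
From mathcomp Require Import zify ring.

Set Implicit Arguments.
Unset Strict Implicit.
Unset Printing Implicit Defensive.

Import GRing.Theory.
Local Open Scope ring_scope.

(* Let D be the derivation of Z = Z_chi(lambda) induced by ad E_11 that kills the
   generator v. Letting E_11 act as D makes Z a module over gl_n, of highest weight
   mu with mu_1 = 0. The lower root vectors, shifted by chi, act nilpotently; let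
   tau be the product of their (p-1)-st powers. A filtration argument in the style of
   Kazhdan shows that the Whittaker vectors of Z form the line K tau(v). Hence
   S = U tau(v) lies in every nonzero submodule, {z | tau(U z) = 0} contains every
   proper one, and Z is simple over gl_n. The sums S + D S + ... + D^(i-1) S are
   submodules, the p-th one is Z because D^p = D, and every simple subquotient
   of Z is isomorphic to S.

   If Z is not simple then S <> Z, and S, being isomorphic to the simple quotient
   of Z, contains a highest weight vector of gl_n-weight mu + c (1, ..., 1) with
   c in F_p^*. The minimal polynomial of the Casimir operator of Z (x) K^n is
   prod_i (X - (mu_i - i)) for the weight of any highest weight vector generating
   Z over gl_n, so the multiset of the mu_i - i is invariant under
   translation by c. As p | n, this means that lambda is in W.0.

   If lambda is in W.0, then applying powers of the E_(i+1)i to v yields highest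
   weight vectors for the weights in the dot orbit of mu, among them mu + (1, ..., 1).
   Thus there is an endomorphism T of Z with T D = (D - 1) T, which can be normalised
   to be the identity on S. As T - 1 maps D^i s to - i D^(i-1) s modulo lower steps,
   the above filtration is strict up to the p-th step.

   That v is nonzero is seen on the action of gl_n, twisted by a Fourier transform
   in some of the variables, on polynomials in an n by (n-1) matrix of variables. *)

(** Why gl_n appears: as p divides n, the identity matrix has trace zero, so E_11 is not the sum of
    an element of sl_n and a scalar, and D carries information that sl_n does not have. Its
    eigenvalues separate the weights mu and mu + c (1, ..., 1), which agree on sl_n. No basis of Z
    is chosen and no dimension is counted. Two numbers replace them: the weight (sum of heights) of
    a word in the shifted lower root vectors, which bounds the words that can act nontrivially, and
    the Kazhdan degree of a vector, whose lowest step is zero. The word [tau] has the largest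
    possible weight. Composed with the matching word in dual upper triangular elements, it
    multiplies a Whittaker vector by a power of (p-1)!, which is -1 modulo p by Wilson's theorem.
    This nonzero scalar is what reduces questions on Z to the line through tau(v). *)

(* A reflexive decision procedure for identities in abelian groups. *)
Inductive zterm := ZVar of nat | ZZero | ZAdd of zterm & zterm | ZOpp of zterm.

Fixpoint zeval (V : zmodType) (env : seq V) (t : zterm) : V :=
  match t with
  | ZVar i => nth 0 env i
  | ZZero => 0
  | ZAdd t u => zeval env t + zeval env u
  | ZOpp t => - zeval env t
  end.

Fixpoint zcoef (t : zterm) (i : nat) : int :=
  match t with
  | ZVar j => if i == j then 1 else 0
  | ZZero => 0
  | ZAdd t u => zcoef t i + zcoef u i
  | ZOpp t => - zcoef t i
  end.

Lemma zevalE (V : zmodType) (env : seq V) t :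
  zeval env t = \sum_(i < size env) nth 0 env i *~ zcoef t i.
Proof.
elim: t => [j||t IHt u IHu|t IHt] /=.
- have [jn|nj] := ltnP j (size env); last first.
    rewrite nth_default // big1 // => i _; case: eqP => // ij.
    by move: nj; rewrite -ij leqNgt ltn_ord.
  rewrite (bigD1 (Ordinal jn)) //= eqxx big1 ?addr0 // => i.
  by rewrite -val_eqE /= => /negbTE->.
- by rewrite big1.
- by rewrite IHt IHu -big_split /=; apply: eq_bigr => i _; rewrite mulrzDr.
- by rewrite IHt -sumrN; apply: eq_bigr => i _; rewrite mulrNz.
Qed.

Lemma zeval_eq (V : zmodType) (env : seq V) t u :
  all (fun i => zcoef t i == zcoef u i) (iota 0 (size env)) ->
  zeval env t = zeval env u.
Proof.
move/allP=> tu; rewrite !zevalE; apply: eq_bigr => i _; congr (_ *~ _).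
by apply/eqP; apply: tu; rewrite mem_iota /=.
Qed.

Ltac zmod_index x env :=
  match env with
  | ?y :: _ => let u := match goal with _ => constr_eq x y end in constr:(0%N)
  | _ :: ?env' => let i := zmod_index x env' in constr:(S i)
  end.
(** Atoms are compared syntactically first and only then up to conversion, because the same vector
    may occur through different but convertible terms. *)
Ltac zmod_index_conv x env :=
  match env with
  | _ => zmod_index x env
  | ?y :: _ => let u := match goal with _ => unify x y end in constr:(0%N)
  | _ :: ?env' => let i := zmod_index_conv x env' in constr:(S i)
  end.
Ltac zmod_env t env :=
  lazymatch t with
  | (?a + ?b)%R => let env1 := zmod_env a env in zmod_env b env1
  | (- ?a)%R => zmod_env a env
  | 0%R => env
  | ?x => match env with
    | _ => let i := zmod_index_conv x env in env
    | _ => constr:(x :: env)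
    end
  end.
Ltac zmod_reify t env :=
  lazymatch t with
  | (?a + ?b)%R =>
    let ta := zmod_reify a env in let tb := zmod_reify b env in
    constr:(ZAdd ta tb)
  | (- ?a)%R => let ta := zmod_reify a env in constr:(ZOpp ta)
  | 0%R => constr:(ZZero)
  | ?x => let i := zmod_index_conv x env in constr:(ZVar i)
  end.
Ltac zmod_solve :=
  lazymatch goal with |- @eq ?T ?a ?b =>
    let env0 := constr:(@nil T) in
    let env1 := zmod_env a env0 in
    let env := zmod_env b env1 in
    let ta := zmod_reify a env in
    let tb := zmod_reify b env in
    refine (@zeval_eq _ env ta tb _); vm_compute; reflexivity
  end.

(** * Polynomials in a linear operator *)

Section PolyAction.
Variables (K : fieldType) (V : lmodType K) (f : {linear V -> V}).

Definition pact (q : {poly K}) (z : V) : V := \sum_(i < size q) q`_i *: iter i f z.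

Lemma pactE m (q : {poly K}) z : (size q <= m)%N -> pact q z = \sum_(i < m) q`_i *: iter i f z.
Proof.
move=> qm; rewrite /pact (big_ord_widen m (fun i => q`_i *: iter i f z) qm).
rewrite big_mkcond /=; apply: eq_bigr => i _; case: ltnP => // qi.
by rewrite nth_default // scale0r.
Qed.

Lemma pact_is_linear z : linear (pact^~ z).
Proof.
move=> c q r /=; pose m := maxn (size q) (size r).
rewrite !(@pactE m) ?leq_maxl ?leq_maxr //; last first.
  by rewrite (leq_trans (size_polyD _ _)) // geq_max leq_maxr andbT
             (leq_trans (size_scale_leq _ _)) ?leq_maxl.
rewrite scaler_sumr -big_split /=; apply: eq_bigr => i _.
by rewrite coefD coefZ scalerDl scalerA.
Qed.

Lemma pactD q r z : pact (q + r) z = pact q z + pact r z.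
Proof. by have := pact_is_linear z 1 q r; rewrite !scale1r. Qed.
Lemma pactZ c q z : pact (c *: q) z = c *: pact q z.
Proof.
have pact0 : pact 0 z = 0 by rewrite (@pactE 0) ?size_poly0 // big_ord0.
by rewrite -[c *: q]addr0 pact_is_linear pact0 addr0.
Qed.
Lemma pactB q r z : pact (q - r) z = pact q z - pact r z.
Proof. by rewrite -!scaleN1r pactD pactZ. Qed.

Lemma pactC c z : pact c%:P z = c *: z.
Proof. by rewrite (@pactE 1) ?size_polyC_leq1 // big_ord1 coefC. Qed.

Lemma pactXM q z : pact ('X * q) z = f (pact q z).
Proof.
rewrite (@pactE (size q).+1); last first.
  by have [->|q0] := eqVneq q 0; rewrite ?mulr0 ?size_poly0 // mulrC size_mulX.
rewrite big_ord_recl coefXM eqxx scale0r add0r /pact raddf_sum /=.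
by apply: eq_bigr => i _; rewrite coefXM /= linearZ.
Qed.

Lemma pact_XsubCM a q z : pact (('X - a%:P) * q) z = f (pact q z) - a *: pact q z.
Proof. by rewrite mulrBl pactB pactXM mul_polyC pactZ. Qed.

Lemma pact_prod (I : Type) (r : seq I) (a : I -> K) z :
  pact (\prod_(i <- r) ('X - (a i)%:P)) z =
  foldr (fun i y => f y - a i *: y) z r.
Proof.
elim: r => [|i r IHr]; first by rewrite big_nil pactC scale1r.
by rewrite big_cons pact_XsubCM IHr.
Qed.

Lemma pactXn m z : pact 'X^m z = iter m f z.
Proof.
by elim: m => [|m IHm]; [rewrite expr0 pactC scale1r|rewrite exprS pactXM IHm].
Qed.

Lemma iter_shift a m z :
  iter m (fun y => f y - a *: y) z = pact (('X - a%:P) ^+ m) z.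
Proof.
elim: m => [|m IHm]; first by rewrite expr0 pactC scale1r.
by rewrite exprS pact_XsubCM -IHm.
Qed.

(** The operator [f] commutes with the scalar [a], so the identity is the Frobenius endomorphism of
    K[X] applied to X - a. *)
Lemma iter_shift_pchar p a z : p \in [pchar K] ->
  iter p (fun y => f y - a *: y) z = iter p f z - a ^+ p *: z.
Proof.
move=> hp; have hP : p \in [pchar {poly K}].
  exact: (rmorph_pchar (polyC : {rmorphism K -> {poly K}}) hp).
rewrite iter_shift -(pFrobenius_autE hP) rmorphB /= !pFrobenius_autE pactB pactXn.
by rewrite -polyC_exp pactC.
Qed.

End PolyAction.

(** * Words in nilpotent operators *)

Section Words.
Variables (K : fieldType) (V : lmodType K) (p : nat).
Variables (T : eqType) (X : T -> {linear V -> V}) (ht : T -> nat).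

Definition word (l : seq T) (z : V) : V := foldr (fun a y => X a y) z l.
Definition weight (l : seq T) : nat := \sum_(a <- l) ht a.

Lemma word_is_linear l : linear (word l).
Proof.
by move=> c y z; elim: l => [|a l IHl] //=; rewrite IHl linearP.
Qed.
HB.instance Definition _ l := GRing.isLinear.Build K V V _ (word l)
  (word_is_linear l).

Lemma word_cat l1 l2 z : word (l1 ++ l2) z = word l1 (word l2 z).
Proof. by rewrite /word foldr_cat. Qed.
Lemma word_nseq m a z : word (nseq m a) z = iter m (X a) z.
Proof. by elim: m => //= m ->. Qed.
Lemma weight_nil : weight [::] = 0%N.
Proof. exact: big_nil. Qed.
Lemma weight_cons a l : weight (a :: l) = (ht a + weight l)%N.
Proof. exact: big_cons. Qed.
Lemma weight_cat l1 l2 : weight (l1 ++ l2) = (weight l1 + weight l2)%N.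
Proof. exact: big_cat. Qed.
Lemma weight_nseq m a : weight (nseq m a) = (m * ht a)%N.
Proof.
elim: m => [|m IHm]; first by rewrite /weight big_nil mul0n.
by rewrite weight_cons IHm mulSn.
Qed.

Definition bracket_closed (L : seq T) := forall a b, a \in L -> b \in L ->
  exists (k : K) (c : T), (k != 0 -> c \in L /\ ht c = (ht a + ht b)%N) /\
    forall z, X a (X b z) = X b (X a z) + k *: X c z.

(* Sorting rewrites a word as a combination of ordered monomials of the same
   weight, and those with exponents < p have weight at most (p - 1) weight L. *)
Lemma word_vanish (L l : seq T) z :
    (forall a, a \in L -> (0 < ht a)%N /\ forall y, iter p (X a) y = 0) ->
    bracket_closed L -> sorted (fun a b => ht a <= ht b)%N L ->
    {subset l <= L} -> (p.-1 * weight L < weight l)%N ->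
  word l z = 0.
Proof.
elim: L l z => [|k L IHL] l z Lpos Lbr Lsort lL Hl.
  case: l lL Hl => [|a l] lL; first by rewrite /weight big_nil muln0.
  by have := lL a (mem_head _ _).
have [kpos kpow] := Lpos k (mem_head _ _).
have kmin b : b \in L -> (ht k <= ht b)%N.
  have tr : transitive (fun a b => ht a <= ht b)%N by move=> x y w; exact: leq_trans.
  by move/(order_path_min tr)/allP: Lsort; apply.
have kmin' b : b \in k :: L -> (ht k <= ht b)%N.
  by rewrite inE => /orP[/eqP->|/kmin].
(* A bracket is higher than either argument, hence never the lowest letter k, so the tail [L] is
   itself closed. *)
have brk a b : a \in k :: L -> b \in k :: L ->
    exists (q : K) (c : T), (q != 0 -> c \in L /\ ht c = (ht a + ht b)%N) /\
    forall z, X a (X b z) = X b (X a z) + q *: X c z.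
  move=> aL bL; have [q [c [qc E]]] := Lbr a b aL bL.
  exists q, c; split=> // /qc[cL hc]; split=> //.
  have := kmin' a aL; have [bpos _] := Lpos b bL.
  move: cL; rewrite inE => /orP[/eqP ck|//].
  by move: hc; rewrite ck; lia.
have {}IHL l' y : {subset l' <= L} -> (p.-1 * weight L < weight l')%N -> word l' y = 0.
  apply: IHL.
  - by move=> a aL; apply: Lpos; rewrite inE aL orbT.
  - by move=> a b aL bL; apply: brk; rewrite inE ?aL ?bL orbT.
  - exact: path_sorted Lsort.
(* The lowest letter k is moved to the right end, where [a] copies are already collected. A
   commutation preserves the total weight; it moves k one place on, or fuses k with its neighbour
   into a higher letter, which lowers the number c of letters k still to be moved. *)
suff main c l' a y : (count_mem k l' <= c)%N -> {subset l' <= k :: L} ->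
    (p.-1 * weight (k :: L) < weight l' + a * ht k)%N ->
    word l' (iter a (X k) y) = 0.
  by apply: (main (count_mem k l) l 0%N) => //; rewrite mul0n addn0.
elim: c l' a y {lL Hl l z} => [|c IHc] l a y.
  rewrite leqn0 => /eqP/count_memPn kl lL Hl.
  have [pa|ap] := leqP p a.
    have -> : iter a (X k) y = 0 by rewrite -(subnKC pa) iterD kpow.
    exact: raddf0.
  apply: IHL => [b bl|].
    by have := lL b bl; rewrite inE => /orP[/eqP bk|//]; rewrite -bk bl in kl.
  (* Fewer than p collected copies account for at most (p-1) ht k, so the rest of the word exceeds
     the bound for [L]. *)
  move: Hl; rewrite weight_cons mulnDr.
  have : (a * ht k <= p.-1 * ht k)%N by rewrite leq_mul2r; apply/orP; right; lia.
  by lia.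
have [kl|kl] := boolP (k \in l); last first.
  by move=> _; apply: IHc; move/count_memPn: kl => ->.
case/splitPr: kl => l1 l2; elim: l2 l1 => [|b l2 IHl2] l1.
  rewrite count_cat /= eqxx addn0 addn1 ltnS => Hc lL Hl.
  rewrite word_cat /= -iterS; apply: IHc => //.
    by move=> b bl; apply: lL; rewrite mem_cat bl.
  by move: Hl; rewrite weight_cat !weight_cons weight_nil; lia.
move=> Hc lL Hl.
have bL : b \in k :: L by apply: lL; rewrite mem_cat !inE eqxx !orbT.
have [q [d [qd E]]] := brk k b (mem_head _ _) bL.
rewrite word_cat /= E raddfD /= linearZ /=.
have -> : word l1 (X b (X k (word l2 (iter a (X k) y)))) =
   word (rcons l1 b ++ k :: l2) (iter a (X k) y) by rewrite cat_rcons word_cat.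
rewrite IHl2; last first.
- by move: Hl; rewrite cat_rcons !(weight_cat, weight_cons); lia.
- move=> x; rewrite cat_rcons => xl; apply: lL; move: xl.
  by rewrite !mem_cat !inE; case: (x \in l1) => //=; case: (x == b); rewrite ?orbT.
- by move: Hc; rewrite cat_rcons !count_cat /= ; lia.
rewrite add0r; have [->|/qd[dL hd]] := eqVneq q 0; first by rewrite scale0r.
have -> : word l1 (X d (word l2 (iter a (X k) y))) =
   word (l1 ++ d :: l2) (iter a (X k) y) by rewrite word_cat.
rewrite IHc ?scaler0 //.
- move: Hc; rewrite !count_cat /= eqxx.
  suff -> : (d == k) = false by lia.
  by apply/eqP => dk; move: hd; rewrite dk; have [] := Lpos b bL; lia.
- move=> x; rewrite mem_cat inE => /or3P[xl|/eqP->|xl].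
  + by apply: lL; rewrite mem_cat xl.
  + by rewrite inE dL orbT.
  + by apply: lL; rewrite mem_cat !inE xl !orbT.
- by move: Hl; rewrite !(weight_cat, weight_cons) hd; lia.
Qed.

End Words.

(** * Whittaker vectors for the lower triangular matrices *)

Section GeneralLinear.
Variables (K : fieldType) (p : nat) (n : nat) (V : lmodType K).
Variable E : 'I_n -> 'I_n -> {linear V -> V}.

(* A representation of gl_n whose p-character, on the lower triangular root
   vectors, is that of a regular nilpotent. *)
Record gl_rep : Prop := GlRep {
  gl_bracket : forall i j k l z, E i j (E k l z) =
    E k l (E i j z) + E i l z *+ (j == k) - E k j z *+ (l == i);
  gl_pow : forall (i j : 'I_n) z, (j < i)%N ->
    iter p (E i j) z = z *+ (i == j.+1 :> nat) }.

Hypotheses (hp : p \in [pchar K]) (rep : gl_rep).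

Definition subspace (P : V -> Prop) :=
  P 0 /\ forall c y z, P y -> P z -> P (c *: y + z).

Lemma subspaceD P y z : subspace P -> P y -> P z -> P (y + z).
Proof. by case=> _ Pl Py Pz; rewrite -[y]scale1r; apply: Pl. Qed.
Lemma subspaceZ P c y : subspace P -> P y -> P (c *: y).
Proof. by case=> P0 Pl Py; rewrite -[_ *: _]addr0; apply: Pl. Qed.
Lemma subspaceB P y z : subspace P -> P y -> P z -> P (y - z).
Proof. by case=> _ Pl Py Pz; rewrite addrC -scaleN1r; apply: Pl. Qed.
Lemma subspace_sum P (I : Type) (r : seq I) (Q : pred I) (f : I -> V) :
  subspace P -> (forall i, Q i -> P (f i)) -> P (\sum_(i <- r | Q i) f i).
Proof.
move=> sP Pf; apply: (big_ind P) => //; first by case: sP.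
by move=> *; apply: subspaceD.
Qed.

Implicit Types (a b : 'I_n * 'I_n).

Definition lower a := (a.2 < a.1)%N.
Definition ht a := (a.1 - a.2)%N.
Definition chi a : K := (a.1 == a.2.+1 :> nat)%:R.

Definition shifted a (z : V) : V := E a.1 a.2 z - chi a *: z.
Lemma shifted_is_linear a : linear (shifted a).
Proof.
move=> c y z; rewrite /shifted linearP scalerDr scalerBr !scalerA [chi a * c]mulrC.
by rewrite opprD addrACA.
Qed.
HB.instance Definition _ a := GRing.isLinear.Build K V V _ (shifted a)
  (shifted_is_linear a).

Lemma E_shifted a z : E a.1 a.2 z = shifted a z + chi a *: z.
Proof. by rewrite subrK. Qed.

Lemma E_shiftZ i j c y z : E i j (y - c *: z) = E i j y - c *: E i j z.
Proof. by rewrite raddfB /= linearZ_LR. Qed.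

Lemma pgt0 : (0 < p)%N. Proof. by rewrite prime_gt0 ?(pcharf_prime hp). Qed.

(** (E - chi)^p = E^p - chi^p, and both terms are 1 on the subdiagonal and 0 below it. *)
Lemma shifted_pow a z : lower a -> iter p (shifted a) z = 0.
Proof.
move=> la; rewrite (iter_shift_pchar (E a.1 a.2)) // (gl_pow rep) // /chi.
case: eqP; last by rewrite expr0n gtn_eqF ?pgt0 // scale0r subrr.
by rewrite expr1n scale1r subrr.
Qed.

Lemma shiftedC a b z : shifted a (shifted b z) = shifted b (shifted a z)
   + E a.1 b.2 z *+ (a.2 == b.1) - E b.1 a.2 z *+ (b.2 == a.1).
Proof.
rewrite /= /shifted !E_shiftZ !scalerBr.
rewrite (gl_bracket rep) !scalerA [chi b * chi a]mulrC.
zmod_solve.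
Qed.

Definition roots : seq ('I_n * 'I_n) :=
  sort (fun a b => ht a <= ht b)%N [seq a <- enum {: 'I_n * 'I_n} | lower a].

Lemma mem_roots a : (a \in roots) = lower a.
Proof. by rewrite mem_sort mem_filter mem_enum andbT. Qed.

Lemma roots_sorted : sorted (fun a b => ht a <= ht b)%N roots.
Proof. by apply: sort_sorted => a b; exact: leq_total. Qed.

Lemma roots_uniq : uniq roots.
Proof. by rewrite sort_uniq filter_uniq ?enum_uniq. Qed.

Lemma ht_gt0 a : lower a -> (0 < ht a)%N.
Proof. by rewrite /lower /ht; lia. Qed.

Lemma chiE a : lower a -> chi a = (ht a == 1)%:R.
Proof. by rewrite /lower /ht /chi => la; congr (_ %:R); congr nat_of_bool; lia. Qed.

(** A bracket of lower root vectors has height at least 2, where [chi] is 0. So [chi] is a character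
    of the strictly lower triangular matrices, and subtracting it does not affect brackets. *)
Lemma roots_bracket : bracket_closed shifted ht roots.
Proof.
move=> a b; rewrite !mem_roots => la lb.
have [ab|ab] := boolP (a.2 == b.1).
  exists 1, (a.1, b.2); rewrite mem_roots.
  move: (la) (lb) (eqP ab); rewrite /lower /= => la' lb' ab'.
  have lc : lower (a.1, b.2) by rewrite /lower /=; move: ab' => /(congr1 val) /=; lia.
  have hc : ht (a.1, b.2) = (ht a + ht b)%N.
    by rewrite /ht /=; move: ab' => /(congr1 val) /=; lia.
  split=> // z /=; rewrite shiftedC ab (E_shifted (a.1, b.2)) scale1r.
  have := ht_gt0 la; have := ht_gt0 lb => hb ha.
  rewrite (chiE lc) hc (_ : (_ == 1)%N = false) ?scale0r ?addr0; last by lia.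
  rewrite (_ : (b.2 == a.1) = false) ?subr0 //.
  by apply/eqP => /(congr1 val) /=; move: ab' => /(congr1 val) /=; lia.
have [ba|ba] := boolP (b.2 == a.1); last first.
  exists 0, a; rewrite eqxx; split=> // z /=; rewrite shiftedC (negbTE ab) (negbTE ba).
  by rewrite subr0 scale0r.
exists (-1), (b.1, a.2); rewrite mem_roots.
move: (la) (lb) (eqP ba); rewrite /lower /= => la' lb' ba'.
have lc : lower (b.1, a.2) by rewrite /lower /=; move: ba' => /(congr1 val) /=; lia.
have hc : ht (b.1, a.2) = (ht a + ht b)%N.
  by rewrite /ht /=; move: ba' => /(congr1 val) /=; lia.
split=> // z /=; rewrite shiftedC (negbTE ab) ba (E_shifted (b.1, a.2)) scaleN1r.
have := ht_gt0 la; have := ht_gt0 lb => hb ha.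
by rewrite (chiE lc) hc (_ : (_ == 1)%N = false) ?scale0r ?addr0 //; lia.
Qed.

Lemma roots_word_vanish l z : all lower l ->
  (p.-1 * weight ht roots < weight ht l)%N -> word shifted l z = 0.
Proof.
move=> /allP ll; apply: (@word_vanish _ _ p _ _ ht roots).
- move=> a; rewrite mem_roots => la; split; first exact: ht_gt0.
  by move=> y; exact: shifted_pow.
- exact: roots_bracket.
- exact: roots_sorted.
- by move=> a /ll; rewrite mem_roots.
Qed.

Definition powers (m : nat) (l : seq ('I_n * 'I_n)) := flatten [seq nseq m a | a <- l].

Lemma weight_powers m l : weight ht (powers m l) = (m * weight ht l)%N.
Proof.
elim: l => [|a l IHl]; first by rewrite weight_nil muln0.
by rewrite /powers /= weight_cat weight_nseq weight_cons IHl mulnDr.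
Qed.

Lemma powers_lower m l : all lower l -> all lower (powers m l).
Proof.
move=> ll; apply/allP => a /flattenP[s /mapP[b bl ->]] /nseqP[-> _].
by move/allP: ll; apply.
Qed.

Lemma powers_rcons m l a : powers m (rcons l a) = powers m l ++ nseq m a.
Proof. by rewrite /powers map_rcons flatten_rcons. Qed.

Lemma roots_lower : all lower roots.
Proof. by apply/allP => a; rewrite mem_roots. Qed.

(* The image of [tau] consists of Whittaker vectors, and [tau] does not vanish at
   z iff z generates a cyclic highest weight module under the lower vectors. *)
Definition tau : {linear V -> V} := word shifted (powers p.-1 roots).

Definition whittaker (w : V) := forall a, lower a -> shifted a w = 0.

(** The word of [tau] already has the largest weight left open by [roots_word_vanish], so one more
    letter gives 0. *)
Lemma shifted_tau a z : lower a -> shifted a (tau z) = 0.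
Proof.
move=> la; have -> : shifted a (tau z) = word shifted (a :: powers p.-1 roots) z by [].
apply: roots_word_vanish; first by rewrite /= la powers_lower ?roots_lower.
by rewrite weight_cons weight_powers; have := ht_gt0 la; lia.
Qed.

Lemma whittaker_tau z : whittaker (tau z).
Proof. by move=> a; exact: shifted_tau. Qed.

(** Engel's argument: a vector that is not yet Whittaker is replaced by a nonzero image under some
    [shifted a], which lowers the weight from which on all words kill it. *)
Lemma exists_whittaker (P : V -> Prop) z :
    (forall a y, lower a -> P y -> P (shifted a y)) -> P z -> z != 0 ->
  exists w, [/\ P w, w != 0 & whittaker w].
Proof.
move=> PX; pose H := (p.-1 * weight ht roots)%N.
suff main m y : (forall l, all lower l -> (m <= weight ht l)%N -> word shifted l y = 0) ->
    P y -> y != 0 -> exists w, [/\ P w, w != 0 & whittaker w].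
  by apply: (main H.+1) => l ll Hl; apply: roots_word_vanish.
elim: m y => [|m IHm] y Hy Py y0; first by rewrite [y](Hy [::] isT isT) eqxx in y0.
have [yw|] := pselect (whittaker y); first by exists y.
move/existsNP => [a /not_implyP[la /eqP Xy]].
apply: (IHm (shifted a y)) => // [l ll Hl|]; last exact: PX.
rewrite -[word _ _ _]/(word shifted l (word shifted [:: a] y)) -word_cat.
apply: Hy; rewrite ?all_cat ?ll /= ?la //.
by rewrite weight_cat weight_cons weight_nil; have := ht_gt0 la; lia.
Qed.

(* The Kazhdan filtration of the submodule generated by a Whittaker vector,
   shifted by one so that its 0-th step is zero. *)
Inductive kazhdan (w : V) : nat -> V -> Prop :=
| KazBase k of (0 < k)%N : kazhdan w k w
| Kaz0 k : kazhdan w k 0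
| KazLin k c y z of kazhdan w k y & kazhdan w k z : kazhdan w k (c *: y + z)
| KazE (i j : 'I_n) k m z of (i <= j)%N & kazhdan w k z & (k + (j - i) < m)%N :
    kazhdan w m (E i j z).

Lemma kazhdan_subspace w k : subspace (kazhdan w k).
Proof. by split=> [|c y z]; [exact: Kaz0|exact: KazLin]. Qed.

Lemma kazhdan_mono w k m z : kazhdan w k z -> (k <= m)%N -> kazhdan w m z.
Proof.
move=> kz; elim: kz m => {k z} [k kpos|k|k c y z _ IHy _ IHz|i j k m z ij _ IHz km] m' mm.
- by apply: KazBase; lia.
- exact: Kaz0.
- by apply: KazLin; [exact: IHy|exact: IHz].
- by apply: (KazE ij (IHz _ (leqnn _))); lia.
Qed.

Lemma kazhdan_eq0 w z : kazhdan w 0 z -> z = 0.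
Proof.
move: {1 3}0%N (erefl 0%N) => k k0 kz; elim: kz k0 => {k z} //.
- by move=> k kpos k0; rewrite k0 in kpos.
- by move=> k c y z _ IHy _ IHz /[dup] /IHy -> /IHz ->; rewrite scaler0 addr0.
- by move=> i j k m z _ _ _ km m0; rewrite m0 in km.
Qed.

(** Every E_ij, lower ones included, raises the degree by at most j - i + 1. The behaviour of
    [shifted] on z is a hypothesis because this is applied within the induction that establishes
    it. *)
Lemma kazhdan_E w k m z (i j : 'I_n) :
    (forall a, lower a -> kazhdan w (k - ht a) (shifted a z)) -> kazhdan w k z ->
  (k + j < m + i)%N -> kazhdan w m (E i j z).
Proof.
move=> Xz kz km; have [ij|ji] := leqP i j; first by apply: (KazE ij kz); lia.
have lij : lower (i, j) by [].
rewrite (E_shifted (i, j)) chiE //; apply: subspaceD; first exact: kazhdan_subspace.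
  by apply: (kazhdan_mono (Xz _ lij)); rewrite /ht /=; lia.
have [h1|_] := eqVneq (ht (i, j)) 1%N; last by rewrite scale0r; exact: Kaz0.
by rewrite scale1r; apply: (kazhdan_mono kz); move: h1; rewrite /ht /=; lia.
Qed.

(** Since [shifted a] kills w, it acts on products of upper elements through commutators, and a
    commutator has one degree less than the product. Hence the drop by ht a, although E_a has degree
    1 - ht a. *)
Lemma kazhdan_shifted w k z a : whittaker w -> kazhdan w k z -> lower a ->
  kazhdan w (k - ht a) (shifted a z).
Proof.
move=> wh kz; elim: kz a => {k z} [k _ a /wh->|k a _|k c y z _ IHy _ IHz a la|].
- exact: Kaz0.
- by rewrite raddf0; exact: Kaz0.
- by rewrite linearP; apply: KazLin; [exact: IHy|exact: IHz].
move=> i j k m z ij kz IHz km [s t] lst.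
have := IHz _ lst; have := lst; rewrite /lower /ht /= => st kX.
have -> : shifted (s, t) (E i j z) = E i j (shifted (s, t) z)
    + E s j z *+ (t == i) - E i t z *+ (j == s).
  rewrite /= /shifted E_shiftZ (gl_bracket rep).
  zmod_solve.
apply: subspaceB; [exact: kazhdan_subspace|apply: subspaceD|].
- exact: kazhdan_subspace.
(* If the height exceeds k, truncated subtraction puts the vector into the 0-th step, which is
   zero. *)
- have [ks|sk] := leqP (s - t) k; first by apply: (KazE ij kX); lia.
  have /kazhdan_eq0-> : kazhdan w 0 (shifted (s, t) z).
    by move: kX; rewrite (_ : k - (s - t) = 0)%N //; lia.
  by rewrite raddf0; exact: Kaz0.
- case: eqP => [ti|_]; last exact: Kaz0.
  by rewrite mulr1n; apply: (kazhdan_E IHz kz); rewrite -ti in ij km; lia.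
- case: eqP => [js|_]; last exact: Kaz0.
  by rewrite mulr1n; apply: (kazhdan_E IHz kz); rewrite js in ij km; lia.
Qed.

(* Dual to the lower root vector of [a] under (x, y) |-> chi [x, y]. *)
Definition dual a (z : V) : V :=
  \sum_(i : 'I_n) \sum_(j : 'I_n | (i <= a.2)%N && (j.+1 + a.2 == i + a.1)%N) E i j z.
Lemma dual_is_linear a : linear (dual a).
Proof.
move=> c y z; rewrite /dual scaler_sumr -big_split /=; apply: eq_bigr => i _.
by rewrite scaler_sumr -big_split /=; apply: eq_bigr => j _; rewrite linearP.
Qed.
HB.instance Definition _ a := GRing.isLinear.Build K V V _ (dual a)
  (dual_is_linear a).

Lemma kazhdan_dual w k z a : lower a -> kazhdan w k z ->
  kazhdan w (k + ht a) (dual a z).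
Proof.
move=> la kz; have sG := kazhdan_subspace w (k + ht a).
apply: subspace_sum => // i _; apply: subspace_sum => // j /andP[ia /eqP ja].
by move: la; rewrite /lower /ht => la; apply: (KazE _ kz); lia.
Qed.

Lemma sum_pred1_eq (W : zmodType) (P : pred 'I_n) (i0 : 'I_n) (x : 'I_n -> W) :
  \sum_(i | P i) x i *+ (i0 == i) = x i0 *+ P i0.
Proof.
rewrite big_mkcond (bigD1 i0) //= eqxx big1 ?addr0 => [|i].
  by case: (P i0).
by rewrite eq_sym => /negbTE->; case: (P i).
Qed.

Lemma shifted_dual w k z a b : whittaker w -> lower a -> lower b ->
    (ht b <= ht a)%N -> kazhdan w k z ->
  exists2 r, kazhdan w (k - (ht a - ht b).+1) r &
    shifted a (dual b z) = dual b (shifted a z) + z *+ (a == b) + r.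
Proof.
move=> wh la lb ba kz; case: a b la lb ba => [i j] [s t].
set a := (i, j); set b := (s, t); move=> la lb ba.
pose C (x y : 'I_n) := (x <= t)%N && (y.+1 + t == x + s)%N.
have -> : shifted a (dual b z) = dual b (shifted a z)
    + (\sum_(y | C j y) E i y z - \sum_(x | C x i) E x j z).
  have -> : \sum_(y | C j y) E i y z = \sum_x \sum_(y | C x y) E i y z *+ (j == x).
    rewrite (exchange_big_dep predT) //= big_mkcond /=; apply: eq_bigr => y _.
    rewrite (eq_bigr (fun x => E i y z *+ (j == x))) //.
    by rewrite sum_pred1_eq; case: (C j y).
  have -> : \sum_(x | C x i) E x j z = \sum_x \sum_(y | C x y) E x j z *+ (y == i).
    rewrite big_mkcond; apply: eq_bigr => x _.
    under eq_bigr do rewrite eq_sym.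
    by rewrite sum_pred1_eq; case: (C x i).
  have -> : shifted a (dual b z) = E i j (dual b z) - chi a *: dual b z by [].
  have -> : dual b (shifted a z) = dual b (E i j z) - chi a *: dual b z.
    by rewrite /shifted raddfB /= linearZ_LR.
  suff -> : E i j (dual b z) = dual b (E i j z)
     + (\sum_x \sum_(y | C x y) E i y z *+ (j == x)
        - \sum_x \sum_(y | C x y) E x j z *+ (y == i)) by zmod_solve.
  rewrite /dual raddf_sum -sumrB -big_split /=; apply: eq_bigr => x _.
  rewrite raddf_sum -sumrB -big_split /=; apply: eq_bigr => y _.
  rewrite (gl_bracket rep); zmod_solve.
exists (\sum_(y | C j y) shifted (i, y) z - \sum_(x | C x i) shifted (x, j) z).
  have sG := kazhdan_subspace w (k - (ht a - ht b).+1).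
  move: la lb ba; rewrite /lower /ht /= => la lb ba.
  apply: subspaceB => //; apply: subspace_sum => // x /andP[xt /eqP Ex].
    apply: (kazhdan_mono (kazhdan_shifted wh kz _)); rewrite /lower /ht /=; lia.
  by apply: (kazhdan_mono (kazhdan_shifted wh kz _)); rewrite /lower /ht /=; lia.
rewrite -addrA; congr (_ + _).
(* Each sum of [chi] has at most one nonzero term. Both require that a and b have the same height,
   the first also j <= t and the second j < t, so they differ exactly for j = t. *)
have -> : z *+ (a == b) =
    (\sum_(y | C j y) chi (i, y) - \sum_(x | C x i) chi (x, j)) *: z.
  have chi1 : \sum_(y | C j y) chi (i, y) = ((j <= t)%N && (i + t == j + s)%N)%:R.
    have i0 : (i.-1 < n)%N by rewrite (leq_ltn_trans (leq_pred i)).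
    rewrite (eq_bigr (fun y => 1 *+ (Ordinal i0 == y))) ?sum_pred1_eq.
      by rewrite /C /=; congr (_%:R); congr nat_of_bool; move: la; rewrite /lower /=; lia.
    move=> y _; rewrite /chi /= -val_eqE /=; congr (_%:R); congr nat_of_bool.
    by move: la; rewrite /lower /=; lia.
  have chi2 : \sum_(x | C x i) chi (x, j) = ((j < t)%N && (i + t == j + s)%N)%:R.
    have j0 : (j.+1 < n)%N by move: la; rewrite /lower /=; have := ltn_ord i; lia.
    rewrite (eq_bigr (fun y => 1 *+ (Ordinal j0 == y))) ?sum_pred1_eq.
      by rewrite /C /=; congr (_%:R); congr nat_of_bool; lia.
    by move=> y _; rewrite /chi /= -val_eqE /= eq_sym.
  rewrite chi1 chi2 /a /b xpair_eqE -!val_eqE /= leq_eqVlt.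
  have -> : (i == s :> nat) && (j == t :> nat) = (j == t :> nat) && (i + t == j + s)%N.
    by lia.
  case: (i + t == j + s)%N; rewrite ?andbF ?subrr ?scale0r //.
  case: eqP => [->|_] /=; first by rewrite ltnn subr0 scale1r.
  by rewrite subrr scale0r.
rewrite scalerBl !scaler_suml.
rewrite (eq_bigr (fun y => shifted (i, y) z + chi (i, y) *: z)); last first.
  by move=> y _; rewrite -E_shifted.
rewrite [X in _ - X](eq_bigr (fun x => shifted (x, j) z + chi (x, j) *: z)); last first.
  by move=> y _; rewrite -E_shifted.
rewrite !big_split /=; zmod_solve.
Qed.

Lemma kazhdan_word w k z l : whittaker w -> all lower l -> kazhdan w k z ->
  kazhdan w (k - weight ht l) (word shifted l z).
Proof.
move=> wh; elim: l => [|a l IHl] /=; first by rewrite weight_nil subn0.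
move=> /andP[la ll] kz; rewrite weight_cons addnC subnDA.
by apply: kazhdan_shifted => //; apply: IHl.
Qed.

Lemma kazhdan_dual_word w l : all lower l ->
  kazhdan w (weight ht l).+1 (word dual l w).
Proof.
elim: l => [|a l IHl] /=; first by move=> _; apply: KazBase.
by move=> /andP[la ll]; rewrite weight_cons addnC -addSn; apply/kazhdan_dual/IHl.
Qed.

Lemma kazhdan_dual_sub w k z a b : lower b -> kazhdan w (k - ht a) z ->
  kazhdan w (k + ht b - ht a) (dual b z).
Proof.
move=> lb kz; have [ak|ka] := leqP (ht a) k; first by rewrite addnC -addnBA // addnC; apply: kazhdan_dual.
have /kazhdan_eq0-> : kazhdan w 0 z by move: kz; rewrite (_ : k - ht a = 0)%N //; lia.
by rewrite raddf0; exact: Kaz0.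
Qed.

Lemma shifted_dual_word w a l : whittaker w -> lower a -> all lower l ->
    {in l, forall b, ht b <= ht a}%N -> a \notin l ->
  kazhdan w (weight ht l - ht a) (shifted a (word dual l w)).
Proof.
move=> wh la; elim: l => [|b l IHl] /=; first by move=> _ _ _; rewrite wh //; exact: Kaz0.
move=> /andP[lb ll] hl; rewrite inE negb_or => /andP[ab al].
have hb := hl b (mem_head _ _).
have [r kr ->] := shifted_dual wh la lb hb (kazhdan_dual_word w ll).
rewrite (negbTE ab) addr0 weight_cons addnC; apply: subspaceD.
- exact: kazhdan_subspace.
- apply: kazhdan_dual_sub => //; apply: IHl => // c cl.
  by apply: hl; rewrite inE cl orbT.
- by apply: (kazhdan_mono kr); lia.
Qed.

(** Modulo lower degree, [shifted a] acts on powers of [dual a] as a derivative acts on powers of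
    its variable; the letters of l, different from a and not higher, behave like constants. *)
Lemma shifted_dual_power w a l m : whittaker w -> lower a -> all lower l ->
    {in l, forall b, ht b <= ht a}%N -> a \notin l ->
  exists2 r, kazhdan w (m * ht a + weight ht l - ht a) r &
    shifted a (word dual (nseq m a ++ l) w) =
      word dual (nseq m.-1 a ++ l) w *+ m + r.
Proof.
move=> wh la ll hl al; elim: m => [|m [r kr E0]].
  exists (shifted a (word dual l w)); last by rewrite add0r.
  exact: shifted_dual_word.
have lml : all lower (nseq m a ++ l) by rewrite all_cat ll all_nseq la orbT.
have [r' kr' E1] := shifted_dual wh la la (leqnn _) (kazhdan_dual_word w lml).
rewrite eqxx weight_cat weight_nseq in kr' E1.
exists (dual a r + r').
  apply: subspaceD; first exact: kazhdan_subspace.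
    by apply: (kazhdan_mono (kazhdan_dual_sub la kr)); rewrite mulSn; lia.
  by apply: (kazhdan_mono kr'); rewrite mulSn; lia.
rewrite [shifted a _]E1 E0 raddfD raddfMn /= mulr1n.
have -> : dual a (word dual (nseq m.-1 a ++ l) w) *+ m =
    word dual (nseq m a ++ l) w *+ m by case: (m).
rewrite mulrSr; zmod_solve.
Qed.

Lemma shifted_dual_iter w a l m j : whittaker w -> lower a -> all lower l ->
    {in l, forall b, ht b <= ht a}%N -> a \notin l -> (j <= m)%N ->
  exists2 r, kazhdan w ((m - j) * ht a + weight ht l) r &
    iter j (shifted a) (word dual (nseq m a ++ l) w) =
      word dual (nseq (m - j) a ++ l) w *+ m ^_ j + r.
Proof.
move=> wh la ll hl al; elim: j => [|j IHj] jm.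
  by exists 0; [exact: Kaz0|rewrite subn0 addr0 ffactn0].
have [r kr E0] := IHj (ltnW jm).
have [r' kr' E1] := shifted_dual_power (m - j) wh la ll hl al.
have mj : (m - j = (m - j.+1).+1)%N by lia.
exists (r' *+ m ^_ j + shifted a r).
  apply: subspaceD; first exact: kazhdan_subspace.
    rewrite -scaler_nat; apply: subspaceZ; first exact: kazhdan_subspace.
    by apply: (kazhdan_mono kr'); rewrite mj mulSn -addnA addKn.
  by apply: (kazhdan_mono (kazhdan_shifted wh kr la)); rewrite mj mulSn -addnA addKn.
rewrite iterS E0 raddfD raddfMn /= E1 mulrnDl -mulrnA ffactnSr mulnC.
by rewrite -subnS; zmod_solve.
Qed.

Definition dual_top : {linear V -> V} := word dual (powers p.-1 (rev roots)).

(** The roots are removed from the highest down, as [shifted_dual] requires, each giving a factor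
    (p-1)!. The remainder lies in the step whose number is the weight of the remaining dual word;
    the remaining letters of [tau] have the same weight and take it to the 0-th step. The leading
    term survives because w starts in step 1. *)
Lemma tau_dual_top w : whittaker w ->
  tau (dual_top w) = (p.-1)`!%:R ^+ size roots *: w.
Proof.
move=> wh; rewrite /tau /dual_top /=.
have := roots_lower; have := roots_uniq; have := roots_sorted.
elim/last_ind: roots => [|l a IHl]; first by rewrite expr0 scale1r.
move=> sl; rewrite rcons_uniq all_rcons => /andP[al ul] /andP[la ll].
have tr : transitive (fun a b => ht a <= ht b)%N by move=> x y z; exact: leq_trans.
have [sl' hl] : sorted (fun a b => ht a <= ht b)%N l /\ {in l, forall b, ht b <= ht a}%N.
  move: sl; rewrite -cats1 sorted_pairwise // pairwise_cat -sorted_pairwise //.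
  by move=> /and3P[/allrelP alr -> _]; split=> // b bl; apply: alr; rewrite ?inE.
rewrite rev_rcons powers_rcons word_cat word_nseq size_rcons.
have [|||r kr E0] := @shifted_dual_iter w a (powers p.-1 (rev l)) p.-1 p.-1 wh la _ _ _ (leqnn _).
- by rewrite powers_lower // all_rev.
- by move=> b /flattenP[s /mapP[c cl ->]] /nseqP[-> _]; apply: hl; rewrite mem_rev in cl.
- apply/negP => /flattenP[s /mapP[c cl ->]] /nseqP[ac _].
  by rewrite mem_rev -ac (negbTE al) in cl.
rewrite (_ : powers p.-1 (a :: rev l) = nseq p.-1 a ++ powers p.-1 (rev l)) //.
rewrite E0 subnn cat0s ffactnn raddfD raddfMn /= IHl //.
have := kazhdan_word wh (powers_lower p.-1 ll) kr.
rewrite subnn mul0n !weight_powers (_ : weight ht (rev l) = weight ht l) ?subnn.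
  by move/kazhdan_eq0->; rewrite addr0 -scaler_nat scalerA exprS.
by rewrite /weight; apply: perm_big; rewrite perm_rev.
Qed.

Lemma fact_pred_pchar : (p.-1)`!%:R != 0 :> K.
Proof.
have p1 := prime_gt1 (pcharf_prime hp).
have := pcharf_prime hp; rewrite Wilson // (dvdn_pcharf hp) -addn1 natrD => /eqP E0.
apply/eqP => E1; move: E0; rewrite E1 add0r => /eqP.
by rewrite oner_eq0.
Qed.

Definition stable (P : V -> Prop) :=
  subspace P /\ forall i j z, P z -> P (E i j z).
Definition lower_stable (P : V -> Prop) :=
  subspace P /\ forall a z, lower a -> P z -> P (shifted a z).

Lemma stable_lower P : stable P -> lower_stable P.
Proof.
move=> [sP PE]; split=> // a z _ Pz; apply: subspaceB => //; first exact: PE.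
exact: subspaceZ.
Qed.

Lemma stable_dual_top P z : stable P -> P z -> P (dual_top z).
Proof.
move=> [sP PE]; rewrite /dual_top /=; elim: powers z => //= a l IHl z Pz.
by apply: subspace_sum => // i _; apply: subspace_sum => // j _; apply/PE/IHl.
Qed.

Lemma lower_stable_word P l z : lower_stable P -> all lower l -> P z ->
  P (word shifted l z).
Proof.
move=> [sP PX]; elim: l => //= a l IHl /andP[la ll] Pz.
by apply: PX => //; apply: IHl.
Qed.

Definition generates v := forall P, stable P -> P v -> forall z, P z.

Definition hw (mu : 'I_n -> K) (z : V) :=
  (forall i, E i i z = mu i *: z) /\ (forall i j : 'I_n, (i < j)%N -> E i j z = 0).

(** A decreasing filtration by the weight of lower words; step 1 plays the role of the augmentation
    ideal applied to v. *)
Inductive lspan (v : V) : nat -> V -> Prop :=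
| LBase : lspan v 0 v
| L0 h : lspan v h 0
| LLin h c y z of lspan v h y & lspan v h z : lspan v h (c *: y + z)
| LShift a h m z of lower a & lspan v h z & (m <= h + ht a)%N : lspan v m (shifted a z).

Lemma lspan_subspace v h : subspace (lspan v h).
Proof. by split=> [|c y z]; [exact: L0|exact: LLin]. Qed.

Lemma lspan_word_vanish v h z l : lspan v h z -> all lower l ->
  (p.-1 * weight ht roots < weight ht l + h)%N -> word shifted l z = 0.
Proof.
move=> sz; elim: sz l => {h z} [|h|h c y z _ IHy _ IHz|a h m z la hz IHz mh] l ll Hl.
- by apply: roots_word_vanish => //; rewrite addn0 in Hl.
- exact: raddf0.
- by rewrite linearP /= IHy // IHz // scaler0 addr0.
have -> : word shifted l (shifted a z) = word shifted (l ++ [:: a]) z by rewrite word_cat.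
apply: IHz; first by rewrite all_cat ll /= la.
by rewrite weight_cat weight_cons weight_nil; lia.
Qed.

Lemma lspan_word v h z l : lspan v h z -> all lower l ->
  lspan v (weight ht l + h) (word shifted l z).
Proof.
move=> sz; elim: l => [|a l IHl] /=; first by rewrite weight_nil.
by move=> /andP[la ll]; apply: (LShift la (IHl ll)); rewrite weight_cons; lia.
Qed.

Section Cyclic.
Variables (mu : 'I_n -> K) (v : V).
Hypotheses (v_hw : hw mu v) (v_gen : generates v) (v_neq0 : v != 0).

(** The substitute for a PBW decomposition: a matrix unit can be commuted past the shifted letters
    until it meets v, so the lower words applied to v span a gl_n-stable subspace. *)
Lemma lspan_full z : lspan v 0 z.
Proof.
apply: (v_gen (P := lspan v 0)); last exact: LBase.
split; first exact: lspan_subspace.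
have sG := lspan_subspace v 0.
clear z; suff main h y : lspan v h y -> forall i j, lspan v 0 (E i j y).
  by move=> i j y hy; exact: main hy i j.
elim=> {h y}.
- move=> i j; have [Ed Eu] := v_hw; case: (ltngtP i j) => [ij|ji|/val_inj->].
  + by rewrite Eu //; exact: L0.
  + rewrite (E_shifted (i, j)); apply: subspaceD => //.
      by apply: (LShift _ (LBase v)).
    by apply: subspaceZ => //; exact: LBase.
  + by rewrite Ed; apply: subspaceZ => //; exact: LBase.
- by move=> h i j; rewrite raddf0; exact: L0.
- move=> h c y z _ IHy _ IHz i j; rewrite linearP.
  by apply: LLin; [exact: IHy|exact: IHz].
- move=> a h m z la hz IH _ i j.
  have -> : E i j (shifted a z) = shifted a (E i j z)
      + E i a.2 z *+ (j == a.1) - E a.1 j z *+ (a.2 == i).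
    by rewrite /= /shifted E_shiftZ (gl_bracket rep); zmod_solve.
  apply: subspaceB => //; last by case: (a.2 == i); [exact: IH|exact: L0].
  apply: subspaceD => //; last by case: (j == a.1); [exact: IH|exact: L0].
  by apply: (LShift la (IH i j)).
Qed.

Lemma lower_stable_full P : lower_stable P -> P v -> forall z, P z.
Proof.
move=> [sP PX] Pv z; have sG := lspan_full z; elim: sG Pv => {z} //.
- by case: sP.
- by move=> _ c y z _ IHy _ IHz Pv; apply: sP.2; [exact: IHy|exact: IHz].
- by move=> a h m z la _ IHz _ Pv; apply: PX => //; exact: IHz.
Qed.

Lemma lspan_split z : exists c r, lspan v 1 r /\ z = c *: v + r.
Proof.
suff main h y : lspan v h y -> exists c r, lspan v 1 r /\ y = c *: v + r.
  exact: main (lspan_full z).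
clear z; elim => {h y} [|h|h c y z _ IHy _ IHz|a h m z la hz _ _].
- by exists 1, 0; rewrite scale1r addr0; split=> //; exact: L0.
- by exists 0, 0; rewrite scale0r addr0; split=> //; exact: L0.
- have [b [r [sr ->]]] := IHy; have [d [t [st ->]]] := IHz.
  exists (c * b + d), (c *: r + t); split; first exact: LLin.
  by rewrite scalerDr scalerA scalerDl; zmod_solve.
- exists 0, (shifted a z); rewrite scale0r add0r; split=> //.
  by apply: (LShift la hz); have := ht_gt0 la; lia.
Qed.

Lemma tau_lspan r : lspan v 1 r -> tau r = 0.
Proof.
move=> sr; apply: (lspan_word_vanish sr); first by rewrite powers_lower ?roots_lower.
by rewrite weight_powers addn1.
Qed.

(* Nakayama's lemma: the shifted lower root vectors act nilpotently. *)
Lemma lspan_nakayama P r : lower_stable P -> lspan v 1 r -> P (v + r) -> P v.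
Proof.
move=> lP sr Pvr; pose H := (p.-1 * weight ht roots)%N; have sP := lP.1.
(* Downward induction on the step h, which is zero beyond H. Writing v as (v + r) - r, the first
   part is in P and the second leads to a deeper step. *)
suff main d h z : (H < d + h)%N -> lspan v h z -> P z.
  by apply: (main H.+1 0%N); [rewrite addn0|exact: LBase].
elim: d h z => [|d IHd] h z Hd hz.
  by have := lspan_word_vanish (l := [::]) hz; rewrite weight_nil /= => ->; case: sP.
suff: forall l, all lower l -> (H < d.+1 + (weight ht l + h))%N -> P (word shifted l z).
  by move=> /(_ [::]); apply; rewrite ?weight_nil.
elim: hz {Hd} => {h z} [|h|h c y z _ IHy _ IHz|a h m z la hz IHz mh] l ll Hl.
- rewrite addn0 in Hl; have -> : v = v + r - r by rewrite addrK.
  rewrite raddfB /=; apply: subspaceB => //; first exact: lower_stable_word.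
  by apply: (IHd (weight ht l).+1); rewrite ?addnS -?addSn // -addn1; exact: lspan_word.
- by rewrite raddf0; case: sP.
- by rewrite linearP; apply: sP.2; [exact: IHy|exact: IHz].
have -> : word shifted l (shifted a z) = word shifted (l ++ [:: a]) z by rewrite word_cat.
apply: IHz; first by rewrite all_cat ll /= la.
by rewrite weight_cat weight_cons weight_nil; lia.
Qed.

(** [tau] kills step 1 and so detects the coefficient of v in z. If this is nonzero, z is a multiple
    of v modulo step 1, and Nakayama's lemma applies. *)
Lemma tau_neq0_full P z : lower_stable P -> P z -> tau z != 0 -> forall y, P y.
Proof.
move=> lP Pz tz; apply: lower_stable_full => //.
have [c [r [sr zE]]] := lspan_split z.
have c0 : c != 0.
  by apply/eqP => c0; move: tz; rewrite zE c0 scale0r add0r tau_lspan ?eqxx.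
apply: (lspan_nakayama (r := c^-1 *: r)) => //.
  by apply: subspaceZ => //; exact: lspan_subspace.
have -> : v + c^-1 *: r = c^-1 *: z by rewrite zE scalerDr scalerA mulVf // scale1r.
by apply: subspaceZ => //; case: lP.
Qed.

Lemma tau_dual_top_neq0 w : whittaker w -> w != 0 -> tau (dual_top w) != 0.
Proof.
move=> wh w0; rewrite tau_dual_top // scaler_eq0 negb_or w0 andbT.
by rewrite expf_neq0 ?fact_pred_pchar.
Qed.

(** By [tau_dual_top], w is up to a nonzero scalar a value of [tau], and all values of [tau] lie on
    the line through [tau v]. *)
Lemma whittaker_tau_v w : whittaker w -> exists c, w = c *: tau v.
Proof.
move=> wh; have [c [r [sr zE]]] := lspan_split (dual_top w).
have := tau_dual_top wh; rewrite zE linearP (tau_lspan sr) addr0 => Ew.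
have k0 : (p.-1)`!%:R ^+ size roots != 0 :> K by rewrite expf_neq0 ?fact_pred_pchar.
exists (((p.-1)`!%:R ^+ size roots)^-1 * c); rewrite -scalerA.
by rewrite Ew scalerA mulVf // scale1r.
Qed.

Lemma lower_stable_tau P z : lower_stable P -> P z -> z != 0 -> P (tau v).
Proof.
move=> lP Pz z0; have [w [Pw w0 wh]] := exists_whittaker lP.2 Pz z0.
have [c Ew] := whittaker_tau_v wh; have c0 : c != 0.
  by apply/eqP => c0; move: w0; rewrite Ew c0 scale0r eqxx.
have -> : tau v = c^-1 *: w by rewrite Ew scalerA mulVf // scale1r.
by apply: subspaceZ => //; case: lP.
Qed.

(** A gl_n-stable subspace is also closed under the dual operators, which lead from a Whittaker
    vector in it back to a vector on which [tau] does not vanish. *)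
Lemma stable_full P z : stable P -> P z -> z != 0 -> forall y, P y.
Proof.
move=> sP Pz z0; have lP := stable_lower sP.
have [w [Pw w0 wh]] := exists_whittaker lP.2 Pz z0.
by apply: (tau_neq0_full lP (z := dual_top w)); [exact: stable_dual_top|exact: tau_dual_top_neq0].
Qed.

Lemma tau_v_neq0 : tau v != 0.
Proof.
have P0 : stable (fun=> True) by split=> //; split.
have [w [_ w0 wh]] := exists_whittaker (fun a y _ _ => I : (fun=> True) (shifted a y)) I v_neq0.
have [c Ew] := whittaker_tau_v wh.
by apply/eqP => tv; move: w0; rewrite Ew tv scaler0 eqxx.
Qed.

End Cyclic.
End GeneralLinear.

(** * The Casimir operator *)

Section Casimir.
Variables (K : fieldType) (p : nat) (n : nat) (V : lmodType K).
Variable E : 'I_n -> 'I_n -> {linear V -> V}.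
Hypotheses (hp : p \in [pchar K]) (rep : gl_rep p E).

(* The Casimir operator of V (x) K^n, whose elements are written as functions
   'I_n -> V; [diag_act] is the action of E_ij on this tensor product. *)
Definition casimir (f : {ffun 'I_n -> V}) : {ffun 'I_n -> V} :=
  [ffun j => \sum_k E k j (f k)].
Definition diag_act (i j : 'I_n) (f : {ffun 'I_n -> V}) : {ffun 'I_n -> V} :=
  [ffun k => E i j (f k) + f j *+ (k == i)].
Definition single (z : V) (i : 'I_n) : {ffun 'I_n -> V} :=
  [ffun k => z *+ (k == i)].

Lemma casimir_is_linear : linear casimir.
Proof.
move=> c f g; apply/ffunP => j; rewrite !ffunE scaler_sumr -big_split /=.
by apply: eq_bigr => k _; rewrite !ffunE linearP.
Qed.
HB.instance Definition _ := GRing.isLinear.Build K {ffun 'I_n -> V} {ffun 'I_n -> V} _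
  casimir casimir_is_linear.

Lemma diag_act_is_linear i j : linear (diag_act i j).
Proof.
move=> c f g; apply/ffunP => k; rewrite !ffunE linearP scalerDr mulrnDl scalerMnr.
by zmod_solve.
Qed.
HB.instance Definition _ i j := GRing.isLinear.Build K {ffun 'I_n -> V} {ffun 'I_n -> V} _
  (diag_act i j) (diag_act_is_linear i j).

Lemma casimir_diag_act i j f : casimir (diag_act i j f) = diag_act i j (casimir f).
Proof.
apply/ffunP => l; rewrite !ffunE.
rewrite (eq_bigr (fun k => E i j (E k l (f k)) + (E k j (f k) *+ (l == i)
    - E i l (f k) *+ (j == k) + E k l (f j) *+ (i == k)))); last first.
  move=> k _; rewrite !ffunE raddfD raddfMn /= (gl_bracket rep) [k == i]eq_sym.
  by zmod_solve.
rewrite !big_split /= raddf_sum /= -sumrMnl; congr (_ + _).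
rewrite -[RHS]addr0 -addrA; congr (_ + _).
rewrite (bigD1 j) //= eqxx big1 => [|k]; last first.
  by rewrite eq_sym => /negbTE->; rewrite oppr0.
rewrite (bigD1 i) //= eqxx big1 ?addr0 ?addNr // => k.
by rewrite eq_sym => /negbTE->.
Qed.

Lemma singleE (f : {ffun 'I_n -> V}) : f = \sum_i single (f i) i.
Proof.
apply/ffunP => k; rewrite sum_ffunE (bigD1 k) //= ffunE eqxx big1 ?addr0 // => i.
by rewrite ffunE eq_sym => /negbTE->.
Qed.

(** For z of highest weight mu this is the usual filtration of V (x) K^n whose k-th quotient is
    generated by a vector of weight mu + eps_k. *)
Inductive tensor_filt (z : V) (k : nat) : {ffun 'I_n -> V} -> Prop :=
| TFBase (i : 'I_n) of (i < k)%N : tensor_filt z k (single z i)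
| TF0 : tensor_filt z k 0
| TFLin c f g of tensor_filt z k f & tensor_filt z k g : tensor_filt z k (c *: f + g)
| TFAct i j f of tensor_filt z k f : tensor_filt z k (diag_act i j f).

Lemma tensor_filt_subspace z k : subspace (tensor_filt z k).
Proof. by split; [exact: TF0|exact: TFLin]. Qed.

Lemma tensor_filt_eq0 z f : tensor_filt z 0 f -> f = 0.
Proof.
elim=> {f} // [c f g _ -> _ ->|i j f _ ->]; first by rewrite scaler0 addr0.
exact: raddf0.
Qed.

Lemma tensor_filt_full z f : generates E z -> tensor_filt z n f.
Proof.
move=> gz; have sT := tensor_filt_subspace z n.
suff Hs y : forall i, tensor_filt z n (single y i).
  by rewrite (singleE f); apply: subspace_sum.
move: y; apply: gz; last by move=> i; exact: TFBase.
split=> [|i j y IHy k].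
  split=> [i|c x y IHx IHy i].
    have -> : single 0 i = 0 by apply/ffunP => k; rewrite !ffunE mul0rn.
    exact: TF0.
  have -> : single (c *: x + y) i = c *: single x i + single y i.
    by apply/ffunP => k; rewrite !ffunE mulrnDl scalerMnr.
  exact: TFLin.
have -> : single (E i j y) k = diag_act i j (single y k) - (j == k)%:R *: single y i.
  apply/ffunP => l; rewrite !ffunE raddfMn -scalerMnr scaler_nat -!mulrnA.
  by rewrite [(_ * (l == i))%N]mulnC addrK.
by apply: subspaceB => //; [exact: TFAct|apply: subspaceZ].
Qed.

Section HighestWeight.
Variables (mu : 'I_n -> K) (z : V).
Hypothesis (z_hw : hw E mu z).

(** The term - i arises because each E_ij with j < i also moves e_j to e_i and so contributes one
    copy of z (x) e_i. *)
Lemma casimir_single i : casimir (single z i) =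
  (mu i - i%:R) *: single z i + \sum_(j < n | (j < i)%N) diag_act i j (single z j).
Proof.
have [Ed Eu] := z_hw; apply/ffunP => t; rewrite !ffunE sum_ffunE.
rewrite (bigD1 i) //= !ffunE eqxx big1 ?addr0; last first.
  by move=> k /negbTE ki; rewrite ffunE ki mulr0n raddf0.
under eq_bigr do rewrite !ffunE eqxx raddfMn.
rewrite big_split /= (sum_pred1_eq _ _ (fun k => E i k z)) sumr_const.
have -> : #|[pred j : 'I_n | (j < i)%N]| = i.
  rewrite -sum1_card (big_ord_narrow (ltnW (ltn_ord i))) /=.
  by rewrite sum1_card card_ord.
rewrite !mulr1n -[t == i]val_eqE.
case: (ltngtP t i) => [ti|it|/val_inj->].
- by rewrite mulr1n !mulr0n mul0rn scaler0 addr0 add0r.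
- by rewrite Eu // !mulr0n mul0rn scaler0 !addr0.
- by rewrite Ed !mulr1n mulr0n add0r scalerBl scaler_nat subrK.
Qed.

Lemma casimir_filt k f : tensor_filt z k f -> tensor_filt z k (casimir f).
Proof.
have sT := tensor_filt_subspace z k.
elim=> {f} [i ik||c f g _ IHf _ IHg|i j f _ IHf].
- rewrite casimir_single; apply: subspaceD => //.
    by apply: subspaceZ => //; exact: TFBase.
  apply: subspace_sum => // j ji; apply/TFAct/TFBase; exact: ltn_trans ik.
- by rewrite raddf0; exact: TF0.
- by rewrite linearP; exact: TFLin.
- by rewrite casimir_diag_act; exact: TFAct.
Qed.

Lemma casimir_filtS (k : 'I_n) f : tensor_filt z k.+1 f ->
  tensor_filt z k (casimir f - (mu k - k%:R) *: f).
Proof.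
have sT := tensor_filt_subspace z k.
elim=> {f} [i ik||c f g _ IHf _ IHg|i j f _ IHf].
- have [ik'|] := ltnP i k.
    apply: subspaceB => //; first exact/casimir_filt/TFBase.
    by apply: subspaceZ => //; exact: TFBase.
  move=> ki; have <- : i = k by apply/val_inj/eqP; rewrite eqn_leq ki -ltnS ik.
  rewrite casimir_single addrC addrA addNr add0r.
  apply: subspace_sum; first exact: tensor_filt_subspace.
  by move=> j ji; apply/TFAct/TFBase.
- by rewrite raddf0 scaler0 subr0; exact: TF0.
- have -> : casimir (c *: f + g) - (mu k - k%:R) *: (c *: f + g) =
    c *: (casimir f - (mu k - k%:R) *: f) + (casimir g - (mu k - k%:R) *: g).
    rewrite linearP scalerDr !scalerA [in RHS]scalerBr scalerA mulrC; zmod_solve.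
  exact: TFLin.
- by rewrite casimir_diag_act -linearZ -raddfB; exact: TFAct.
Qed.

Definition weight_poly (nu : 'I_n -> K) : {poly K} :=
  \prod_(i < n) ('X - (nu i - i%:R)%:P).

(** The Casimir operator is triangular for [tensor_filt], with scalar mu_k - k on the k-th quotient,
    so the factors are applied from the last one down. *)
Lemma casimir_weight_poly f : generates E z -> pact casimir (weight_poly mu) f = 0.
Proof.
move=> gz; rewrite /weight_poly -big_enum pact_prod.
have := tensor_filt_full f gz; set h := fun _ _ => _.
suff main m g : (m <= n)%N -> tensor_filt z m g ->
    foldr h g (take m (enum 'I_n)) = 0.
  by move/(main _ _ (leqnn n)); rewrite take_oversize ?size_enum_ord.
elim: m g => [|m IHm] g mn mg; first by rewrite take0 /=; exact: tensor_filt_eq0 mg.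
rewrite (take_nth (Ordinal mn)) ?size_enum_ord // foldr_rcons.
apply: IHm; first exact: ltnW.
have -> : nth (Ordinal mn) (enum 'I_n) m = Ordinal mn.
  by apply: val_inj; rewrite /= nth_enum_ord.
exact: (casimir_filtS (k := Ordinal mn)).
Qed.

End HighestWeight.

Section MinimalPolynomial.
Variable (w : V) (o : 'I_n).
Hypotheses (wh : whittaker E w) (oE : o = n.-1 :> nat).

(** One application lowers the smallest index of a nonzero component by at most one: below index
    n-1-s the Kazhdan degree is 0. At this index only the subdiagonal root vector contributes, and
    it fixes w because [chi] is 1 there. *)
Lemma casimir_iter s (j : 'I_n) :
  kazhdan E w (j + s + 2 - n) (iter s casimir (single w o) j) /\
  ((j + s).+1 = n -> iter s casimir (single w o) j = w).
Proof.
have n0 : (0 < n)%N by apply: leq_ltn_trans (ltn_ord o).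
elim: s j => [|s IHs] j /=.
  rewrite ffunE addn0; have [->|jo] := eqVneq j o.
    by rewrite mulr1n; split=> //; apply: KazBase; rewrite oE; lia.
  rewrite mulr0n; split=> [|jn]; first exact: Kaz0.
  by case/eqP: jo; apply: val_inj; rewrite /= oE; lia.
rewrite ffunE; set z := iter s _ _ in IHs *; split=> [|jn].
  apply: subspace_sum; first exact: kazhdan_subspace.
  move=> k _; have [kz _] := IHs k; have [ks|ks] := leqP n (k + s + 2).
    by apply: (kazhdan_E hp (fun a la => kazhdan_shifted hp rep wh kz la) kz); lia.
  rewrite (_ : _ - _ = 0)%N in kz; last by lia.
  by rewrite (kazhdan_eq0 kz) raddf0; exact: Kaz0.
have j1 : (j.+1 < n)%N by lia.
rewrite (bigD1 (Ordinal j1)) //= big1 => [|k kj].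
  have [_ ->] := IHs (Ordinal j1); last by rewrite /=; lia.
  have la : lower (Ordinal j1, j) by rewrite /lower /=.
  by rewrite (E_shifted E (Ordinal j1, j)) wh // /chi eqxx scale1r add0r addr0.
have [kz _] := IHs k; have [kj'|jk] := leqP k j.
  rewrite (_ : _ - _ = 0)%N in kz; last by lia.
  by rewrite (kazhdan_eq0 kz) raddf0.
have la : lower (k, j) by [].
rewrite (E_shifted E (k, j)) /chi /= (_ : (k == j.+1 :> nat) = false) ?scale0r ?addr0.
  have := kazhdan_shifted hp rep wh kz la; rewrite (_ : _ - _ = 0)%N; last by rewrite /ht /=; lia.
  exact: kazhdan_eq0.
by apply: contraNF kj => /eqP kj; apply/eqP/val_inj.
Qed.

(** By [casimir_iter] the first n iterates are in echelon form: the component of index n-1-deg q is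
    the leading coefficient times w. *)
Lemma casimir_faithful (q : {poly K}) : w != 0 -> q != 0 -> (size q <= n)%N ->
  pact casimir q (single w o) != 0.
Proof.
move=> w0 q0; have : (0 < size q)%N by rewrite size_poly_gt0.
have := lead_coefE q; rewrite /pact; case: (size q) => // r qr _ rn.
have jn : (n.-1 - r < n)%N by lia.
apply/eqP => /ffunP/(_ (Ordinal jn)); rewrite sum_ffunE big_ord_recr big1 /=.
  rewrite !ffunE add0r (casimir_iter r (Ordinal jn)).2 /=; last by lia.
  by move/eqP; rewrite scaler_eq0 (negbTE w0) orbF -qr lead_coef_eq0 (negbTE q0).
move=> i _; rewrite !ffunE; have [+ _] := casimir_iter i (Ordinal jn).
rewrite (_ : _ - _ = 0)%N => [/kazhdan_eq0->|]; first by rewrite scaler0.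
by have := ltn_ord i; rewrite /=; lia.
Qed.

End MinimalPolynomial.

(** Both polynomials are monic of degree n and annihilate V (x) K^n, so their difference has degree
    less than n and [casimir_faithful] forces it to be 0. *)
Lemma weight_poly_eq mu nu v z : hw E mu v -> generates E v -> v != 0 ->
  hw E nu z -> generates E z -> weight_poly mu = weight_poly nu.
Proof.
move=> hv gv v0 hz gz; case: (posnP n) => [n0|n0].
  by rewrite /weight_poly !big1 // => -[i i_lt] _; exfalso; lia.
have o_lt : (n.-1 < n)%N by lia.
have wh := whittaker_tau hp rep v; have w0 := tau_v_neq0 hp rep hv gv v0.
apply/eqP; rewrite -subr_eq0; apply/negPn/negP => d0.
have szP k : size (weight_poly k) = n.+1.
  by rewrite /weight_poly -big_enum size_prod_XsubC size_enum_ord.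
have lead1 k : (weight_poly k)`_n = 1.
  have /monicP : weight_poly k \is monic by apply: monic_prod_XsubC.
  by rewrite lead_coefE szP.
have /(casimir_faithful wh (erefl _ : Ordinal o_lt = n.-1 :> nat) w0 d0) :
    (size (weight_poly mu - weight_poly nu)%R <= n)%N.
  apply/leq_sizeP => j; rewrite leq_eqVlt coefB => /orP[/eqP<-|nj].
    by rewrite !lead1 subrr.
  by rewrite !nth_default ?szP // subrr.
by rewrite pactB (casimir_weight_poly hv) // (casimir_weight_poly hz) // subrr eqxx.
Qed.

End Casimir.

(** * Weights in the prime field *)

Section PrimeField.
Variables (K : fieldType) (p : nat).
Hypothesis hp : p \in [pchar K].

Definition in_prime_field (x : K) := exists m : nat, x = m%:R.

Lemma prime_fieldP x : in_prime_field x -> exists2 m, (m < p)%N & x = m%:R.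
Proof.
case=> m ->; exists (m %% p)%N; first by rewrite ltn_pmod // prime_gt0 ?(pcharf_prime hp).
by rewrite {1}(divn_eq m p) natrD natrM (pcharf0 hp) mulr0 add0r.
Qed.

Lemma in_prime_field_nat m : in_prime_field m%:R. Proof. by exists m. Qed.
Lemma in_prime_fieldD x y : in_prime_field x -> in_prime_field y -> in_prime_field (x + y).
Proof. by case=> a -> [b ->]; exists (a + b)%N; rewrite natrD. Qed.
Lemma in_prime_fieldN x : in_prime_field x -> in_prime_field (- x).
Proof.
case/prime_fieldP=> a ap ->; exists (p - a)%N.
by rewrite natrB 1?ltnW // (pcharf0 hp) sub0r.
Qed.
Lemma in_prime_fieldB x y : in_prime_field x -> in_prime_field y -> in_prime_field (x - y).
Proof. by move=> Fx Fy; apply/in_prime_fieldD/in_prime_fieldN. Qed.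

Lemma prime_field_pow x : in_prime_field x -> x ^+ p = x.
Proof. by case=> m ->; rewrite -(pFrobenius_autE hp) rmorph_nat. Qed.

Lemma prod_prime_field :
  'X^p - 'X = \prod_(m <- iota 0 p) ('X - (m%:R)%:P) :> {poly K}.
Proof.
have p1 := prime_gt1 (pcharf_prime hp).
have sz : size ('X^p - 'X : {poly K}) = p.+1.
  by rewrite size_polyDl ?size_polyN ?size_polyXn ?size_polyX ?ltnS.
pose rs := [seq (m%:R : K) | m <- iota 0 p].
have urs : uniq_roots rs.
  rewrite uniq_rootsE map_inj_in_uniq ?iota_uniq // => a b; rewrite !mem_iota !add0n /= => ap bp.
  wlog ab : a b ap bp / (a <= b)%N.
    by move=> H E0; case: (leqP a b) => [|/ltnW] ab; [apply: H|apply/esym/H].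
  move=> E0; have : (p %| b - a)%N by rewrite (dvdn_pcharf hp) natrB // E0 subrr.
  have [->//|ba] := eqVneq a b.
  by move/dvdn_leq => H; have := H _; lia.
have ars : all (root ('X^p - 'X)) rs.
  apply/allP => y /mapP[m _ ->]; rewrite rootE !hornerE prime_field_pow ?subrr //.
  exact: in_prime_field_nat.
rewrite (all_roots_prod_XsubC _ ars urs) ?sz ?size_map ?size_iota // big_map.
rewrite lead_coefE sz coefB coefXn coefX eqxx (_ : (p == 1)%N = false) ?subr0 ?scale1r //.
by apply/eqP; lia.
Qed.

Lemma pow_prime_field x : x ^+ p = x -> in_prime_field x.
Proof.
move=> xp; have : root ('X^p - 'X) x by rewrite rootE !hornerE xp subrr.
rewrite prod_prime_field -(big_map _ predT (fun z => 'X - z%:P)) root_prod_XsubC.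
by case/mapP => m _ ->; exists m.
Qed.

(** Invariance makes the multiplicity constant on the prime field, and the p multiplicities add up
    to the size. So such a multiset is determined by its size. *)
Lemma count_prime_field (s : seq K) m :
    (forall x, x \in s -> in_prime_field x) ->
    (forall x, count_mem x s = count_mem (x + 1) s) ->
  (count_mem m%:R s * p = size s)%N.
Proof.
move=> Fs shift.
have c0 k : count_mem k%:R s = count_mem 0 s.
  by elim: k => // k IHk; rewrite -addn1 natrD -shift.
rewrite c0 mulnC -[RHS]count_predT.
transitivity (\sum_(k < p) count_mem (k%:R : K) s)%N.
  by rewrite (eq_bigr (fun=> count_mem 0 s)) ?sum_nat_const ?card_ord.
elim: s Fs {shift c0} => [|x s IHs] Fs; first by rewrite big1.
rewrite /= big_split /= IHs => [|y ys]; last by apply: Fs; rewrite inE ys orbT.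
congr (_ + _)%N; have [a ap ->] := prime_fieldP (Fs x (mem_head _ _)).
rewrite (bigD1 (Ordinal ap)) //= eqxx big1 // => i ia.
apply/eqP; rewrite eqb0; apply: contraNneq ia => E0; apply/eqP/val_inj => /=.
have ip := ltn_ord i.
wlog ai : a i ap ip E0 / (a <= i)%N.
  move=> H; case: (leqP a i) => [|/ltnW] ai; first exact: H.
  by apply/esym; apply: (H i (Ordinal ap)).
have [//|ne] := eqVneq (val i) a.
have : (p %| i - a)%N by rewrite (dvdn_pcharf hp) natrB // -E0 subrr.
by move/dvdn_leq => H; have := H _; move/eqP: ne => /= ne; lia.
Qed.

(* Both multisets are invariant under translation by 1, so they contain each
   element of the prime field equally often. *)
Lemma shift_invariant_perm n (b : 'I_n -> K) c : (p %| n)%N ->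
    (forall k, in_prime_field (b k)) -> in_prime_field c -> c != 0 ->
    \prod_(k < n) ('X - (b k)%:P) = \prod_(k < n) ('X - (b k + c)%:P) ->
  exists s : 'S_n, forall k, b k = - (s k)%:R.
Proof.
move=> pn Fb Fc c0 prodE.
have p_gt0 : (0 < p)%N by rewrite prime_gt0 ?(pcharf_prime hp).
pose s := [tuple b k | k < n]; pose t := [tuple (- (val k)%:R : K) | k < n].
have Fs x : x \in (s : seq K) -> in_prime_field x by case/mapP => k _ ->.
have Ft x : x \in (t : seq K) -> in_prime_field x.
  by case/mapP => k _ ->; apply/in_prime_fieldN/in_prime_field_nat.
have shift_c x : count_mem x s = count_mem (x + c) s.
  have /seq.permP/(_ (pred1 (x + c))) : perm_eq s [seq b k + c | k <- enum 'I_n].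
    by apply: prod_XsubC_eq; rewrite !big_map -!big_enum in prodE *.
  move=> ->; rewrite !count_map; apply: eq_count => k /=.
  by rewrite (inj_eq (addIr c)).
(* 1 = c^(p-2) c, and c^(p-2) is the image of the natural number a^(p-2): that many translations by
   c make up a translation by 1. *)
have shift_s x : count_mem x s = count_mem (x + 1) s.
  have iter_c j y : count_mem y s = count_mem (y + j%:R * c) s.
    elim: j y => [|j IHj] y; first by rewrite mul0r addr0.
    by rewrite IHj shift_c -addn1 natrD mulrDl mul1r addrA.
  have [a ca] := Fc; rewrite (iter_c (a ^ p.-2)%N x); congr (count_mem (x + _) s).
  rewrite natrX -ca -exprSr; apply: (mulIf c0); rewrite -exprSr mul1r.
  have p1 := prime_gt1 (pcharf_prime hp).
  by rewrite (_ : p.-2.+2 = p)%N ?prime_field_pow //; lia.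
(* As n = 0 in K, a translation by 1 is the cyclic shift of the indices. *)
have shift_t x : count_mem x t = count_mem (x + 1) t.
  have cE y : count_mem y t = (\sum_(k < n) (- (val k)%:R == y :> K))%N.
    rewrite /= count_map -sum1_count big_mkcond big_enum /=.
    by apply: eq_bigr => k _; case: (_ == _).
  rewrite !cE (reindex_inj (@ordS_inj n)) /=; apply: eq_bigr => k _.
  have -> : (k.+1 %% n)%:R = k.+1%:R :> K.
    have /eqP n0 : n%:R == 0 :> K by rewrite -(dvdn_pcharf hp).
    by rewrite [in RHS](divn_eq k.+1 n) natrD natrM n0 mulr0 add0r.
  congr nat_of_bool; apply/eqP/eqP => [<-|E0].
    by rewrite -addn1 natrD opprD subrK.
  by apply: (addIr 1); rewrite -E0 -addn1 natrD opprD subrK.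
have : perm_eq s t.
  apply/allP => x _ /=; apply/eqP.
  have [Fx|nFx] := pselect (in_prime_field x); last first.
    have /count_memPn -> : x \notin (s : seq K) by apply/negP => /Fs.
    by have /count_memPn -> : x \notin (t : seq K) by apply/negP => /Ft.
  case: Fx => m ->; apply/eqP; rewrite -(eqn_pmul2r p_gt0).
  by rewrite !count_prime_field // !size_tuple.
case/tuple_permP => q stE; exists q => k.
have := congr1 (fun u => tnth u k) (val_inj stE : s = _).
by rewrite !tnth_mktuple.
Qed.

End PrimeField.

(** * Highest weight vectors and adjacent transpositions *)

Section Reflections.
Variables (K : fieldType) (p : nat) (n : nat) (V : lmodType K).
Variable E : 'I_n -> 'I_n -> {linear V -> V}.
Hypotheses (hp : p \in [pchar K]) (rep : gl_rep p E).

(** The simple root vectors generate the others: E_ij = [E_ik, E_kj] for k = j - 1. *)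
Lemma hw_simple mu z : (forall i, E i i z = mu i *: z) ->
    (forall i j : 'I_n, j = i.+1 :> nat -> E i j z = 0) ->
  hw E mu z.
Proof.
move=> Ed Es; split=> // i j ij; move: {-1}(j - i)%N (leqnn (j - i)) => d.
elim: d i j ij => [|d IHd] i j ij dij; first by lia.
have [ji|ji] := eqVneq (j : nat) i.+1; first exact: Es.
have k_lt : (j.-1 < n)%N by have := ltn_ord j; lia.
pose k := Ordinal k_lt; have jk : j = k.+1 :> nat by rewrite /=; lia.
have := gl_bracket rep i k k j z; rewrite (Es k j jk) raddf0 eqxx.
rewrite (_ : (j == i) = false) ?subr0; last by apply/eqP => E0; move: ij; rewrite E0 ltnn.
have -> : E i k z = 0 by apply: IHd; rewrite /=; move/eqP: ji; lia.
by rewrite raddf0 add0r mulr1n.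
Qed.

Section Pair.
Variables (i j : 'I_n) (mu : 'I_n -> K) (z : V).
Hypotheses (ji : j = i.+1 :> nat) (z_hw : hw E mu z).

Let ij : (i == j) = false.
Proof. by apply/eqP => E0; move: ji; rewrite E0; lia. Qed.

Lemma diag_lower_iter a k : E k k (iter a (E j i) z) =
  (mu k + a%:R * ((k == j)%:R - (k == i)%:R)) *: iter a (E j i) z.
Proof.
elim: a => [|a IHa] /=; first by rewrite mul0r addr0 z_hw.1.
rewrite (gl_bracket rep) IHa linearZ_LR /= [i == k]eq_sym -[a.+1]addn1 natrD.
case: (eqVneq k j) => [->|kj].
  rewrite [j == i]eq_sym ij mulr0n mulr1n subr0 -[X in _ + X]scale1r -scalerDl.
  by congr (_ *: _); ring.
case: (eqVneq k i) => [->|ki].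
  rewrite mulr0n mulr1n addr0 -[X in _ - X]scale1r -scalerBl.
  by congr (_ *: _); ring.
by rewrite !mulr0n addr0 subr0; congr (_ *: _); ring.
Qed.

Lemma raise_lower_iter a : E i j (iter a.+1 (E j i) z) =
  (a.+1%:R * (mu i - mu j - a%:R)) *: iter a (E j i) z.
Proof.
elim: a => [|a IHa].
  rewrite /= (gl_bracket rep) !eqxx (z_hw.2 i j) ?ji // raddf0 !z_hw.1.
  by rewrite add0r !mulr1n subr0 mul1r scalerBl.
rewrite iterS (gl_bracket rep) IHa !eqxx linearZ_LR /= -[E j i (iter a _ z)]/(iter a.+1 (E j i) z).
rewrite -[E i i (E j i _)]/(E i i (iter a.+1 (E j i) z)).
rewrite -[E j j (E j i _)]/(E j j (iter a.+1 (E j i) z)) !diag_lower_iter.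
rewrite !eqxx ij [j == i]eq_sym ij /= !mulr1n -scalerDl -scalerBl; congr (_ *: _).
by rewrite -[a.+2]addn1 -[a.+1]addn1 !natrD; ring.
Qed.

(** The p-th power of this root vector is the identity because [chi] takes the value 1 on it; hence
    no power of it kills a nonzero vector. *)
Lemma lower_inj a : z != 0 -> iter a (E j i) z != 0.
Proof.
move=> z0; elim: a => // a IHa; apply: contra IHa => /eqP E0.
have lij : (i < j)%N by rewrite ji.
have := gl_pow rep (iter a (E j i) z) lij; rewrite ji eqxx mulr1n => <-.
have := prime_gt0 (pcharf_prime hp); case: (p) => // q _.
by rewrite iterSr [E j i _]E0; elim: q => //= q /eqP->; rewrite raddf0.
Qed.

End Pair.

(** With b_i = mu_i - i, which is mu + rho up to a constant, the dot action is a plain permutation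
    of the b_i. *)
Definition shifted_hw (b : 'I_n -> K) := hw E (fun i => b i + i%:R).

Lemma shifted_hw_ext b c z : b =1 c -> shifted_hw b z -> shifted_hw c z.
Proof. by move=> bc [Ed Eu]; split=> // i; rewrite Ed bc. Qed.

(** If b_i - b_j is the image of the natural number a, then the a-th power of E_ji subtracts a from
    b_i and adds it to b_j, which exchanges them. The result is again of highest weight because the
    factor mu_i - mu_j - (a-1) in [raise_lower_iter] is 0. *)
Lemma reflection (i j : 'I_n) b z : j = i.+1 :> nat ->
    in_prime_field (b i - b j) -> shifted_hw b z -> z != 0 ->
  exists2 y, shifted_hw (b \o tperm i j) y & y != 0.
Proof.
move=> ji [a ab] zb z0.
have nij : (j == i) = false by apply/eqP => E0; move: ji; rewrite E0; lia.
exists (iter a (E j i) z); last exact: lower_inj.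
apply: hw_simple => [k|k l lk].
  rewrite (diag_lower_iter ji zb) /= -ab; congr (_ *: _).
  case: tpermP => [->|->|/eqP/negbTE-> /eqP/negbTE->] /=; last by ring.
    by rewrite eqxx [i == j]eq_sym nij /=; ring.
  by rewrite eqxx nij /=; ring.
have [ki|ki] := eqVneq k i.
  have -> : l = j by apply: ord_inj; rewrite lk ki ji.
  rewrite ki; case: a ab => [|a] ab /=; first by apply: zb.2; rewrite ji.
  rewrite -[E j i _]/(iter a.+1 (E j i) z) (raise_lower_iter ji zb).
  rewrite (_ : _ * _ = 0) ?scale0r //.
  apply/eqP; rewrite mulf_eq0; apply/orP; right; rewrite ji.
  have -> : b i = b j + a.+1%:R by rewrite -ab addrC subrK.
  by apply/eqP; rewrite -[i.+1]addn1 -[a.+1]addn1 !natrD; ring.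
elim: a {ab} => [|a IHa] /=; first by apply: zb.2; rewrite lk.
rewrite (gl_bracket rep) IHa raddf0 add0r.
rewrite (_ : (l == j) = false); last first.
  by apply/eqP => lj; case/eqP: ki; apply: ord_inj; move: lk; rewrite lj ji => -[].
by rewrite eq_sym (negbTE ki) !mulr0n subr0.
Qed.

Lemma shifted_hw_perm b z (s : 'S_n) : (forall k l, in_prime_field (b k - b l)) ->
    shifted_hw b z -> z != 0 -> exists2 y, shifted_hw (b \o s) y & y != 0.
Proof.
move=> Fb zb z0.
(* The weight is quantified inside [Q] because each factor of a product acts on a weight that other
   factors have already permuted. *)
pose Q (t : 'S_n) := forall b, (forall k l, in_prime_field (b k - b l)) ->
  (exists2 y, shifted_hw b y & y != 0) -> exists2 y, shifted_hw (b \o t) y & y != 0.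
have QM t u : Q t -> Q u -> Q (t * u)%g.
  move=> Qt Qu c Fc yc.
  have [y cy y0] : exists2 y, shifted_hw ((c \o u) \o t) y & y != 0.
    by apply: Qt; [move=> k l; exact: Fc|exact: Qu].
  by exists y => //; apply: shifted_hw_ext cy => k; rewrite /= permM.
have Qtr d (i j : 'I_n) : (i < j)%N -> (j - i <= d)%N -> Q (tperm i j).
  elim: d i j => [|d IHd] i j ij dij; first by lia.
  have [ji|ji] := eqVneq (j : nat) i.+1.
    by move=> c Fc [y cy y0]; apply: (reflection ji (Fc i j) cy y0).
  have k_lt : (j.-1 < n)%N by have := ltn_ord j; lia.
  pose k := Ordinal k_lt; have kj : (k < j)%N by rewrite /=; lia.
  have ik : (i < k)%N by rewrite /=; move/eqP: ji; lia.
  have -> : tperm i j = (tperm k j * tperm i k * tperm k j)%g.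
    have := tpermJ i k (tperm k j); rewrite /conjg tpermV tpermL tpermD; first by move<-; rewrite mulgA.
      by apply/eqP => E0; move: ik; rewrite -E0 ltnn.
    by apply/eqP => E0; move: ij; rewrite E0 ltnn.
  have Qkj : Q (tperm k j).
    move=> c Fc [y cy y0]; have jk : j = k.+1 :> nat by rewrite /=; lia.
    exact: (reflection jk (Fc k j) cy y0).
  by apply: (QM) => //; apply: (QM) => //; apply: IHd => //=; lia.
have [ts -> _] := prod_tpermP s; move: Fb; suff QP : Q (\prod_(t <- ts) tperm t.1 t.2)%g.
  by move=> Fb; apply: QP => //; exists z.
apply: (big_ind Q) => // [c Fc [y cy y0]|[i j] _ /=].
  by exists y => //; apply: shifted_hw_ext cy => k; rewrite /= perm1.
case: (ltngtP i j) => [ij|ij|/val_inj->].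
- exact: Qtr ij (leqnn _).
- by rewrite tpermC; exact: Qtr ij (leqnn _).
- move=> c Fc [y cy y0]; exists y => //; apply: shifted_hw_ext cy => k.
  by rewrite /= tperm1 perm1.
Qed.

(* V is spanned by eigenvectors of E_ii with eigenvalues in the prime field. *)
Lemma diag_pow mu v i : hw E mu v -> generates E v -> in_prime_field (mu i) ->
  forall z, iter p (E i i) z = E i i z.
Proof.
move=> hv gv Fm.
pose ev c y := E i i y = c *: y.
have ev_pow c y : in_prime_field c -> ev c y -> iter p (E i i) y = E i i y.
  move=> Fc yc; rewrite -[p in LHS]/p.
  have -> : iter p (E i i) y = c ^+ p *: y.
    elim: p => [|q IHq]; first by rewrite expr0 scale1r.
    by rewrite iterS IHq linearZ_LR /= yc scalerA exprSr.
  by rewrite (prime_field_pow hp Fc) yc.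
have lin_pow q : linear (iter q (E i i)).
  by move=> c x y; elim: q => //= q ->; rewrite linearP.
(* The span of the eigenvectors as the intersection of all subspaces containing them. It is
   gl_n-stable since E_kl changes an eigenvalue by an integer. *)
pose P (z : V) := forall Q : V -> Prop, subspace Q ->
  (forall c y, in_prime_field c -> ev c y -> Q y) -> Q z.
suff PP z : P z.
  move=> z; apply: (PP z (fun y => iter p (E i i) y = E i i y)); last exact: ev_pow.
  split=> [|c x y Ex Ey]; last by rewrite lin_pow linearP Ex Ey.
  rewrite raddf0; elim: p => //= q ->; exact: raddf0.
move: z; apply: gv; last by move=> Q _; apply; [exact: Fm|exact: hv.1].
split=> [|k l z Pz Q sQ Qev].
  split=> [Q sQ _|c y z Py Pz Q sQ Qev]; first by case: sQ.
  by apply: sQ.2; [apply: Py|apply: Pz].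
apply: (Pz (fun y => Q (E k l y))) => [|c y Fc yc].
  by split=> [|d x y Qx Qy]; rewrite ?raddf0 ?linearP; [case: sQ|apply: sQ.2].
apply: (Qev (c + ((i == k)%:R - (i == l)%:R))).
  by apply: in_prime_fieldD => //; apply: (in_prime_fieldB hp); exact: in_prime_field_nat.
rewrite /ev (gl_bracket rep) yc linearZ_LR /= scalerDl -addrA; congr (_ + _).
rewrite scalerBl !scaler_nat [l == i]eq_sym; congr (_ - _).
  by case: eqP => [->|].
by case: eqP => [->|].
Qed.

End Reflections.

(** * Jacobson's formula *)

Section AdjointPower.
Variables (R : pzRingType) (p : nat).
Hypotheses (p_pr : prime p) (p0 : p%:R = 0 :> R).

Definition ad (q w : R) := q * w - w * q.
Arguments ad : simpl never.

Lemma bin_pred_prime i : (i < p)%N -> 'C(p.-1, i)%:R = (-1) ^+ i :> R.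
Proof.
elim: i => [|i IHi] ip; first by rewrite bin0 expr0.
have /dvdnP[q pE] : (p %| 'C(p, i.+1))%N by apply: prime_dvd_bin.
have := congr1 (fun m => m%:R : R) pE; rewrite natrM p0 mulr0.
have pS := prednK (prime_gt0 p_pr); rewrite -{1}pS binS natrD IHi 1?ltnW //.
by move/eqP; rewrite addr_eq0 exprS mulN1r => /eqP.
Qed.

Lemma ad_is_linear q : zmod_morphism (ad q).
Proof. by move=> u w; rewrite /ad mulrBr mulrBl; zmod_solve. Qed.
HB.instance Definition _ q := GRing.isZmodMorphism.Build R R (ad q) (ad_is_linear q).

Let c (k i : nat) : int := (-1) ^+ (k - i) * 'C(k, i)%:Z.

Lemma ad_iterE k q w :
  iter k (ad q) w = \sum_(i < k.+1) (q ^+ i * w * q ^+ (k - i)) *~ c k i.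
Proof.
elim: k => [|k IHk].
  by rewrite big_ord1 /c subn0 !expr0 bin0 !mul1r mulr1.
have cE i : c k.+1 i = (if i is j.+1 then c k j else 0) - c k i.
  rewrite /c; case: i => [|i]; first by rewrite !subn0 !bin0 exprS; ring.
  rewrite binS subSS; case: (ltngtP i k) => [ik|ki|->].
  - by rewrite (_ : (k - i = (k - i.+1).+1)%N) ?exprS ?PoszD; [ring|lia].
  - by rewrite !bin_small ?mulr0 ?subr0 //; lia.
  - by rewrite !(bin_small (ltnSn k)) add0n mulr0 subr0.
rewrite iterS IHk raddf_sum.
rewrite [RHS](eq_bigr (fun i : 'I_k.+2 => (q ^+ i * w * q ^+ (k.+1 - i)) *~
   (if val i is j.+1 then c k j else 0) - (q ^+ i * w * q ^+ (k.+1 - i)) *~ c k i)); last first.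
  by move=> i _; rewrite -mulrzBr cE.
rewrite [RHS]sumrB [X in _ = X - _]big_ord_recl /= mulr0z add0r.
rewrite [X in _ = _ - X]big_ord_recr /=.
have -> : c k k.+1 = 0 by rewrite /c (bin_small (ltnSn k)) mulr0.
rewrite mulr0z addr0 -sumrB; apply: eq_bigr => i _.
rewrite raddfMz -mulrzBl /bump leq0n add1n subSS subSn -1?ltnS //.
congr (_ *~ _); set t := q ^+ i * w * _.
by rewrite -[LHS]/(q * t - t * q) [in RHS]exprS exprSr !mulrA.
Qed.

(** Modulo p the binomial coefficient C(p-1, i) is (-1)^i, which cancels the sign in the expansion
    of ad(q)^(p-1). *)
Lemma sum_ad q w : \sum_(i < p) q ^+ i * w * q ^+ (p.-1 - i) = iter p.-1 (ad q) w.
Proof.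
rewrite ad_iterE prednK ?prime_gt0 //; apply: eq_bigr => i _.
have ip : (i <= p.-1)%N by have := ltn_ord i; lia.
have c1 : (c p.-1 i)%:~R = 1 :> R.
  rewrite /c rmorphM rmorphXn /= rmorphN1 -pmulrn bin_pred_prime // -exprD subnK //.
  rewrite -bin_pred_prime ?binn //.
  by rewrite prednK // prime_gt0.
by rewrite -mulrzr c1 mulr1.
Qed.

Lemma ad_pow q w : iter p (ad q) w = ad (q ^+ p) w.
Proof.
have pS := prednK (prime_gt0 p_pr).
rewrite -{1}pS iterS -sum_ad /ad mulr_sumr mulr_suml -pS big_ord_recr /=.
rewrite [X in _ - X]big_ord_recl /= subnn subn0 expr0 mul1r mulr1 !mulrA -exprS.
rewrite -[w * _ * q]mulrA -exprSr.
rewrite (eq_bigr (fun i : 'I_p.-1 => q ^+ bump 0 i * w * q ^+ (p.-1 - bump 0 i) * q)).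
  by zmod_solve.
move=> i _; rewrite !mulrA -exprS -!mulrA -exprSr.
by rewrite (_ : (p.-1 - bump 0 i).+1 = p.-1 - i)%N // /bump leq0n; have := ltn_ord i; lia.
Qed.

End AdjointPower.

Section Jacobson.
Variables (A S : nzRingType) (p : nat) (h : {additive A -> S}).
Hypotheses (p_pr : prime p) (pA : p%:R = 0 :> A) (pS : p%:R = 0 :> S).
Hypothesis h_ad : forall u v, h (ad u v) = ad (h u) (h v).

Lemma map_poly_ad P Q : map_poly h (ad P Q) = ad (map_poly h P) (map_poly h Q).
Proof.
apply/polyP => k; rewrite coef_map /ad !coefB [X in _ - X]coefMr coefM.
rewrite [X in _ = _ - X]coefMr [X in _ = X - _]coefM -!sumrB raddf_sum /=.
by apply: eq_bigr => i _; rewrite !coef_map /=; exact: h_ad.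
Qed.

Lemma deriv_exp (R : nzRingType) (q : {poly R}) k :
  (q ^+ k)^`() = \sum_(i < k) q ^+ i * q^`() * q ^+ (k.-1 - i).
Proof.
elim: k => [|k IHk]; first by rewrite expr0 -polyC1 derivC big_ord0.
rewrite exprSr derivM IHk big_ord_recr /= subnn mulr1; congr (_ + _).
rewrite mulr_suml; apply: eq_bigr => i _; rewrite -mulrA -exprSr.
by congr (_ * q ^+ _); have := ltn_ord i; lia.
Qed.

Section LinearPoly.
Variables (R : nzRingType) (u v : R).
Definition lpoly : {poly R} := 'X * u%:P + v%:P.

Lemma deriv_lpoly : lpoly^`() = u%:P.
Proof. by rewrite derivD derivC addr0 derivM derivX derivC mulr0 addr0 mul1r. Qed.

Lemma size_lpoly_exp k : (size (lpoly ^+ k) <= k.+1)%N.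
Proof.
apply: leq_trans (size_exp_leq _ _) _; rewrite ltnS -[leqRHS]mul1n leq_mul2r.
apply/orP; right; rewrite -subn1 leq_subLR.
apply: leq_trans (size_polyD _ _) _; rewrite geq_max.
rewrite (leq_trans (size_polyC_leq1 _)) // andbT.
by rewrite (leq_trans (size_polyMleq _ _)) // size_polyX add2n /= ltnS size_polyC_leq1.
Qed.

Lemma lpoly_coef0 k : (lpoly ^+ k)`_0 = v ^+ k.
Proof.
elim: k => [|k IHk]; first by rewrite !expr0 coef1.
by rewrite !exprS coef0M IHk coefD coefXM !coefC /= add0r.
Qed.

Lemma lpoly_lead k : (lpoly ^+ k)`_k = u ^+ k.
Proof.
elim: k => [|k IHk]; first by rewrite !expr0 coef1.
rewrite !exprS {1}/lpoly mulrDl coefD -mulrA coefXM /= !coefCM IHk.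
by rewrite (nth_default _ (size_lpoly_exp k)) mulr0 addr0.
Qed.

Lemma lpoly_horner1 k : (lpoly ^+ k).[1] = (u + v) ^+ k.
Proof.
rewrite horner_exp_comm; last by rewrite /comm_poly mul1r mulr1.
by rewrite hornerD hornerC hornerM_comm ?hornerX ?hornerC ?mul1r // /comm_poly mul1r mulr1.
Qed.

End LinearPoly.

Lemma map_lpoly u v : map_poly h (lpoly u v) = lpoly (h u) (h v).
Proof.
apply/polyP => i; rewrite coef_map /= !coefD !coefXM !coefC raddfD /=.
by case: i => [|[|i]]; rewrite ?raddf0.
Qed.

(** Additivity of the defect h(u)^p - h(u^p) allows p-characters to be checked on matrix units. The
    derivative of (X u + v)^p is ad(X u + v)^(p-1)(u), a Lie polynomial, with which h commutes. So d
    has derivative 0 and only its coefficients at 0 and p survive; then X is set to 1. *)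
Lemma jacobson u v :
  h (u + v) ^+ p - h ((u + v) ^+ p) =
  (h u ^+ p - h (u ^+ p)) + (h v ^+ p - h (v ^+ p)).
Proof.
have p_gt0 := prime_gt0 p_pr.
pose d := lpoly (h u) (h v) ^+ p - map_poly h (lpoly u v ^+ p).
have pP (R : nzRingType) : p%:R = 0 :> R -> p%:R = 0 :> {poly R}.
  by move=> E0; rewrite -polyC_natr E0.
have d'0 : d^`() = 0.
  have -> : d^`() = (lpoly (h u) (h v) ^+ p)^`() - map_poly h (lpoly u v ^+ p)^`().
    apply/polyP => i; rewrite derivB !coefB coef_map !coef_deriv coef_map /=.
    by rewrite (raddfMn h).
  rewrite !deriv_exp !deriv_lpoly !sum_ad ?pP //.
  have -> m : map_poly h (iter m (ad (lpoly u v)) u%:P) =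
      iter m (ad (lpoly (h u) (h v))) (h u)%:P.
    elim: m => [|m IHm] /=; first by rewrite map_polyC.
    by rewrite map_poly_ad IHm map_lpoly.
  by rewrite subrr.
have sd : (size d <= p.+1)%N.
  rewrite (leq_trans (size_polyD _ _)) // geq_max size_lpoly_exp size_polyN.
  by apply/leq_sizeP => j pj; rewrite coef_map (nth_default _ (leq_trans (size_lpoly_exp _ _ _) pj)) /= raddf0.
have dmid i : (0 < i < p)%N -> d`_i = 0.
  case: i => // i ip; have := congr1 (fun q : {poly S} => q`_i) d'0.
  rewrite coef0 coef_deriv => E0.
  (* S is only known to be a ring with p = 0, so the index is cancelled by a Bezout relation with
     p. *)
  have cop : coprime p i.+1 by rewrite prime_coprime // gtnNdvd.
  have [a b E1 _] := egcdnP p (ltn0Sn i : 0 < i.+1)%N.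
  rewrite gcdnC (eqP cop) in E1.
  have := congr1 (fun m => d`_i.+1 *+ m) E1.
  rewrite mulnC mulrnA E0 mul0rn addn1 mulrS -mulr_natr natrM pS mulr0 mulr0 addr0.
  by move/esym.
have := horner_coef_wide 1 sd.
rewrite -(big_mkord xpredT (fun i => d`_i * 1 ^+ i)) big_nat_recr //= big_ltn //.
rewrite big_nat big1 => [|i /dmid->]; last by rewrite mul0r.
rewrite !expr1n !mulr1 addr0 /d !coefB !coef_map.
rewrite !lpoly_coef0 !lpoly_lead hornerD hornerN lpoly_horner1.
have -> : (map_poly h (lpoly u v ^+ p)).[1] = h ((u + v) ^+ p).
  rewrite -(lpoly_horner1 u v p) (horner_coef_wide _ (size_lpoly_exp u v p)) raddf_sum /=.
  rewrite (@horner_coef_wide _ p.+1); last first.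
    by apply/leq_sizeP => j pj; rewrite coef_map (nth_default _ (leq_trans (size_lpoly_exp _ _ _) pj)) /= raddf0.
  by apply: eq_bigr => i _; rewrite coef_map !expr1n !mulr1.
by move=> E0; rewrite [h (u + v)]raddfD E0 addrC.
Qed.

End Jacobson.

(** * Weyl algebra representations *)

Section Weyl.
Variables (K : fieldType) (p : nat).
Hypothesis hp : p \in [pchar K].

(* A nonzero representation of the m-th Weyl algebra (y_i = d/dx_i) on which
   x_i^p = a_i and y_i^p = 0, with an eigenvector F of all the x_i y_i. *)
Record weyl_rep (m : nat) (a : nat -> K) (c : nat -> nat) (S : nzRingType)
    (phi : {rmorphism K -> S}) (x y : nat -> S) (F : S) : Prop := WeylRep {
  weyl_central : forall k s, phi k * s = s * phi k;
  weyl_xx : forall i j, (i < m)%N -> (j < m)%N -> x i * x j = x j * x i;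
  weyl_yy : forall i j, (i < m)%N -> (j < m)%N -> y i * y j = y j * y i;
  weyl_yx : forall i j, (i < m)%N -> (j < m)%N -> y i * x j = x j * y i + (i == j)%:R;
  weyl_xp : forall i, (i < m)%N -> x i ^+ p = phi (a i);
  weyl_yp : forall i, (i < m)%N -> y i ^+ p = 0;
  weyl_F0 : F != 0;
  weyl_xyF : forall i, (i < m)%N -> x i * (y i * F) = (c i)%:R * F;
  weyl_yF : forall i, (i < m)%N -> c i = 0%N -> y i * F = 0;
  weyl_xF : forall i, (i < m)%N -> c i = p.-1 -> a i = 0 -> x i * F = 0 }.

Section Extension.
Variables (S : nzRingType) (phi : {rmorphism K -> S}) (a : K) (c q : nat).
Hypotheses (pq : p = q.+1) (phiC : forall k s, phi k * s = s * phi k).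

(** With [weyl_y], these are multiplication by x and d/dx on S[x]/(x^p - a) in the basis 1, x, ...,
    x^(p-1), where p = q + 1. *)
Definition weyl_x : 'M[S]_q.+1 := \matrix_(r, s)
  (if r == s.+1 :> nat then 1 else if (r == 0 :> nat) && (s == q :> nat) then phi a else 0).
Definition weyl_y : 'M[S]_q.+1 := \matrix_(r, s) (if s == r.+1 :> nat then s%:R else 0).
(** The vector x^c F, stored as the first column of a matrix: the matrix ring acts on itself from
    the left, so that a module with a vector is simply a ring with an element. *)
Definition weyl_F (F : S) : 'M[S]_q.+1 :=
  \matrix_(r, s) (if (r == c :> nat) && (s == 0 :> nat) then F else 0).

Lemma weyl_xy_mx : weyl_x * weyl_y = \matrix_(r, s) (s%:R *+ (r == s)).
Proof.
apply/matrixP => r s; rewrite !mxE.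
have [s0|s0] := posnP s.
  rewrite s0 mul0rn big1 // => t _; rewrite !mxE s0.
  by rewrite (_ : (0 == t.+1)%N = false) ?mulr0.
have ts : (s.-1 < q.+1)%N by have := ltn_ord s; lia.
rewrite (bigD1 (Ordinal ts)) //= !mxE /= prednK // eqxx big1 ?addr0; last first.
  move=> t; rewrite -val_eqE /= => tN; rewrite !mxE.
  by rewrite (_ : (s == t.+1 :> nat) = false) ?mulr0 //; move/eqP: tN; lia.
rewrite -val_eqE /=; case: eqP => _; first by rewrite mul1r.
rewrite (_ : (s.-1 == q)%N = false) ?andbF ?mul0r //; have := ltn_ord s; lia.
Qed.

Lemma weyl_yx_mx : weyl_y * weyl_x = weyl_x * weyl_y + 1.
Proof.
have p0 : p%:R = 0 :> S by rewrite -(rmorph_nat phi) (pcharf0 hp) rmorph0.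
rewrite weyl_xy_mx; apply/matrixP => r s; rewrite !mxE -mulrnDl natr1.
have [rq|rq] := ltnP r q; last first.
  have rE : r = q :> nat by have := ltn_ord r; lia.
  rewrite big1 => [|t _]; last first.
    rewrite !mxE (_ : (t == r.+1 :> nat) = false) ?mul0r //; have := ltn_ord t; lia.
  have [<-|//] := eqVneq r s; by rewrite rE -pq p0 mul0rn.
have tr : (r.+1 < q.+1)%N by [].
rewrite (bigD1 (Ordinal tr)) //= !mxE /= eqxx big1 ?addr0 => [|t]; last first.
  rewrite -val_eqE /= => tN; rewrite !mxE (_ : (t == r.+1 :> nat) = false) ?mul0r //.
  exact/negbTE.
rewrite eqSS -[r == s]val_eqE /=; case: eqP => [->|_]; first by rewrite mulr1.
by rewrite mulr0.
Qed.

Lemma weyl_x_pow : weyl_x ^+ p = (phi a)%:M.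
Proof.
suff xk k : (k <= p)%N -> weyl_x ^+ k = \matrix_(r, s)
    (if r == (s + k)%N :> nat then 1 else if (r + p)%N == (s + k)%N then phi a else 0).
  rewrite xk //; apply/matrixP => r s; rewrite !mxE eqn_add2r -[r == s]val_eqE /=.
  rewrite (_ : (r == s + p :> nat)%N = false); last by have := ltn_ord r; lia.
  by case: eqP.
elim: k => [|k IHk] kp.
  apply/matrixP => r s; rewrite expr0 !mxE addn0 -[r == s]val_eqE /=; case: eqP => // _.
  by rewrite (_ : (r + p == s)%N = false) //; have := ltn_ord s; lia.
rewrite exprS (IHk (ltnW kp)); apply/matrixP => r s; rewrite !mxE.
have [r0|r_gt0] := posnP r.
  rewrite (bigD1 ord_max) //= !mxE /= r0 eqxx big1 ?addr0 => [|t]; last first.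
    rewrite -val_eqE /= => /negbTE tq; rewrite !mxE r0 tq andbF /=.
    by rewrite mul0r.
  rewrite addnS add0n pq eqSS /=.
  case: eqP => _; first by rewrite mulr1.
  by rewrite (_ : (q + q.+1 == s + k)%N = false) ?mulr0 //; have := ltn_ord s; lia.
have tr : (r.-1 < q.+1)%N by have := ltn_ord r; lia.
rewrite (bigD1 (Ordinal tr)) //= !mxE /= prednK // eqxx mul1r big1 ?addr0 => [|t].
  have -> : (r.-1 == s + k)%N = (r == s + k.+1 :> nat)%N by lia.
  by have -> : (r.-1 + p == s + k)%N = (r + p == s + k.+1)%N by lia.
rewrite -val_eqE /= => /eqP tN; rewrite !mxE (_ : (r == t.+1 :> nat) = false).
  by rewrite (_ : (r == 0 :> nat) = false) ?mul0r //; lia.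
by apply/eqP; lia.
Qed.

Lemma weyl_y_pow : weyl_y ^+ p = 0.
Proof.
suff yk k (r s : 'I_q.+1) : s != (r + k)%N :> nat -> (weyl_y ^+ k) r s = 0.
  apply/matrixP => r s; rewrite yk ?mxE //; have := ltn_ord s; lia.
elim: k r s => [|k IHk] r s sr.
  rewrite expr0 mxE -val_eqE /=; rewrite addn0 eq_sym in sr.
  by rewrite (negbTE sr).
rewrite exprS mxE big1 // => t _; rewrite mxE; case: eqP => [tr|_]; last by rewrite mul0r.
by rewrite IHk ?mulr0 // tr; lia.
Qed.

Lemma scalar_weyl_xC u : u%:M * weyl_x = weyl_x * u%:M.
Proof.
rewrite -[LHS]/(_ *m _) -[RHS]/(_ *m _) mul_scalar_mx; apply/matrixP => r s.
rewrite !mxE (bigD1 s) //= !mxE eqxx mulr1n big1 ?addr0 => [|t /negbTE ts]; last first.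
  by rewrite !mxE ts mulr0n mulr0.
by case: ifP => _; rewrite ?mulr1 ?mul1r //; case: ifP; rewrite ?mulr0 ?mul0r // phiC.
Qed.

Lemma scalar_weyl_yC u : u%:M * weyl_y = weyl_y * u%:M.
Proof.
rewrite -[LHS]/(_ *m _) -[RHS]/(_ *m _) mul_scalar_mx; apply/matrixP => r s.
rewrite !mxE (bigD1 s) //= !mxE eqxx mulr1n big1 ?addr0 => [|t /negbTE ts]; last first.
  by rewrite !mxE ts mulr0n mulr0.
by case: ifP => _; rewrite ?mulr0 ?mul0r // mulr_natl mulr_natr.
Qed.

Lemma scalar_phiC k (B : 'M[S]_q.+1) : (phi k)%:M * B = B * (phi k)%:M.
Proof.
rewrite -[LHS]/(_ *m _) -[RHS]/(_ *m _) mul_scalar_mx; apply/matrixP => r s.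
rewrite !mxE (bigD1 s) //= !mxE eqxx mulr1n big1 ?addr0 ?phiC // => t /negbTE ts.
by rewrite !mxE ts mulr0n mulr0.
Qed.

Lemma scalar_weyl_F u F : u%:M * weyl_F F = weyl_F (u * F).
Proof.
rewrite -[LHS]/(_ *m _) mul_scalar_mx; apply/matrixP => r s; rewrite !mxE.
by case: ifP; rewrite ?mulr0.
Qed.

Lemma weyl_F_neq0 F : (c < p)%N -> F != 0 -> weyl_F F != 0.
Proof.
rewrite pq => cq F0; apply: contra F0 => /eqP/matrixP/(_ (Ordinal cq) ord0).
by rewrite !mxE /= eqxx /= => ->.
Qed.

Lemma weyl_xyF_mx F : weyl_x * (weyl_y * weyl_F F) = weyl_F (c%:R * F).
Proof.
rewrite mulrA weyl_xy_mx; apply/matrixP => r s; rewrite !mxE (bigD1 r) //= !mxE eqxx mulr1n.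
rewrite big1 ?addr0 => [|t]; last by rewrite eq_sym => /negbTE tr; rewrite !mxE tr mul0r.
by case: (eqVneq (r : nat) c) => [->|_] /=; [case: ifP => _|]; rewrite ?mulr0.
Qed.

Lemma weyl_yF_mx F : c = 0%N -> weyl_y * weyl_F F = 0.
Proof.
move=> c0; apply/matrixP => r s; rewrite !mxE big1 // => t _; rewrite !mxE c0.
by case: (eqVneq (t : nat) 0%N) => [->|_] /=; [rewrite mul0r|rewrite mulr0].
Qed.

Lemma weyl_xF_mx F : c = p.-1 -> a = 0 -> weyl_x * weyl_F F = 0.
Proof.
rewrite pq /= => cq a0; apply/matrixP => r s; rewrite !mxE big1 // => t _.
rewrite !mxE cq a0 rmorph0; case: (eqVneq (t : nat) q) => [->|_] /=; last by rewrite mulr0.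
rewrite (_ : (r == q.+1 :> nat) = false) ?andbT; last by have := ltn_ord r; lia.
by case: ifP; rewrite mul0r.
Qed.

End Extension.

(** Each new variable replaces S by the p by p matrices over S, and the earlier operators become
    scalar matrices. *)
Lemma weyl_rep_exists m a c : (forall i, c i < p)%N ->
  exists (S : nzRingType) (phi : {rmorphism K -> S}) (x y : nat -> S) (F : S),
    weyl_rep m a c phi x y F.
Proof.
move=> cp; have [q pq] : exists q, p = q.+1.
  by exists p.-1; rewrite prednK // prime_gt0 ?(pcharf_prime hp).
elim: m => [|m [S [phi [x [y [F W]]]]]].
  exists K, idfun, (fun=> 0), (fun=> 0), 1; split=> //; last exact: oner_neq0.
  by move=> k s; rewrite mulrC.
have phiC := weyl_central W.
pose psi : {rmorphism K -> 'M[S]_q.+1} := (scalar_mx : {rmorphism S -> 'M[S]_q.+1}) \o phi.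
pose X := weyl_x phi (a m) q; pose Y := weyl_y S q.
pose x' i := if i == m then X else (x i)%:M.
pose y' i := if i == m then Y else (y i)%:M.
have xC u : u%:M * X = X * u%:M by exact: scalar_weyl_xC.
have yC u : u%:M * Y = Y * u%:M by exact: scalar_weyl_yC.
have M (u v : S) : u%:M * v%:M = (u * v)%:M :> 'M[S]_q.+1.
  by rewrite (rmorphM (scalar_mx : {rmorphism S -> 'M[S]_q.+1})).
have lt i : (i < m.+1)%N -> (i == m) = false -> (i < m)%N.
  by move=> im /eqP ne; lia.
exists 'M[S]_q.+1, psi, x', y', (weyl_F (c m) q F); split.
- by move=> k B; exact: scalar_phiC.
- move=> i j /lt im /lt jm; rewrite /x'.
  case: (i == m) im => im; case: (j == m) jm => jm //; rewrite ?xC //.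
  by rewrite !M (weyl_xx W) ?im ?jm.
- move=> i j /lt im /lt jm; rewrite /y'.
  case: (i == m) im => im; case: (j == m) jm => jm //; rewrite ?yC //.
  by rewrite !M (weyl_yy W) ?im ?jm.
- move=> i j /lt im /lt jm; rewrite /x' /y'.
  case: (eqVneq i m) im => [->|ne] im; case: (eqVneq j m) jm => [->|ne'] jm.
  + exact: weyl_yx_mx.
  + by rewrite addr0 yC.
  + by rewrite (negbTE ne) addr0 xC.
  + by rewrite !M (weyl_yx W) ?im ?jm // raddfD /= rmorph_nat.
- move=> i /lt im; rewrite /x'; case: (eqVneq i m) im => [->|ne] im.
    exact: weyl_x_pow.
  by rewrite -(rmorphXn (scalar_mx : {rmorphism S -> 'M[S]_q.+1})) (weyl_xp W) ?im.
- move=> i /lt im; rewrite /y'; case: (eqVneq i m) im => [->|ne] im.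
    exact: weyl_y_pow.
  by rewrite -(rmorphXn (scalar_mx : {rmorphism S -> 'M[S]_q.+1})) (weyl_yp W) ?im //= raddf0.
- by apply: weyl_F_neq0; rewrite ?cp ?(weyl_F0 W).
- move=> i /lt im; rewrite /x' /y'; case: (eqVneq i m) im => [->|ne] im.
    rewrite weyl_xyF_mx // -scalar_weyl_F; congr (_ * _).
    exact: (rmorph_nat (scalar_mx : {rmorphism S -> 'M[S]_q.+1})).
  rewrite !scalar_weyl_F (weyl_xyF W) ?im // -scalar_weyl_F; congr (_ * _).
  exact: (rmorph_nat (scalar_mx : {rmorphism S -> 'M[S]_q.+1})).
- move=> i /lt im ci; rewrite /y'; case: (eqVneq i m) im => [im|ne] im'.
    by apply: weyl_yF_mx; rewrite -im.
  rewrite scalar_weyl_F (weyl_yF W) ?im' //; apply/matrixP => r s; rewrite !mxE.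
  by case: ifP.
- move=> i /lt im ci ai; rewrite /x'; case: (eqVneq i m) im => [im|ne] im'.
    by apply: weyl_xF_mx => //; rewrite -im.
  rewrite scalar_weyl_F (weyl_xF W) ?im' //; apply/matrixP => r s; rewrite !mxE.
  by case: ifP.
Qed.

End Weyl.

(** * p-th powers of differential operators *)

Section PowerIdentities.
Variables (K : fieldType) (p : nat) (S : nzRingType) (phi : {rmorphism K -> S}).
Hypotheses (hp : p \in [pchar K]) (phiC : forall k s, phi k * s = s * phi k).

(** For T = x y one has x^m y^m = T (T-1) ... (T-m+1), which for m = p is T^p - T. *)
Lemma weyl_mul_pow (x y : S) : y * x = x * y + 1 ->
  (x * y) ^+ p = x * y + x ^+ p * y ^+ p.
Proof.
move=> yx; have cT : commr_rmorph phi (x * y) by move=> k; exact/esym/phiC.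
pose ev : {rmorphism {poly K} -> S} := horner_morph cT.
have ymul m : x * y * y ^+ m = y ^+ m * (x * y - m%:R).
  elim: m => [|m IHm]; first by rewrite expr0 mul1r mulr1 subr0.
  have yT : x * y * y = y * (x * y - 1) by rewrite mulrBr mulrA yx mulrDl mulr1 mul1r addrK.
  rewrite exprS mulrA yT -mulrA mulrBl mul1r IHm -{2}[y ^+ m]mulr1 -mulrBr mulrA.
  by rewrite -natr1 opprD addrA.
have xyE m : x ^+ m * y ^+ m = ev (\prod_(k <- iota 0 m) ('X - (k%:R)%:P)).
  elim: m => [|m IHm]; first by rewrite big_nil rmorph1 !expr0 mulr1.
  rewrite exprSr exprS -mulrA [x * (y * _)]mulrA ymul mulrA IHm.
  rewrite -[m.+1]addn1 iotaD big_cat big_seq1 /= add0n rmorphM rmorphB /=.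
  by rewrite horner_morphX horner_morphC rmorph_nat.
rewrite xyE -(prod_prime_field hp) rmorphB rmorphXn /= horner_morphX.
by rewrite addrC subrK.
Qed.

Lemma sum_comm_pow (I : Type) (r : seq I) (f : I -> S) :
  (forall i j, GRing.comm (f i) (f j)) ->
  (\sum_(i <- r) f i) ^+ p = \sum_(i <- r) f i ^+ p.
Proof.
move=> fC; have hS : p \in [pchar S] by exact: (rmorph_pchar phi hp).
elim: r => [|i r IHr].
  by rewrite !big_nil expr0n gtn_eqF ?prime_gt0 ?(pcharf_prime hp).
rewrite !big_cons -IHr -!(pFrobenius_autE hS) pFrobenius_autD_comm //.
by apply: commr_sum => j _; exact: fC.
Qed.

End PowerIdentities.

(** * Matrices acting by polarization operators *)

Section WeylGl.
Variables (K : fieldType) (p n : nat) (S : nzRingType) (phi : {rmorphism K -> S}).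
Variables (x y : 'I_n.+1 -> 'I_n -> S).
Hypotheses (hp : p \in [pchar K]) (phiC : forall k s, phi k * s = s * phi k).
Hypotheses (xx : forall i k j l, x i k * x j l = x j l * x i k)
  (yy : forall i k j l, y i k * y j l = y j l * y i k)
  (yx : forall i k j l, y i k * x j l = x j l * y i k + ((i == j) && (k == l))%:R)
  (xp : forall i k, x i k ^+ p = (i == k.+1 :> nat)%:R)
  (yp : forall i k, y i k ^+ p = (i == k :> nat)%:R).

Definition weyl_gl (i j : 'I_n.+1) : S := \sum_k x i k * y j k.
Definition weyl_mx (A : 'M[K]_n.+1) : S := \sum_i \sum_j phi (A i j) * weyl_gl i j.

Lemma weyl_gl_bracket i j k l : ad (weyl_gl i j) (weyl_gl k l) =
  weyl_gl i l *+ (j == k) - weyl_gl k j *+ (l == i).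
Proof.
have swap (a b c d : S) (e : bool) : b * c = c * b + e%:R ->
    a * b * (c * d) = a * c * (b * d) + a * d *+ e.
  move=> bc; rewrite -!mulrA [b * (c * d)]mulrA bc mulrDl mulrDr -!mulrA.
  by rewrite mulr_natl mulrnAr.
rewrite /ad /weyl_gl mulr_suml [X in _ - X]mulr_sumr.
rewrite -[X in _ = X - _]sumrMnl -[X in _ = _ - X]sumrMnl -!sumrB.
apply: eq_bigr => s _; rewrite mulr_sumr mulr_suml -sumrB.
rewrite (eq_bigr (fun t => (x i s * y l t *+ (j == k)) *+ (s == t)
   - (x k t * y j s *+ (l == i)) *+ (s == t))); last first.
  move=> t _; rewrite (swap _ _ _ _ _ (yx j s k t)) (swap _ _ _ _ _ (yx l t i s)).
  rewrite xx yy [t == s]eq_sym -!mulrnA !mulnb; zmod_solve.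
rewrite sumrB (bigD1 s) //= [X in _ - X](bigD1 s) //= eqxx !mulr1n.
by rewrite !big1 ?addr0 // => t ts; rewrite [s == t]eq_sym (negbTE ts).
Qed.

Lemma weyl_mx_is_linear c A B : weyl_mx (c *: A + B) = phi c * weyl_mx A + weyl_mx B.
Proof.
rewrite /weyl_mx mulr_sumr -big_split; apply: eq_bigr => i _ /=.
rewrite mulr_sumr -big_split; apply: eq_bigr => j _ /=.
by rewrite !mxE rmorphD rmorphM mulrDl mulrA.
Qed.

Lemma weyl_mx_zmod : zmod_morphism weyl_mx.
Proof.
move=> A B; rewrite -[B in LHS]scale1r -scaleNr addrC weyl_mx_is_linear.
by rewrite rmorphN1 mulN1r addrC.
Qed.
HB.instance Definition _ := GRing.isZmodMorphism.Build _ _ weyl_mx weyl_mx_zmod.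

Lemma weyl_mx_delta i j : weyl_mx (delta_mx i j) = weyl_gl i j.
Proof.
rewrite /weyl_mx (bigD1 i) //= (bigD1 j) //= !mxE !eqxx rmorph1 mul1r.
rewrite big1 => [|k /negbTE kj]; last by rewrite !mxE kj andbF rmorph0 mul0r.
rewrite big1 ?addr0 // => k /negbTE ki; rewrite big1 // => l _.
by rewrite !mxE ki rmorph0 mul0r.
Qed.

Lemma mx_span_ind (P : 'M[K]_n.+1 -> Prop) :
    P 0 -> (forall c A B, P A -> P B -> P (c *: A + B)) ->
    (forall i j, P (delta_mx i j)) -> forall A, P A.
Proof.
move=> P0 Plin Pd A; rewrite [A]matrix_sum_delta.
have PD B C : P B -> P C -> P (B + C) by move=> ? ?; rewrite -[B]scale1r; apply: Plin.
apply: (big_ind P) => // i _; apply: (big_ind P) => // j _.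
by rewrite -[_ *: _]addr0; apply: Plin.
Qed.

Lemma weyl_mx_ad A B : weyl_mx (ad A B) = ad (weyl_mx A) (weyl_mx B).
Proof.
move: A; apply: mx_span_ind => [|c A A' IHA IHA'|i j].
- by rewrite /ad mul0r mulr0 subrr raddf0 mul0r mulr0 subrr.
- have -> : ad (c *: A + A') B = c *: ad A B + ad A' B.
    by rewrite /ad mulrDl mulrDr -scalerAl -scalerAr scalerBr; zmod_solve.
  rewrite !weyl_mx_is_linear IHA IHA' /ad mulrDl !mulrDr mulrN !mulrA -phiC.
  by zmod_solve.
move: B; apply: mx_span_ind => [|c B B' IHB IHB'|k l].
- by rewrite /ad mul0r mulr0 subrr raddf0 mul0r mulr0 subrr.
- have -> : ad (delta_mx i j) (c *: B + B') = c *: ad (delta_mx i j) B + ad (delta_mx i j) B'.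
    by rewrite /ad mulrDl mulrDr -scalerAl -scalerAr scalerBr; zmod_solve.
  rewrite !weyl_mx_is_linear IHB IHB' /ad mulrDl !mulrDr mulrN !mulrA -phiC.
  by zmod_solve.
rewrite !weyl_mx_delta weyl_gl_bracket /ad -![_ * _]/(_ *m _) !mul_delta_mx_cond.
by rewrite raddfB !raddfMn /= !weyl_mx_delta.
Qed.

Definition weyl_curv (A : 'M[K]_n.+1) : S := weyl_mx A ^+ p - weyl_mx (A ^+ p).

Lemma weyl_curvD A B : weyl_curv (A + B) = weyl_curv A + weyl_curv B.
Proof.
have p0 : p%:R = 0 :> K by exact: pcharf0.
apply: jacobson; first exact: (pcharf_prime hp).
- by rewrite -(rmorph_nat (scalar_mx : {rmorphism K -> 'M[K]_n.+1})) p0 rmorph0.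
- by rewrite -(rmorph_nat phi) p0 rmorph0.
- exact: weyl_mx_ad.
Qed.

Lemma weyl_mxZ c A : weyl_mx (c *: A) = phi c * weyl_mx A.
Proof. by rewrite -[c *: A]addr0 weyl_mx_is_linear raddf0 addr0. Qed.

Lemma weyl_curvZ c A : weyl_curv (c *: A) = phi (c ^+ p) * weyl_curv A.
Proof.
rewrite /weyl_curv exprZn !weyl_mxZ exprMn_comm; last exact: phiC.
by rewrite -rmorphXn mulrBr.
Qed.

(** For i = j, [weyl_mul_pow] leaves the x_ik^p y_ik^p, where one factor is always 0. For i <> j the
    factors of x_ik y_jk commute, and x_ik^p y_jk^p is nonzero only if k = j and i = k + 1. *)
Lemma weyl_curv_delta i j : weyl_curv (delta_mx i j) = (i == j.+1 :> nat)%:R.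
Proof.
have p_gt1 := prime_gt1 (pcharf_prime hp).
have dmul a b c d : delta_mx a b * delta_mx c d = delta_mx a d *+ (b == c) :> 'M[K]_n.+1.
  by rewrite -[LHS]/(_ *m _) mul_delta_mx_cond.
have dp : (delta_mx i j : 'M[K]_n.+1) ^+ p = delta_mx i j *+ (i == j).
  have [<-|ij] := eqVneq i j.
    rewrite mulr1n; case: p p_gt1 => // q _; elim: q => [|q IHq]; first by rewrite expr1.
    by rewrite exprS IHq dmul eqxx.
  case: p p_gt1 => [|[|q]] // _.
  by rewrite !exprS mulrA dmul [j == i]eq_sym (negbTE ij) mulr0n mul0r.
rewrite /weyl_curv dp raddfMn /= weyl_mx_delta /weyl_gl (sum_comm_pow phi hp); last first.
  move=> s t; have [->//|st] := eqVneq s t; rewrite /GRing.comm.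
  have yxst k l : y k s * x l t = x l t * y k s by rewrite yx (negbTE st) andbF addr0.
  have yxts k l : y k t * x l s = x l s * y k t by rewrite yx [t == s]eq_sym (negbTE st) andbF addr0.
  rewrite mulrA -[x i s * _ * _]mulrA yxst !mulrA -[x i t * y j t * _]mulrA yxts !mulrA.
  by rewrite [x i s * x i t]xx -!mulrA [y j s * _]yy.
have [<-|ij] := eqVneq i j.
  rewrite mulr1n (eq_bigr (fun k => x i k * y i k)); last first.
    move=> k _; rewrite (weyl_mul_pow hp phiC); last by rewrite yx !eqxx.
    rewrite xp yp; case: (eqVneq (i : nat) k.+1) => [->|_] /=; last by rewrite mul0r addr0.
    by rewrite (_ : (k.+1 == k)%N = false) ?mulr0 ?addr0 //; lia.
  by rewrite subrr (_ : (i == i.+1 :> nat) = false) //; lia.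
rewrite mulr0n subr0.
rewrite (eq_bigr (fun k : 'I_n => ((i == j.+1 :> nat) && (k == j :> nat))%:R)); last first.
  move=> k _; rewrite exprMn_comm; last first.
    by rewrite /GRing.comm yx [j == i]eq_sym (negbTE ij) addr0.
  rewrite xp yp -natrM mulnb; congr (_%:R); congr nat_of_bool.
  by apply/andP/andP => -[/eqP-> /eqP->].
have [ij1|ij1] := eqVneq (i : nat) j.+1; last by rewrite big1.
have jn : (j < n)%N by have := ltn_ord i; lia.
rewrite (bigD1 (Ordinal jn)) //= eqxx big1 ?addr0 // => k.
by rewrite -val_eqE /= => /negbTE->.
Qed.

Lemma weyl_mx_pow A : weyl_mx A ^+ p - weyl_mx (A ^+ p) =
  phi ((\sum_i \sum_j A i j * (i == j.+1 :> nat)%:R) ^+ p).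
Proof.
rewrite -/(weyl_curv A); move: A; apply: mx_span_ind => [|c A B IHA IHB|i j].
- have -> : weyl_curv 0 = 0 by rewrite -(scale0r 0) weyl_curvZ expr0n gtn_eqF ?prime_gt0 ?(pcharf_prime hp) // rmorph0 mul0r.
  rewrite big1 ?expr0n ?gtn_eqF ?prime_gt0 ?(pcharf_prime hp) ?rmorph0 // => i _.
  by rewrite big1 // => j _; rewrite mxE mul0r.
- rewrite weyl_curvD weyl_curvZ IHA IHB -rmorphM -rmorphD -exprMn.
  rewrite -!(pFrobenius_autE hp) -rmorphD; congr (phi (_ _)).
  rewrite mulr_sumr -big_split; apply: eq_bigr => i _ /=.
  rewrite mulr_sumr -big_split; apply: eq_bigr => j _ /=.
  by rewrite !mxE mulrDl mulrA.
- rewrite weyl_curv_delta (bigD1 i) //= (bigD1 j) //= !mxE !eqxx mul1r.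
  rewrite big1 => [|k /negbTE kj]; last by rewrite !mxE kj andbF mul0r.
  rewrite big1 ?addr0 => [|k /negbTE ki]; last first.
    by rewrite big1 // => l _; rewrite !mxE ki mul0r.
  by rewrite -natrX rmorph_nat; case: eqP; rewrite ?exp1n ?exp0n ?prime_gt0 ?(pcharf_prime hp).
Qed.

End WeylGl.

(* In the k-th column of variables the Fourier transform (x, y) |-> (-y, x) is
   applied to the k-th variable, so that exactly y_kk and x_(k+1)k have nonzero
   p-th powers. *)
Lemma weyl_hw_exists (K : fieldType) (p n : nat) (c : nat -> nat) :
    p \in [pchar K] -> (forall i, c i < p)%N ->
  exists (S : nzRingType) (phi : {rmorphism K -> S}) (h : 'M[K]_n.+1 -> S) (F : S),
  [/\ forall k s, phi k * s = s * phi k,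
      forall k A B, h (k *: A + B) = phi k * h A + h B,
      forall A B, h (A *m B - B *m A) = h A * h B - h B * h A,
      forall A, h A ^+ p - h (A ^+ p) =
        phi ((\sum_i \sum_j A i j * (i == j.+1 :> nat)%:R) ^+ p)
    & [/\ F != 0,
      forall i j : 'I_n.+1, (i < j)%N -> h (delta_mx i j) * F = 0
      & forall i : 'I_n.+1, h (delta_mx i i) * F =
        phi ((if (0 < i)%N then (c i)%:R else 0) - (n - i)%:R) * F]].
Proof.
move=> hp cp; have p_gt1 := prime_gt1 (pcharf_prime hp).
have eqSn (k : nat) : (k == k.+1) = false by apply/eqP; lia.
have lt_eqS (i k : nat) : (i < k)%N -> (i == k.+1) = false.
  by move=> ik; apply/eqP; lia.
have gtS (i k : nat) : (k.+1 < i)%N ->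
    [/\ (i < k)%N = false, (i == k) = false & (i == k.+1) = false].
  by move=> ki; split; lia.
(* The entry in row i and column k of the matrix of variables has the number k (n+1) + i. Both x_kk
   and x_(k+1)k get p-th power 1; the first becomes y_kk after the Fourier transform. *)
pose a (s : nat) : K := let i := (s %% n.+1)%N in let k := (s %/ n.+1)%N in
  if (i == k.+1) || (i == k) then 1 else 0.
(* The exponents of the monomial F: p-1 for i < k, where x^p = 0 and so x kills F; the free
   parameter c_i on the subdiagonal; 0 elsewhere, where y kills F. *)
pose d (s : nat) : nat := let i := (s %% n.+1)%N in let k := (s %/ n.+1)%N in
  if (i < k)%N then p.-1 else if i == k.+1 then c i else 0%N.
have dp s : (d s < p)%N by rewrite /d; case: ifP => _; [lia|case: ifP => _ //; lia].
have [S [phi [x [y [F W]]]]] := weyl_rep_exists hp (n * n.+1)%N a dp.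
have phiC := weyl_central W.
pose io (i : 'I_n.+1) (k : 'I_n) := (k * n.+1 + i)%N.
have io_mod i k : (io i k %% n.+1)%N = i by rewrite /io modnMDl modn_small.
have io_div i k : (io i k %/ n.+1)%N = k by rewrite /io divnMDl // divn_small ?addn0.
have io_lt i k : (io i k < n * n.+1)%N.
  rewrite /io; apply: (@leq_trans (k.+1 * n.+1)); last by rewrite leq_mul2r ltn_ord orbT.
  by rewrite mulSn addnC ltn_add2r.
have io_inj i k j l : (io i k == io j l) = (i == j) && (k == l).
  apply/eqP/andP => [E|[/eqP-> /eqP->]//].
  have := congr1 (fun s => s %% n.+1)%N E; have := congr1 (fun s => s %/ n.+1)%N E.
  by rewrite !io_mod !io_div => /val_inj-> /val_inj->.
pose X (i : 'I_n.+1) (k : 'I_n) := if i == k :> nat then - y (io i k) else x (io i k).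
pose Y (i : 'I_n.+1) (k : 'I_n) := if i == k :> nat then x (io i k) else y (io i k).
have XX i k j l : X i k * X j l = X j l * X i k.
  have yx0 : i == k :> nat -> (j == l :> nat) = false ->
      y (io i k) * x (io j l) = x (io j l) * y (io i k).
    move=> ik jl; rewrite (weyl_yx W) // io_inj; case: eqP => [ij|_] /=; last by rewrite addr0.
    by case: eqP => [kl|_] /=; [rewrite -ij -kl ik in jl|rewrite addr0].
  have xy0 : j == l :> nat -> (i == k :> nat) = false ->
      y (io j l) * x (io i k) = x (io i k) * y (io j l).
    move=> jl ik; rewrite (weyl_yx W) // io_inj; case: eqP => [ij|_] /=; last by rewrite addr0.
    by case: eqP => [kl|_] /=; [rewrite -ij -kl jl in ik|rewrite addr0].
  rewrite /X; case: ifP => ik; case: ifP => jl; rewrite ?mulrNN ?mulrN ?mulNr.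
  - exact: (weyl_yy W).
  - by rewrite yx0.
  - by rewrite xy0.
  - exact: (weyl_xx W).
have YY i k j l : Y i k * Y j l = Y j l * Y i k.
  have yx0 : i == k :> nat -> (j == l :> nat) = false ->
      y (io j l) * x (io i k) = x (io i k) * y (io j l).
    move=> ik jl; rewrite (weyl_yx W) // io_inj; case: eqP => [ij|_] /=; last by rewrite addr0.
    by case: eqP => [kl|_] /=; [rewrite ij kl ik in jl|rewrite addr0].
  have xy0 : j == l :> nat -> (i == k :> nat) = false ->
      y (io i k) * x (io j l) = x (io j l) * y (io i k).
    move=> jl ik; rewrite (weyl_yx W) // io_inj; case: eqP => [ij|_] /=; last by rewrite addr0.
    by case: eqP => [kl|_] /=; [rewrite ij kl jl in ik|rewrite addr0].
  rewrite /Y; case: ifP => ik; case: ifP => jl.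
  - exact: (weyl_xx W).
  - by rewrite yx0.
  - by rewrite xy0.
  - exact: (weyl_yy W).
have YX i k j l : Y i k * X j l = X j l * Y i k + ((i == j) && (k == l))%:R.
  have diff : (i == k :> nat) != (j == l :> nat) -> ((i == j) && (k == l))%:R = 0 :> S.
    by case: (eqVneq i j) => // ->; case: (eqVneq k l) => // ->; rewrite eqxx.
  rewrite /X /Y; case: ifP => ik; case: ifP => jl.
  - rewrite mulrN mulNr (weyl_yx W) // io_inj [j == i]eq_sym [l == k]eq_sym.
    by zmod_solve.
  - by rewrite diff ?ik ?jl // addr0 (weyl_xx W).
  - by rewrite diff ?ik ?jl // addr0 mulrN mulNr (weyl_yy W).
  - by rewrite (weyl_yx W) // io_inj.
have Xp i k : X i k ^+ p = (i == k.+1 :> nat)%:R.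
  rewrite /X; case: ifP => [/eqP ik|ik].
    by rewrite exprNn (weyl_yp W) // mulr0 ik eqSn.
  rewrite (weyl_xp W) // /a io_mod io_div ik orbF; case: eqP => _; first exact: rmorph1.
  exact: rmorph0.
have Yp i k : Y i k ^+ p = (i == k :> nat)%:R.
  rewrite /Y; case: ifP => ik; last exact: (weyl_yp W).
  by rewrite (weyl_xp W) // /a io_mod io_div ik orbT rmorph1.
have XF (i : 'I_n.+1) (k : 'I_n) : (i <= k)%N -> X i k * F = 0.
  rewrite leq_eqVlt /X => /orP[/eqP ik|ik].
    rewrite ik eqxx mulNr (weyl_yF W) ?oppr0 // /d io_mod io_div ik ltnn.
    by rewrite eqSn.
  rewrite (ltn_eqF ik) (weyl_xF W) // /d /a io_mod io_div ?ik //.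
  by rewrite (lt_eqS _ _ ik) (ltn_eqF ik).
have YF (i : 'I_n.+1) (k : 'I_n) : (k.+1 < i)%N -> Y i k * F = 0.
  move=> /gtS[ik1 ik2 ik3]; rewrite /Y ik2 (weyl_yF W) // /d io_mod io_div.
  by rewrite ik1 ik3.
exists S, phi, (weyl_mx phi X Y), F; split=> //.
- exact: weyl_mx_is_linear.
- by move=> A B; exact: (weyl_mx_ad phiC XX YY YX).
- exact: (weyl_mx_pow hp phiC XX YY YX Xp Yp).
split=> [|i j ij|i]; first exact: (weyl_F0 W).
  rewrite weyl_mx_delta mulr_suml big1 // => k _.
  (* For i <= k the factor X_ik kills F; otherwise k + 1 < j and Y_jk kills it. *)
  have [ik|ki] := leqP i k.
    have -> : X i k * Y j k = Y j k * X i k.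
      by rewrite YX (_ : (j == i) = false) ?addr0 //; apply/eqP => E; move: ij; rewrite E ltnn.
    by rewrite -mulrA XF // mulr0.
  by rewrite -mulrA YF ?mulr0 //; exact: leq_ltn_trans ij.
rewrite weyl_mx_delta mulr_suml.
(* Each k >= i contributes -1, by X Y = Y X - 1 and X F = 0; among the others only k = i - 1
   contributes, namely c_i. *)
rewrite (eq_bigr (fun k : 'I_n => phi ((if i == k.+1 :> nat then (c i)%:R else 0)
    - (i <= k)%N%:R) * F)); last first.
  move=> k _; have [ik|ki] := leqP i k.
    have -> : X i k * Y i k = Y i k * X i k - 1 by rewrite YX !eqxx addrK.
    rewrite (_ : (i == k.+1 :> nat) = false); last by rewrite ltn_eqF.
    by rewrite mulrBl -mulrA XF // mulr0 mul1r sub0r sub0r rmorphN1 mulN1r.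
  rewrite subr0; have [ik|ik] := eqVneq (i : nat) k.+1; last first.
    by rewrite rmorph0 mul0r -mulrA YF ?mulr0 // ltn_neqAle eq_sym ik.
  rewrite /X /Y (_ : (i == k :> nat) = false); last by rewrite ik gtn_eqF.
  rewrite -mulrA (weyl_xyF W) // /d io_mod io_div ik (_ : (k.+1 < k)%N = false); last by rewrite ltnNge leqnSn.
  by rewrite eqxx rmorph_nat.
rewrite -mulr_suml -rmorph_sum sumrB; congr (phi (_ - _) * F).
  have [i0|i0] := posnP i; first by rewrite big1 // => k _; rewrite i0.
  have kn : (i.-1 < n)%N by have := ltn_ord i; lia.
  rewrite (bigD1 (Ordinal kn)) //= prednK // eqxx big1 ?addr0 // => k.
  rewrite -val_eqE /= => /eqP kN; rewrite (_ : (i == k.+1 :> nat) = false) //.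
  by apply/eqP; lia.
rewrite -natr_sum; congr (_%:R).
rewrite -(big_mkord xpredT (fun k => nat_of_bool (i <= k)%N)).
rewrite (@big_cat_nat _ _ _ i) //=; last by have := ltn_ord i; lia.
rewrite big_nat big1 => [|k /andP[_ ki]]; last by rewrite leqNgt ki.
rewrite add0n big_nat (eq_bigr (fun=> 1%N)) => [|k /andP[-> _] //].
by rewrite -big_nat sum_nat_const_nat muln1.
Qed.

(** * Baby Verma modules as modules over gl_n *)

Section RestrictionOfScalars.
Variables (A B : pzRingType) (f : {rmorphism A -> B}) (V : lmodType B).

Definition restrict_scalars of {rmorphism A -> B} : Type := V.
HB.instance Definition _ := GRing.Zmodule.on (restrict_scalars f).
Definition restrict_scale (a : A) (v : restrict_scalars f) : restrict_scalars f :=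
  f a *: (v : V).
Fact restrict_scalerA a b v :
  restrict_scale a (restrict_scale b v) = restrict_scale (a * b) v.
Proof. by rewrite /restrict_scale scalerA rmorphM. Qed.
Fact restrict_scale1 : left_id 1 restrict_scale.
Proof. by move=> v; rewrite /restrict_scale rmorph1 scale1r. Qed.
Fact restrict_scalerDr : right_distributive restrict_scale +%R.
Proof. by move=> a u v; exact: scalerDr. Qed.
Fact restrict_scalerDl v : {morph restrict_scale^~ v : a b / a + b}.
Proof. by move=> a b; rewrite /restrict_scale rmorphD; exact: scalerDl. Qed.
HB.instance Definition _ := GRing.Zmodule_isLmodule.Build A (restrict_scalars f)
  restrict_scalerA restrict_scale1 restrict_scalerDr restrict_scalerDl.

Lemma restrict_scaleE a (v : restrict_scalars f) : a *: v = f a *: (v : V) :> V.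
Proof. by []. Qed.

End RestrictionOfScalars.

Section TensorLift.
Variables (B A : pzRingType) (f : {rmorphism B -> A}) (M : lmodType B) (W : zmodType).
Variable beta : A -> M -> W.
Hypotheses (betaDl : forall a a' m, beta (a + a') m = beta a m + beta a' m)
  (betaDr : forall a m m', beta a (m + m') = beta a m + beta a m')
  (betaM : forall a b m, beta (a * f b) m = beta a (b *: m)).

Let F (t : A * M) (c : int) : W := beta t.1 t.2 *~ c.
Let Fadd t : zmod_morphism (F t).
Proof. by move=> c d; exact: mulrzBr. Qed.

Definition tensor_lift (x : tensor f M) : W := malg_ext F (repr x).

Let FB x y : malg_ext F (x - y) = malg_ext F x - malg_ext F y.
Proof. exact: malg_ext_zmod. Qed.

Lemma tensor_lift_ker x : tensor_gen f x -> malg_ext F x = 0.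
Proof.
have FU t : malg_ext F << t >> = beta t.1 t.2 by rewrite malg_extU // /F mulr1z.
elim=> {x} [_ [a1 a2 m|a1 m m'|a1 b m]||x y _ Ex _ Ey]; rewrite ?FB ?FU /=.
- by rewrite betaDl; zmod_solve.
- by rewrite betaDr; zmod_solve.
- by rewrite betaM subrr.
- by have := FB 0 0; rewrite !subrr.
- by rewrite Ex Ey subrr.
Qed.

Lemma tensor_lift_pi x : tensor_lift (tensor_pi f x) = malg_ext F x.
Proof.
apply/eqP; rewrite -subr_eq0 -FB; apply/eqP/tensor_lift_ker.
by apply/tensor_piP; rewrite tensor_piK.
Qed.

Lemma tensor_liftE a m : tensor_lift (pure_tensor f a m) = beta a m.
Proof. by rewrite pure_tensorE tensor_lift_pi malg_extU // /F mulr1z. Qed.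

Lemma tensor_lift_zmod : zmod_morphism tensor_lift.
Proof.
move=> x y; rewrite -(tensor_piK x) -(tensor_piK y) -tensor_piB !tensor_lift_pi.
exact: FB.
Qed.

End TensorLift.

Section UchiInduction.
Variables (K : fieldType) (n p : nat) (g : rLieAlg K n p) (chi : 'Hom(subvs_of g, K^o)).

Lemma free_ind (P : free_alg g -> Prop) :
    (forall c, P (free_scal g c)) -> (forall x, P (free_gen x)) ->
    (forall u v, P u -> P v -> P (u + v)) -> (forall u v, P u -> P v -> P (u * v)) ->
  forall u, P u.
Proof.
move=> Pc Pg PD PM u; rewrite [u]monalgE.
apply: (big_ind P) => // [|m _].
  by have := Pc 0; rewrite free_scalE rmorph0.
have -> : << u@_m *g m >> = free_scal g u@_m * << m >> :> free_alg g.
  by rewrite free_scalE [RHS]fgmulUU mulr1 mul1m.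
apply: (PM) => //; case: m => s; elim: s => [|x s IHs].
  have -> : << FMonom [::] >> = free_scal g 1 :> free_alg g; last exact: Pc.
  by rewrite free_scalE; congr << _ >>; apply: val_inj; rewrite /= fm1.
have -> : << FMonom (x :: s) >> = free_gen x * << FMonom s >> :> free_alg g.
  by rewrite free_genE [RHS]fgmulUU mulr1; congr << _ >>; apply: val_inj; rewrite /= fmM fmU.
exact: PM.
Qed.

Lemma Uchi_ind (P : Uchi chi -> Prop) :
    (forall c, P (Uchi_scal chi c)) -> (forall x, P (Uchi_gen chi x)) ->
    (forall u v, P u -> P v -> P (u + v)) -> (forall u v, P u -> P v -> P (u * v)) ->
  forall u, P u.
Proof.
move=> Pc Pg PD PM u; rewrite -(rquo_piK u) -(rquo_piK (repr u)).
move: (repr (repr u)) => {}u; elim/free_ind: u => // u v Pu Pv.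
- by rewrite rquo_piD rquo_piD; apply: PD.
- by rewrite rquo_piM rquo_piM; apply: PM.
Qed.

End UchiInduction.

(** * Derivations of reduced enveloping algebras *)

Section Derivation.
Variables (K : fieldType) (n p : nat) (g : rLieAlg K n p) (chi : 'Hom(subvs_of g, K^o)).
Hypothesis hp : p \in [pchar K].
Variables (e : 'M[K]_n).
Hypothesis eP : forall x, x \in rl_space g -> e *m x - x *m e \in rl_space g.

Definition lie_der (x : subvs_of g) : subvs_of g := Subvs (eP (subvsP x)).

Lemma lie_der_linear c x y : lie_der (c *: x + y) = c *: lie_der x + lie_der y.
Proof.
apply: val_inj; rewrite [RHS]linearP /=.
by rewrite mulmxDr mulmxDl -scalemxAl -scalemxAr scalerBr; zmod_solve.
Qed.

Lemma lie_der_bracket x y :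
  lie_der (bracket x y) = bracket (lie_der x) y + bracket x (lie_der y).
Proof.
apply: val_inj; rewrite [RHS]raddfD /=.
by rewrite !(mulmxBr, mulmxBl) !mulmxA; zmod_solve.
Qed.

Let A := Uchi chi.
Notation gen := (Uchi_gen chi).
Notation scal := (Uchi_scal chi).

Lemma Uchi_pchar : p%:R = 0 :> A.
Proof. by rewrite -(rmorph_nat scal) (pcharf0 hp) rmorph0. Qed.

Lemma gen_ad x y : ad (gen x) (gen y) = gen (bracket x y).
Proof. by rewrite Uchi_gen_bracket. Qed.

(** The sum is ad(x)^(p-1) applied to [e, x]. It involves brackets only and can be evaluated on
    matrices, where it is [e, x^p]. *)
Lemma lie_der_ppow x : gen (lie_der (ppow x)) =
  \sum_(i < p) gen x ^+ i * gen (lie_der x) * gen x ^+ (p.-1 - i).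
Proof.
have p_pr := pcharf_prime hp.
rewrite (sum_ad p_pr Uchi_pchar).
have it m : iter m (ad (gen x)) (gen (lie_der x)) = gen (iter m (bracket x) (lie_der x)).
  by elim: m => //= m ->; rewrite gen_ad.
rewrite it; congr gen; apply: val_inj => /=.
have itv m : vsval (iter m (bracket x) (lie_der x)) =
    iter m (ad (vsval x)) (e *m vsval x - vsval x *m e).
  by elim: m => //= m <-.
have p0 : p%:R = 0 :> 'M[K]_n.
  by rewrite -(rmorph_nat (scalar_mx : {rmorphism K -> 'M[K]_n})) (pcharf0 hp) rmorph0.
have := ad_pow p_pr p0 (vsval x) e; rewrite itv.
have pS := prednK (prime_gt0 p_pr); rewrite -{1}pS iterSr.
have -> : e *m vsval x - vsval x *m e = - ad (vsval x) e by rewrite opprB.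
have itN m w : iter m (ad (vsval x)) (- w) = - iter m (ad (vsval x)) w.
  by elim: m => //= m ->; rewrite raddfN.
by rewrite itN => ->; rewrite opprB.
Qed.

(** [Uchi_lift] yields ring morphisms, so the derivation is obtained as the upper right entry of a
    morphism into upper triangular 2 by 2 matrices with u on the diagonal. *)
Definition der_mx (x : subvs_of g) : 'M[A]_2 :=
  \matrix_(i, j) (if i == j then gen x else if i == ord0 then gen (lie_der x) else 0).
Definition der_scal (c : K) : 'M[A]_2 := (scal c)%:M.
Fact der_scal_zmod : zmod_morphism der_scal.
Proof. by move=> c d; rewrite /der_scal !rmorphB. Qed.
Fact der_scal_monoid : monoid_morphism der_scal.
Proof. by split=> [|c d]; rewrite /der_scal ?rmorph1 ?rmorphM. Qed.
HB.instance Definition _ := GRing.isZmodMorphism.Build K 'M[A]_2 der_scal der_scal_zmod.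
HB.instance Definition _ := GRing.isMonoidMorphism.Build K 'M[A]_2 der_scal der_scal_monoid.

Definition uptri2 (M : 'M[A]_2) (a b : A) :=
  [/\ M ord0 ord0 = a, M ord0 ord_max = b, M ord_max ord0 = 0 & M ord_max ord_max = a].

Lemma uptri2M M N a b c d : uptri2 M a b -> uptri2 N c d ->
  uptri2 (M * N) (a * c) (a * d + b * c).
Proof.
move=> [M00 M01 M10 M11] [N00 N01 N10 N11].
have o1 : lift ord0 (ord0 : 'I_1) = ord_max :> 'I_2 by apply: val_inj.
split; rewrite !mxE !big_ord_recl big_ord0 !o1 ?M00 ?M01 ?M10 ?M11 ?N00 ?N01 ?N10 ?N11.
- by rewrite mulr0 !addr0.
- by rewrite addr0.
- by rewrite mul0r mulr0 !addr0.
- by rewrite mul0r add0r addr0.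
Qed.

Lemma uptri2D M N a b c d : uptri2 M a b -> uptri2 N c d ->
  uptri2 (M + N) (a + c) (b + d).
Proof. by move=> [? ? E ?] [? ? E' ?]; split; rewrite !mxE; congr (_ + _) || rewrite E E' addr0. Qed.

Lemma uptri2_eq M N a b : uptri2 M a b -> uptri2 N a b -> M = N.
Proof.
move=> [M00 M01 M10 M11] [N00 N01 N10 N11]; apply/matrixP => i j.
have H (k : 'I_2) : k = ord0 \/ k = ord_max.
  by case: k => -[|[|//]] ki; [left|right]; apply: val_inj.
by case: (H i) (H j) => [->|->] [->|->]; congruence.
Qed.

Lemma uptri2_der x : uptri2 (der_mx x) (gen x) (gen (lie_der x)).
Proof. by split; rewrite mxE. Qed.

Lemma uptri2_scal c : uptri2 (der_scal c) (scal c) 0.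
Proof. by split; rewrite mxE. Qed.

Lemma uptri2_pow M a b m : uptri2 M a b ->
  uptri2 (M ^+ m) (a ^+ m) (\sum_(i < m) a ^+ i * b * a ^+ (m.-1 - i)).
Proof.
move=> HM; elim: m => [|m IHm]; first by rewrite big_ord0 !expr0; split; rewrite mxE.
rewrite !exprSr; have := uptri2M IHm HM; congr uptri2.
rewrite big_ord_recr /= subnn expr0 mulr1 addrC mulr_suml; congr (_ + _).
apply: eq_bigr => i _; rewrite -mulrA -exprSr; congr (_ * _ ^+ _).
by have := ltn_ord i; lia.
Qed.

(** In the relation x^p - x^[p] = chi(x)^p, the left side has derivative 0 by [lie_der_ppow], and
    the right side is a scalar. *)
Lemma der_compatible : Uchi_compatible chi (der_scal : {rmorphism K -> 'M[A]_2}) der_mx.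
Proof.
split=> [c x|c x y|x y|x] /=.
- apply: (uptri2_eq (uptri2M (uptri2_scal c) (uptri2_der x))).
  have := uptri2M (uptri2_der x) (uptri2_scal c).
  by rewrite mulr0 add0r mul0r addr0 -!Uchi_scal_central.
- have := uptri2D (uptri2M (uptri2_scal c) (uptri2_der x)) (uptri2_der y).
  rewrite mul0r addr0 -!Uchi_gen_linear -lie_der_linear.
  exact: uptri2_eq (uptri2_der _).
- have uptri2N M a b : uptri2 M a b -> uptri2 (- M) (- a) (- b).
    by move=> [E1 E2 E3 E4]; split; rewrite !mxE ?E1 ?E2 ?E3 ?E4 ?oppr0.
  have := uptri2D (uptri2M (uptri2_der x) (uptri2_der y))
    (uptri2N _ _ _ (uptri2M (uptri2_der y) (uptri2_der x))).
  rewrite -Uchi_gen_bracket.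
  have -> : gen x * gen (lie_der y) + gen (lie_der x) * gen y -
      (gen y * gen (lie_der x) + gen (lie_der y) * gen x) = gen (lie_der (bracket x y)).
    have genD u v : gen (u + v) = gen u + gen v.
      by rewrite -[u]scale1r Uchi_gen_linear rmorph1 mul1r scale1r.
    rewrite lie_der_bracket genD !Uchi_gen_bracket; zmod_solve.
  exact: uptri2_eq (uptri2_der _).
- have uptri2N M a b : uptri2 M a b -> uptri2 (- M) (- a) (- b).
    by move=> [E1 E2 E3 E4]; split; rewrite !mxE ?E1 ?E2 ?E3 ?E4 ?oppr0.
  have := uptri2D (uptri2_pow p (uptri2_der x)) (uptri2N _ _ _ (uptri2_der (ppow x))).
  rewrite Uchi_gen_ppow lie_der_ppow subrr => H.
  exact: uptri2_eq H (uptri2_scal _).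
Qed.

Definition Uchi_der (u : A) : A := Uchi_lift der_compatible u ord0 ord_max.

Lemma uptri2_lift u : uptri2 (Uchi_lift der_compatible u) u (Uchi_der u).
Proof.
suff H : exists b, uptri2 (Uchi_lift der_compatible u) u b.
  by have [b [H1 H2 H3 H4]] := H; split.
elim/Uchi_ind: u => [c|x|u v [b Hb] [d Hd]|u v [b Hb] [d Hd]].
- by exists 0; rewrite Uchi_lift_scal; exact: uptri2_scal.
- by exists (gen (lie_der x)); rewrite Uchi_lift_gen; exact: uptri2_der.
- by exists (b + d); rewrite rmorphD; exact: uptri2D.
- by exists (u * d + b * v); rewrite rmorphM; exact: uptri2M.
Qed.

Lemma Uchi_derD u v : Uchi_der (u + v) = Uchi_der u + Uchi_der v.
Proof. by rewrite /Uchi_der rmorphD mxE. Qed.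

Lemma Uchi_derM u v : Uchi_der (u * v) = u * Uchi_der v + Uchi_der u * v.
Proof.
have [_ E _ _] := uptri2M (uptri2_lift u) (uptri2_lift v).
by rewrite -E -rmorphM.
Qed.

Lemma Uchi_der_gen x : Uchi_der (gen x) = gen (lie_der x).
Proof. by rewrite /Uchi_der Uchi_lift_gen; have [_ ->] := uptri2_der x. Qed.

Lemma Uchi_der_scal c : Uchi_der (scal c) = 0.
Proof. by rewrite /Uchi_der Uchi_lift_scal; have [_ ->] := uptri2_scal c. Qed.

End Derivation.

(** * From sl_n and a derivation to gl_n *)

Section ExtendedAction.
Variables (K : fieldType) (n : nat) (A : pzRingType) (s : {rmorphism K -> A}).
Variables (G : 'M[K]_n -> A) (der : A -> A).
Hypotheses (sC : forall c u, s c * u = u * s c)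
  (G_linear : forall c M N, G (c *: M + N) = s c * G M + G N)
  (der_s : forall c, der (s c) = 0)
  (G_bracket : forall M N, G (M *m N - N *m M) =
     G M * G N - G N * G M + s (\tr M) * der (G N) - s (\tr N) * der (G M)).
Variables (Z : lmodType A) (D : Z -> Z).
Hypotheses (D_zmod : zmod_morphism D)
  (D_scale : forall u z, D (u *: z) = der u *: z + u *: D z).

Let Zk := restrict_scalars Z s.

(* [G] is the action of the traceless part, and [D] that of a matrix of trace 1. *)
Definition gl_act (M : 'M[K]_n) (z : Zk) : Zk := G M *: (z : Z) + s (\tr M) *: D z.

Let DD y z : D (y + z) = D y + D z.
Proof.
have D0 : D 0 = 0 by have := D_zmod 0 0; rewrite !subrr.
have DN w : D (- w) = - D w by rewrite -sub0r D_zmod D0 sub0r.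
by rewrite -{1}[z]opprK D_zmod DN opprK.
Qed.

Lemma gl_act_is_linear M : linear (gl_act M).
Proof.
move=> c y z; rewrite /gl_act !restrict_scaleE DD D_scale der_s scale0r add0r.
by rewrite !scalerDr !scalerA !(sC c); zmod_solve.
Qed.
HB.instance Definition _ M := GRing.isLinear.Build K Zk Zk _ (gl_act M) (gl_act_is_linear M).

Lemma gl_act_linear_l c M N z : gl_act (c *: M + N) z = c *: gl_act M z + gl_act N z.
Proof.
rewrite /gl_act G_linear linearP /= restrict_scaleE rmorphD rmorphM.
by rewrite !scalerDl scalerDr !scalerA; zmod_solve.
Qed.

Lemma gl_act_bracket M N z : gl_act M (gl_act N z) =
  gl_act N (gl_act M z) + gl_act (M *m N - N *m M) z.
Proof.
rewrite /gl_act mxtrace_commutator rmorph0 scale0r addr0 G_bracket.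
rewrite !DD !D_scale !der_s !scale0r !add0r !(scalerDl, scaleNr) !scalerDr !scalerA.
rewrite -!(sC (\tr M)) -!(sC (\tr N)) [s (\tr N) * s (\tr M)]sC; zmod_solve.
Qed.

End ExtendedAction.

Section SlAction.
Variables (K : fieldType) (p : nat) (hp : p \in [pchar K]) (n : nat) (o : 'I_n).
Variables (chi : 'Hom(subvs_of (sl n hp), K^o)) (chiP : regular_nilpotent chi).
Let A := Uchi chi.
Notation gen := (Uchi_gen chi).
Notation scal := (Uchi_scal chi).

Lemma p_gt1 : (1 < p)%N. Proof. exact: prime_gt1 (pcharf_prime hp). Qed.

Lemma mxtrace_delta (i j : 'I_n) : \tr (delta_mx i j : 'M[K]_n) = (i == j)%:R.
Proof.
rewrite /mxtrace (bigD1 i) //= mxE eqxx /= big1 ?addr0 // => k /negbTE ki.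
by rewrite mxE ki.
Qed.

Lemma delta_mul (i j k l : 'I_n) :
  delta_mx i j *m delta_mx k l = delta_mx i l *+ (j == k) :> 'M[K]_n.
Proof. by rewrite mul_delta_mx_cond. Qed.

Lemma delta_pow (i j : 'I_n) : i != j -> (delta_mx i j : 'M[K]_n) ^+ p = 0.
Proof.
move=> ij; case: p p_gt1 => [|[|q]] // _.
by rewrite !exprS mulrA -[X in X * _]/(_ *m _) delta_mul eq_sym (negbTE ij) mulr0n mul0r.
Qed.

Let e := delta_mx o o : 'M[K]_n.

Lemma e_sl x : x \in rl_space (sl n hp) -> e *m x - x *m e \in rl_space (sl n hp).
Proof. by move=> _; rewrite /= mem_sl mxtrace_commutator. Qed.

(* The projection of gl_n onto sl_n along the line spanned by E_oo. *)
Definition slp (M : 'M[K]_n) : subvs_of (sl n hp) := vsproj (sl n hp) (M - \tr M *: e).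

Lemma slpK M : vsval (slp M) = M - \tr M *: e.
Proof.
rewrite vsprojK // /= mem_sl raddfB /= linearZ /= mxtrace_delta eqxx mulr1.
by rewrite subrr.
Qed.

Lemma slp_linear c M N : slp (c *: M + N) = c *: slp M + slp N.
Proof.
apply: val_inj; rewrite [RHS]linearP /= !slpK linearP /= scalerDl scalerBr scalerA.
by zmod_solve.
Qed.

Lemma slp_val x : slp (vsval x) = x.
Proof.
apply: val_inj; rewrite /= slpK; have := subvsP x; rewrite /= mem_sl => /eqP->.
by rewrite scale0r subr0.
Qed.

Lemma slp_delta i j : i != j -> slp (delta_mx i j) = root_vec hp i j.
Proof.
move=> ij; apply: val_inj; rewrite /= slpK root_vecE // mxtrace_delta (negbTE ij).
by rewrite scale0r subr0.
Qed.

(** The form in which the p-character comes out of [weyl_mx_pow]. *)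
Lemma chi_formula (x : subvs_of (sl n hp)) :
  chi x = \sum_i \sum_j vsval x i j * (i == j.+1 :> nat)%:R.
Proof.
have [chi1 chiH chi0] := chiP.
have xE : x = slp (diag_mx (\row_i vsval x i i)) +
    \sum_i \sum_(j | i != j) vsval x i j *: root_vec hp i j.
  apply: val_inj; rewrite [RHS]raddfD /= slpK raddf_sum /=.
  have -> : \tr (diag_mx (\row_i vsval x i i)) = 0.
    have := subvsP x; rewrite /= mem_sl => /eqP <-; rewrite /mxtrace.
    by apply: eq_bigr => i _; rewrite !mxE eqxx mulr1n.
  rewrite scale0r subr0 {1}[vsval x]matrix_sum_delta diag_mx_sum_delta -big_split /=.
  apply: eq_bigr => i _; rewrite mxE (bigD1 i) //=; congr (_ + _).
  rewrite raddf_sum /=; apply: eq_big => [j|j ij]; first by rewrite eq_sym.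
  by rewrite root_vecE // eq_sym.
rewrite {1}xE raddfD /= chiH ?add0r; last first.
  rewrite slpK mem_h; apply/andP; split.
    by rewrite raddfB /= linearZ /= mxtrace_delta eqxx mulr1 subrr.
  have -> : \tr (diag_mx (\row_i vsval x i i)) = 0.
    have := subvsP x; rewrite /= mem_sl => /eqP <-; rewrite /mxtrace.
    by apply: eq_bigr => i _; rewrite !mxE eqxx mulr1n.
  by rewrite scale0r subr0 diag_mx_is_diag.
rewrite raddf_sum /=; apply: eq_bigr => i _.
rewrite raddf_sum [RHS](bigD1 i) //= (_ : (i == i.+1 :> nat) = false) ?mulr0 ?add0r; last by lia.
apply: eq_big => [j|j ij]; first by rewrite eq_sym.
rewrite linearZ /=; congr (_ * _); case: eqP => [ij1|ij1]; last by rewrite chi0.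
by rewrite chi1.
Qed.

Lemma Uchi_scalC c (u : A) : scal c * u = u * scal c.
Proof.
elim/Uchi_ind: u => [d|x|u v Eu Ev|u v Eu Ev].
- by rewrite -!rmorphM mulrC.
- exact: Uchi_scal_central.
- by rewrite mulrDl mulrDr Eu Ev.
- by rewrite mulrA Eu -mulrA Ev mulrA.
Qed.

Lemma Uchi_gen0 : gen 0 = 0.
Proof.
by have := Uchi_gen_linear chi (-1) 0 0; rewrite scaleN1r addNr rmorphN1 mulN1r addNr.
Qed.

Definition slg (M : 'M[K]_n) : A := gen (slp M).

Lemma slg_linear c M N : slg (c *: M + N) = scal c * slg M + slg N.
Proof. by rewrite /slg slp_linear Uchi_gen_linear. Qed.

Notation der := (Uchi_der hp e_sl).

Lemma slg_bracket M N : slg (M *m N - N *m M) = slg M * slg N - slg N * slg M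
  + scal (\tr M) * der (slg N) - scal (\tr N) * der (slg M).
Proof.
rewrite /slg !Uchi_der_gen -Uchi_gen_bracket.
have genD c u w : gen w + scal c * gen u = gen (c *: u + w).
  by rewrite Uchi_gen_linear addrC.
have genB c u w : gen w - scal c * gen u = gen (- c *: u + w).
  by rewrite -genD rmorphN mulNr.
rewrite genD genB; congr gen; apply: val_inj.
rewrite [RHS]linearP /= !slpK mxtrace_commutator scale0r subr0.
set tM := \tr M; set tN := \tr N.
rewrite !(mulmxBr, mulmxBl) -!scalemxAl -!scalemxAr !scaleNr !scalerBr !scalerA.
by rewrite [tN * tM]mulrC; zmod_solve.
Qed.

Lemma Uchi_der_scal0 c : der (scal c) = 0.
Proof. exact: Uchi_der_scal. Qed.

Section Module.
Variables (Z : lmodType A) (D : Z -> Z).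
Hypotheses (D_zmod : zmod_morphism D)
  (D_scale : forall u z, D (u *: z) = der u *: z + u *: D z).

Let Zk := restrict_scalars Z scal.

Notation act := (@gl_act K n A scal slg Z D).

Definition sl_act (M : 'M[K]_n) : Zk -> Zk := act M.
Lemma sl_act_is_linear M : linear (sl_act M).
Proof. exact: (gl_act_is_linear slg Uchi_scalC Uchi_der_scal0 D_zmod D_scale). Qed.
HB.instance Definition _ M := GRing.isLinear.Build K Zk Zk _ (sl_act M) (sl_act_is_linear M).

Lemma sl_act_linear_l c M N z : sl_act (c *: M + N) z = c *: sl_act M z + sl_act N z.
Proof. exact: (gl_act_linear_l slg_linear). Qed.

Lemma sl_act_bracket M N z : sl_act M (sl_act N z) =
  sl_act N (sl_act M z) + sl_act (M *m N - N *m M) z.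
Proof. exact: (gl_act_bracket Uchi_scalC Uchi_der_scal0 slg_bracket D_zmod D_scale). Qed.

Lemma sl_act_gen x z : sl_act (vsval x) z = gen x *: (z : Z).
Proof.
rewrite /sl_act /gl_act /slg slp_val; have := subvsP x; rewrite /= mem_sl => /eqP->.
by rewrite rmorph0 scale0r addr0.
Qed.

Lemma sl_act_tr0 M z : \tr M = 0 -> sl_act M z = slg M *: (z : Z).
Proof. by move=> tM; rewrite /sl_act /gl_act tM rmorph0 scale0r addr0. Qed.

Lemma sl_act_e z : sl_act e z = D z.
Proof.
rewrite /sl_act /gl_act mxtrace_delta eqxx rmorph1 scale1r.
have -> : slg e = 0; last by rewrite scale0r add0r.
rewrite /slg (_ : slp e = 0) ?Uchi_gen0 //; apply: val_inj.
transitivity (0 : 'M[K]_n); last exact/esym/(raddf0 vsval).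
by rewrite [LHS]slpK mxtrace_delta eqxx scale1r subrr.
Qed.

Definition gl_E (i j : 'I_n) : {linear Zk -> Zk} := sl_act (delta_mx i j).

Lemma sl_actB M N z : sl_act (M - N) z = sl_act M z - sl_act N z.
Proof. by rewrite -[M]scale1r -scaleN1r addrC sl_act_linear_l scaleN1r scale1r addrC. Qed.

Lemma sl_act0 z : sl_act 0 z = 0.
Proof. by rewrite -(subrr 0) sl_actB subrr. Qed.

Lemma sl_act_sum z M : sl_act M z = \sum_i \sum_j M i j *: gl_E i j z.
Proof.
have actD N N' : sl_act (N + N') z = sl_act N z + sl_act N' z.
  by have := sl_act_linear_l 1 N N' z; rewrite !scale1r.
rewrite {1}[M]matrix_sum_delta (big_morph (sl_act^~ z) actD (sl_act0 z)).
apply: eq_bigr => i _; rewrite (big_morph (sl_act^~ z) actD (sl_act0 z)).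
apply: eq_bigr => j _.
by have := sl_act_linear_l (M i j) (delta_mx i j) 0 z; rewrite addr0 sl_act0 addr0.
Qed.

Lemma gl_E_rep : gl_rep p gl_E.
Proof.
split=> [i j k l z|i j z ji].
  have H := sl_act_bracket (delta_mx i j) (delta_mx k l) z.
  have E1 : sl_act (delta_mx i l *+ (j == k)) z = gl_E i l z *+ (j == k).
    by case: (j == k); rewrite ?mulr1n // !mulr0n sl_act0.
  have E2 : sl_act (delta_mx k j *+ (l == i)) z = gl_E k j z *+ (l == i).
    by case: (l == i); rewrite ?mulr1n // !mulr0n sl_act0.
  by rewrite !delta_mul sl_actB E1 E2 addrA in H.
have ij : i != j by apply/eqP => E; move: ji; rewrite E ltnn.
have gE y : gl_E i j y = gen (root_vec hp i j) *: (y : Z).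
  rewrite [LHS]sl_act_tr0 /slg ?slp_delta // mxtrace_delta (negbTE ij) //.
have itE q : iter q (gl_E i j) z = gen (root_vec hp i j) ^+ q *: (z : Z).
  elim: q => [|q IHq]; first by rewrite expr0 scale1r.
  by rewrite iterS IHq gE scalerA exprS.
have p0 : ppow (root_vec hp i j) = 0.
  apply: val_inj; transitivity (0 : 'M[K]_n); last exact/esym/(raddf0 vsval).
  by rewrite /= root_vecE // delta_pow.
have [chi1 chiH chi0] := chiP.
have := Uchi_gen_ppow chi (root_vec hp i j); rewrite p0 Uchi_gen0 subr0 itE => ->.
case: eqP => [ij1|ij1]; first by rewrite chi1 // expr1n rmorph1 scale1r.
by rewrite chi0 // expr0n gtn_eqF ?(ltnW p_gt1) // rmorph0 scale0r.
Qed.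

Lemma Uchi_stable (P : Z -> Prop) :
    subspace (P : Zk -> Prop) -> (forall x z, P z -> P (gen x *: z)) ->
  forall u z, P z -> P (u *: z).
Proof.
move=> sP Pg u; elim/Uchi_ind: u => [c|x|u v Pu Pv|u v Pu Pv] z Pz.
- exact: (subspaceZ c sP Pz).
- exact: Pg.
- by rewrite scalerDl; apply: (subspaceD sP); [exact: Pu|exact: Pv].
- by rewrite -scalerA; apply/Pu/Pv.
Qed.

Lemma stable_Uchi (P : Z -> Prop) : stable gl_E P ->
  forall u z, P z -> P (u *: z).
Proof.
move=> [sP PE]; apply: Uchi_stable => // x z Pz; rewrite -sl_act_gen sl_act_sum.
apply: (subspace_sum _ sP) => i _; apply: (subspace_sum _ sP) => j _.
by apply: (subspaceZ _ sP); exact: PE.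
Qed.

End Module.
End SlAction.

(** * The baby Verma module: universal property, derivation and weight *)

Section BabyVermaModule.
Variables (K : fieldType) (p : nat) (hp : p \in [pchar K]) (n : nat) (o : 'I_n).
Variables (chi : 'Hom(subvs_of (sl n hp), K^o)) (chiP : regular_nilpotent chi).
Variables (lam : 'Hom(subvs_of (cartan n hp), K^o)) (lamP : restricted_weight lam).
Let A := Uchi chi.
Notation gen := (Uchi_gen chi).
Notation scal := (Uchi_scal chi).
Notation slg := (slg o chi).
Let b := borel n hp.
Let f := U0_incl (borel_sub_sl n hp) (regular_nilpotent_b0 chiP).
Let Z := baby_verma (regular_nilpotent_b0 chiP) lamP.
Notation bgen := (Uchi_gen (0 : 'Hom(subvs_of b, K^o))).
Notation bscal := (Uchi_scal (0 : 'Hom(subvs_of b, K^o))).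

Lemma U0_incl_gen y : f (bgen y) = gen (incl (sl n hp) y).
Proof. exact: Uchi_lift_gen. Qed.
Lemma U0_incl_scal c : f (bscal c) = scal c.
Proof. exact: Uchi_lift_scal. Qed.

Definition verma_gen : Z := pure_tensor f 1 ((1 : K) : Klambda lamP).

Lemma verma_pure u (m : Klambda lamP) : pure_tensor f u m = u *: (scal m *: verma_gen) :> Z.
Proof.
have -> : pure_tensor f u m = u *: pure_tensor f 1 m.
  by rewrite [RHS]tensor_smulE mulr1.
congr (_ *: _); rewrite /verma_gen [RHS]tensor_smulE mulr1 -[scal m]mul1r -U0_incl_scal.
rewrite pure_tensor_balanced; congr pure_tensor.
by rewrite -[RHS]/(Klambda_scale _ _) /Klambda_scale Uchi_lift_scal mulr1.
Qed.

Lemma verma_ind (P : Z -> Prop) :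
    P 0 -> (forall x y, P x -> P y -> P (x - y)) -> (forall u, P (u *: verma_gen)) ->
  forall z, P z.
Proof.
by move=> P0 PB Pu; apply: tensor_ind => // a m; rewrite verma_pure scalerA.
Qed.

Lemma verma_gen_borel y :
  gen (incl (sl n hp) y) *: verma_gen = scal (b_char lam y) *: verma_gen.
Proof.
rewrite {1}/verma_gen [LHS]tensor_smulE mulr1 -U0_incl_gen -[f _]mul1r pure_tensor_balanced.
rewrite [LHS]verma_pure scale1r Klambda_genE; congr (scal _ *: _); exact: mulr1.
Qed.

Lemma U0_incl_hw (W : lmodType A) (w : W) :
    (forall y, gen (incl (sl n hp) y) *: w = scal (b_char lam y) *: w) ->
  forall u, f u *: w = scal (Uchi_lift (b_char_compatible lamP) u) *: w.
Proof.
move=> Hw; elim/Uchi_ind => [c|y|u u' IH IH'|u u' IH IH'].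
- by rewrite U0_incl_scal Uchi_lift_scal.
- by rewrite U0_incl_gen Hw Uchi_lift_gen.
- by rewrite !rmorphD !scalerDl IH IH'.
- rewrite !rmorphM -!scalerA IH' [LHS]scalerA -Uchi_scalC -scalerA IH !scalerA.
  by congr (_ *: _); rewrite Uchi_scalC.
Qed.

Lemma verma_universal (W : lmodType A) (w : W) :
    (forall y, gen (incl (sl n hp) y) *: w = scal (b_char lam y) *: w) ->
  exists T : {linear Z -> W}, T verma_gen = w.
Proof.
move=> Hw; pose beta (a : A) (m : Klambda lamP) : W := a *: (scal m *: w).
have bDl a a' m : beta (a + a') m = beta a m + beta a' m by exact: scalerDl.
have bDr a m m' : beta a (m + m') = beta a m + beta a m'.
  by rewrite /beta -scalerDr -scalerDl -rmorphD.
have bM a u m : beta (a * f u) m = beta a (u *: m).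
  rewrite /beta -scalerA; congr (_ *: _).
  rewrite !scalerA -Uchi_scalC -scalerA U0_incl_hw // scalerA -rmorphM.
  by rewrite mulrC.
have Tz := tensor_lift_zmod bDl bDr bM; have TE := tensor_liftE bDl bDr bM.
pose T (z : Z) : W := tensor_lift beta z.
have TB x y : T (x - y) = T x - T y by exact: Tz.
have TN x : T (- x) = - T x.
  have T0 : T 0 = 0 by have := TB 0 0; rewrite !subrr.
  by rewrite -sub0r TB T0 sub0r.
have TD x y : T (x + y) = T x + T y by rewrite -{1}[y]opprK TB TN opprK.
have T0 : T 0 = 0 by have := TB 0 0; rewrite !subrr.
have Tu u : T (u *: verma_gen) = u *: w.
  have -> : u *: verma_gen = pure_tensor f u ((1 : K) : Klambda lamP).
    by rewrite /verma_gen [LHS]tensor_smulE mulr1.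
  by rewrite /T TE /beta rmorph1 scale1r.
have TZ a x : T (a *: x) = a *: T x.
  elim/verma_ind: x => [|x y Ex Ey|u]; first by rewrite scaler0 T0 scaler0.
    by rewrite scalerBr !TB Ex Ey scalerBr.
  by rewrite [a *: (u *: _)]scalerA !Tu scalerA.
have Tlin : linear T by move=> a x y; rewrite TD TZ.
pose Tm := GRing.isLinear.Build A Z W _ T Tlin.
pose TL : {linear Z -> W} := HB.pack T Tm.
by exists TL; have := Tu 1; rewrite !scale1r.
Qed.

Let e : 'M[K]_n := delta_mx o o.

Lemma delta_diag (i : 'I_n) : is_diag_mx (delta_mx i i : 'M[K]_n).
Proof.
apply/is_diag_mxP => k l kl; rewrite mxE; case: eqP => //= ki; case: eqP => //= li.
by rewrite ki li eqxx in kl.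
Qed.

Lemma e_borel y : y \in rl_space b -> e *m y - y *m e \in rl_space b.
Proof.
rewrite /= !mem_b mxtrace_commutator eqxx /= => /andP[_ ty].
have te : is_trig_mx e^T by apply: diag_uptri; exact: delta_diag.
have /is_trig_mxP t1 := uptri_mul te ty; have /is_trig_mxP t2 := uptri_mul ty te.
apply/is_trig_mxP => i j ij; have := t1 _ _ ij; have := t2 _ _ ij.
by rewrite !mxE => E1 E2; rewrite E1 E2 subrr.
Qed.

Lemma b_char_e (y : subvs_of b) : b_char lam (Subvs (e_borel (subvsP y))) = 0.
Proof.
have := subvsP y; rewrite /= mem_b => /andP[_ ty].
have te : is_trig_mx e^T by apply: diag_uptri; exact: delta_diag.
rewrite /b_char (_ : diag_part _ = 0) ?raddf0 //; apply: val_inj.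
transitivity (0 : 'M[K]_n); last exact/esym/(raddf0 vsval).
rewrite [LHS]diag_partK; apply/matrixP => i j; rewrite 3!mxE /= [RHS]mxE.
rewrite [X in _ + X]mxE !uptri_mul_diag // [X in _ - X]mulrC subrr.
by rewrite mul0rn.
Qed.

Notation der := (Uchi_der hp (@e_sl K p hp n o)).

(** D is der (x) id. It is balanced over U_0(b) because ad(E_oo) sends b to matrices with zero
    diagonal, which act by 0 on K_lambda. *)
Lemma verma_der_exists : exists D : Z -> Z,
  [/\ zmod_morphism D, forall u z, D (u *: z) = der u *: z + u *: D z & D verma_gen = 0].
Proof.
pose beta (a : A) (m : Klambda lamP) : Z := pure_tensor f (der a) m.
have pureM u a m : pure_tensor f (u * a) m = u *: pure_tensor f a m.
  by rewrite [RHS]tensor_smulE.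
have pure0 m : pure_tensor f 0 m = 0.
  by rewrite -(mulr0 0) pureM -(scale0r (pure_tensor f 0 m)).
have der_f u (m : Klambda lamP) : pure_tensor f (der (f u)) m = 0.
  elim/Uchi_ind: u m => [c|y|u u' IH IH'|u u' IH IH'] m.
  - by rewrite U0_incl_scal Uchi_der_scal pure0.
  - rewrite U0_incl_gen Uchi_der_gen.
    have -> : lie_der (@e_sl K p hp n o) (incl (sl n hp) y) =
        incl (sl n hp) (Subvs (e_borel (subvsP y))).
      by apply: val_inj; rewrite /= ?vsprojK ?(subvP (borel_sub_sl n hp)) ?e_borel ?subvsP //.
    rewrite -U0_incl_gen -[f _]mul1r pure_tensor_balanced Klambda_genE b_char_e mul0r.
    by have := pure_tensorDr f 1 (0 : Klambda lamP) 0; rewrite addr0 => /eqP; rewrite -subr_eq subrr eq_sym => /eqP.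
  - by rewrite rmorphD Uchi_derD pure_tensorDl IH IH' addr0.
  - rewrite rmorphM Uchi_derM pure_tensorDl pureM IH' scaler0 add0r.
    by rewrite pure_tensor_balanced IH.
have bDl a a' m : beta (a + a') m = beta a m + beta a' m.
  by rewrite /beta Uchi_derD pure_tensorDl.
have bDr a m m' : beta a (m + m') = beta a m + beta a m' by exact: pure_tensorDr.
have bM a u m : beta (a * f u) m = beta a (u *: m).
  by rewrite /beta Uchi_derM pure_tensorDl pureM der_f scaler0 add0r pure_tensor_balanced.
have Dz := tensor_lift_zmod bDl bDr bM; have DE := tensor_liftE bDl bDr bM.
pose D (z : Z) : Z := tensor_lift beta z.
have DB x y : D (x - y) = D x - D y by exact: Dz.
have Du u : D (u *: verma_gen) = der u *: verma_gen.
  have -> : u *: verma_gen = pure_tensor f u ((1 : K) : Klambda lamP).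
    by rewrite /verma_gen [LHS]tensor_smulE mulr1.
  by rewrite /D DE /beta /verma_gen -pureM mulr1.
have D0 : D 0 = 0 by have := DB 0 0; rewrite !subrr.
exists D; split=> //; last by have := Du 1; rewrite scale1r => ->; rewrite -(rmorph1 scal) Uchi_der_scal scale0r.
move=> u z; elim/verma_ind: z => [|x y Ex Ey|u'].
- by rewrite !scaler0 D0 scaler0 addr0.
- have subACA (V : zmodType) (x1 x2 x3 x4 : V) : x1 + x2 - (x3 + x4) = x1 - x3 + (x2 - x4).
    by rewrite opprD addrACA.
  by rewrite [u *: (x - y)]scalerBr !DB Ex Ey !scalerBr; exact: subACA.
- by rewrite [u *: (u' *: _)]scalerA !Du Uchi_derM scalerDl !scalerA addrC.
Qed.

Definition cartan_diff (i : 'I_n) : subvs_of (cartan n hp) :=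
  vsproj (cartan n hp) (delta_mx i i - delta_mx o o).

Lemma cartan_diffK i : vsval (cartan_diff i) = delta_mx i i - delta_mx o o.
Proof.
rewrite vsprojK // /= mem_h raddfB /= !mxtrace_delta !eqxx subrr eqxx /=.
apply/is_diag_mxP => k l kl; rewrite !mxE.
by have /is_diag_mxP/(_ k l kl) := delta_diag i; have /is_diag_mxP/(_ k l kl) := delta_diag o; rewrite !mxE => -> ->; rewrite subrr.
Qed.

(* The extension of lambda to the diagonal matrices that vanishes on E_oo. *)
Definition gl_weight (i : 'I_n) : K := lam (cartan_diff i).

Lemma gl_weight_o : gl_weight o = 0.
Proof.
rewrite /gl_weight (_ : cartan_diff o = 0) ?raddf0 //; apply: val_inj.
transitivity (0 : 'M[K]_n); last exact/esym/(raddf0 vsval).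
by rewrite [LHS]cartan_diffK subrr.
Qed.

(** E_ii - E_oo is its own p-th power, so the condition defining X_p says that the value of lambda
    on it is fixed by Frobenius. *)
Lemma gl_weight_prime_field i : in_prime_field (gl_weight i).
Proof.
apply: (pow_prime_field hp); rewrite /gl_weight lamP; congr (lam _); apply: val_inj => /=.
have := h_pow hp (subvsP (cartan_diff i)); rewrite mem_h => /andP[_ /is_diag_mxP dp].
have := subvsP (cartan_diff i); rewrite /= mem_h => /andP[_ /is_diag_mxP d1].
have [_ de] := uptri_exp p (diag_uptri (introT is_diag_mxP d1)).
apply/matrixP => k l; have [<-|kl] := eqVneq k l; last by rewrite dp ?d1.
rewrite de cartan_diffK !mxE; apply: (prime_field_pow hp).
by apply: (in_prime_fieldB hp); exact: in_prime_field_nat.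
Qed.

Lemma b_char_gl_weight (y : subvs_of b) :
  b_char lam y = \sum_i vsval y i i * gl_weight i.
Proof.
have -> : \sum_i vsval y i i * gl_weight i = lam (\sum_i vsval y i i *: cartan_diff i).
  by rewrite raddf_sum /=; apply: eq_bigr => i _; rewrite linearZ.
rewrite /b_char; congr (lam _); apply: val_inj; rewrite /= diag_partK raddf_sum /=.
under [RHS]eq_bigr => i _ do rewrite cartan_diffK scalerBr.
rewrite sumrB -scaler_suml diag_mx_sum_delta.
have := subvsP y; rewrite /= mem_b => /andP[/eqP tr0 _].
rewrite -[\sum_i vsval y i i]/(\tr (vsval y)) tr0 scale0r subr0.
by apply: eq_bigr => i _; rewrite mxE.
Qed.

Lemma slg_sum M : slg M = \sum_i \sum_j scal (M i j) * slg (delta_mx i j).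
Proof.
have slg0 : slg 0 = 0.
  by have := slg_linear o chi (-1) 0 0; rewrite scaleN1r addNr rmorphN1 mulN1r addNr.
have slgD N N' : slg (N + N') = slg N + slg N'.
  by have := slg_linear o chi 1 N N'; rewrite scale1r rmorph1 mul1r.
rewrite {1}[M]matrix_sum_delta (big_morph slg slgD slg0); apply: eq_bigr => i _.
rewrite (big_morph slg slgD slg0); apply: eq_bigr => j _.
by have := slg_linear o chi (M i j) (delta_mx i j) 0; rewrite addr0 slg0 addr0.
Qed.

Lemma incl_slp (y : subvs_of b) : incl (sl n hp) y = slp hp o (vsval y).
Proof. by rewrite -(inclK (borel_sub_sl n hp) y) slp_val. Qed.

Lemma borel_act_hw (W : lmodType A) (w : W) :
    (forall i j : 'I_n, (i < j)%N -> slg (delta_mx i j) *: w = 0) ->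
    (forall i, slg (delta_mx i i) *: w = scal (gl_weight i) *: w) ->
  forall y, gen (incl (sl n hp) y) *: w = scal (b_char lam y) *: w.
Proof.
move=> Hu Hd y; rewrite incl_slp -[gen _]/(slg (vsval y)) slg_sum scaler_suml.
rewrite b_char_gl_weight rmorph_sum scaler_suml; apply: eq_bigr => i _.
rewrite (bigD1 i) //= scalerDl -scalerA Hd scalerA -rmorphM scaler_suml.
rewrite big1 ?addr0 // => j ji; rewrite -scalerA; case: (ltngtP i j) => [ij|ij|/val_inj ij].
- by rewrite Hu // scaler0.
- have := subvsP y; rewrite /= mem_b => /andP[_ /is_trig_mxP/(_ j i ij)].
  by rewrite mxE => ->; rewrite rmorph0 scale0r.
- by rewrite ij eqxx in ji.
Qed.

Lemma slg_verma_upper (i j : 'I_n) : (i < j)%N -> slg (delta_mx i j) *: verma_gen = 0.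
Proof.
move=> ij; have bij : delta_mx i j \in rl_space b.
  rewrite /= mem_b mxtrace_delta (_ : (i == j) = false) ?eqxx /=; last first.
    by apply/eqP => E; move: ij; rewrite E ltnn.
  apply/is_trig_mxP => k l kl; rewrite !mxE; case: eqP => //= li; case: eqP => //= kj.
  by move: kl; rewrite li kj ltnNge ltnW.
have := verma_gen_borel (Subvs bij); rewrite incl_slp /= => ->.
rewrite b_char_gl_weight big1 ?rmorph0 ?scale0r // => k _ /=.
rewrite mxE; case: eqP => [->|]; rewrite ?mul0r //; case: eqP => [E|]; rewrite ?mul0r //.
by move: ij; rewrite E ltnn.
Qed.

Lemma slg_verma_diag (i : 'I_n) :
  slg (delta_mx i i) *: verma_gen = scal (gl_weight i) *: verma_gen.
Proof.
have bi : delta_mx i i - delta_mx o o \in rl_space b.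
  have := subvsP (cartan_diff i); rewrite cartan_diffK; apply: subvP; exact: h_sub_b.
have := verma_gen_borel (Subvs bi); rewrite incl_slp /=.
have -> : slp hp o (delta_mx i i - delta_mx o o) = slp hp o (delta_mx i i).
  apply: val_inj; rewrite /= !slpK raddfB /= !mxtrace_delta !eqxx subrr scale0r subr0.
  by rewrite scale1r.
move=> ->; congr (scal _ *: _); rewrite /b_char /gl_weight; congr (lam _).
apply: val_inj; rewrite /= cartan_diffK diag_partK /=.
apply/matrixP => k l; rewrite !mxE; have [<-|kl] := eqVneq k l; first by rewrite mulr1n.
rewrite mulr0n; have /is_diag_mxP/(_ k l kl) := delta_diag i.
by have /is_diag_mxP/(_ k l kl) := delta_diag o; rewrite !mxE => -> ->; rewrite subrr.
Qed.

Lemma hw_verma (D : Z -> Z) (D_zmod : zmod_morphism D)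
    (D_scale : forall u z, D (u *: z) = der u *: z + u *: D z) :
    D verma_gen = 0 ->
  hw (gl_E (Z := Z) D_zmod D_scale) gl_weight verma_gen.
Proof.
move=> D0; split=> [i|i j ij].
  rewrite [LHS]/(sl_act _ _ _ _) /= /sl_act /gl_act D0 scaler0 addr0.
  exact: slg_verma_diag.
rewrite [LHS]/(sl_act _ _ _ _) /= /sl_act /gl_act D0 scaler0 addr0.
exact: slg_verma_upper.
Qed.

Lemma generates_verma (D : Z -> Z) (D_zmod : zmod_morphism D)
    (D_scale : forall u z, D (u *: z) = der u *: z + u *: D z) :
  generates (gl_E (Z := Z) D_zmod D_scale) verma_gen.
Proof.
move=> P sP Pv z; have PU := stable_Uchi sP; have sP1 := sP.1.
elim/verma_ind: z => [|x y Px Py|u]; first by case: sP1.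
- exact: (subspaceB sP1 Px Py).
- exact: PU.
Qed.

Lemma hw_verma_gen (W : lmodType A) (w : W) :
    (forall i j : 'I_n, (i < j)%N -> slg (delta_mx i j) *: w = 0) ->
    (forall i, slg (delta_mx i i) *: w = scal (gl_weight i) *: w) ->
  exists T : {linear Z -> W}, T verma_gen = w.
Proof. by move=> Hu Hd; apply: verma_universal; apply: borel_act_hw. Qed.

End BabyVermaModule.

(** By the universal property there is a homomorphism that sends the generator to the nonzero vector
    F of [weyl_hw_exists], whose parameters are adapted to lambda. *)
Lemma verma_gen_neq0 (K : fieldType) (p : nat) (hp : p \in [pchar K]) (n : nat)
    (o : 'I_n) (chi : 'Hom(subvs_of (sl n hp), K^o)) (chiP : regular_nilpotent chi)
    (lam : 'Hom(subvs_of (cartan n hp), K^o)) (lamP : restricted_weight lam) :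
  o = 0%N :> nat -> verma_gen chiP lamP != 0.
Proof.
case: n o chi chiP lam lamP => [[]//|n] o chi chiP lam lamP o0.
(* F has E_ii-eigenvalue c_i - (n-i) for i > 0 and - n for i = 0. Subtracting the latter must give
   the weight of the generator, which is solved for c_i. *)
pose d (i : nat) := gl_weight o lam (inord i) - (- (n - i)%:R) - n%:R.
have Fd i : in_prime_field (d i).
  apply: (in_prime_fieldB hp); last exact: in_prime_field_nat.
  apply: (in_prime_fieldB hp); first exact: gl_weight_prime_field.
  exact/(in_prime_fieldN hp)/in_prime_field_nat.
have /choice[c cP] i : exists m, (m < p)%N /\ d i = m%:R.
  by have [m] := prime_fieldP hp (Fd i); exists m.
have hc i := (cP i).1; have dc i := (cP i).2.
have [S [phi [h [F [phiC hL hB hP [F0 Fu Fd']]]]]] := weyl_hw_exists n hp hc.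
pose g (x : subvs_of (sl n.+1 hp)) := h (vsval x).
have gC : Uchi_compatible chi phi g.
  split=> [k x|k x y|x y|x].
  - exact: phiC.
  - by rewrite /g linearP /= hL.
  - exact: hB.
  - by rewrite /g hP (chi_formula o chiP).
pose W := restrict_scalars S^o (Uchi_lift gC).
have actE (u : Uchi chi) (w : W) : u *: w = Uchi_lift gC u * (w : S) :> S by [].
have slE i j : Uchi_lift gC (slg o chi (delta_mx i j)) =
    h (delta_mx i j) - phi (i == j)%:R * h (delta_mx o o).
  rewrite /slg Uchi_lift_gen /g slpK mxtrace_delta -scaleNr addrC hL rmorphN mulNr.
  by rewrite addrC.
have [T TE] : exists T : {linear baby_verma (regular_nilpotent_b0 chiP) lamP -> W},
    T (verma_gen chiP lamP) = (F : W).
  apply: (hw_verma_gen (o := o)) => [i j ij|i]; rewrite actE slE.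
    rewrite (_ : (i == j) = false) ?rmorph0 ?mul0r ?subr0 ?Fu //.
    by apply/eqP => E; move: ij; rewrite E ltnn.
  rewrite eqxx rmorph1 mul1r mulrBl !Fd' o0 ltnn actE Uchi_lift_scal.
  rewrite -mulrBl -rmorphB; congr (phi _ * _).
  have [i0|i0] := posnP i.
    have -> : i = o by apply: val_inj; rewrite /= i0 o0.
    by rewrite gl_weight_o o0 subrr.
  rewrite -dc /d inord_val subn0; ring.
by apply: contra F0 => /eqP v0; rewrite -TE v0 raddf0.
Qed.

(** * The filtration by powers of the derivation *)

Section ModuleGeneralities.
Variable A : pzRingType.

Definition linear_pred (V : lmodType A) (P : V -> Prop) :=
  P 0 /\ forall a x y, P x -> P y -> P (a *: x + y).

Fact submodule_of_closed (V : lmodType A) (P : V -> Prop) :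
  linear_pred P -> submod_closed (fun x => `[< P x >]).
Proof.
by move=> [P0 PL]; split=> [|a x y /asboolP Px /asboolP Py]; apply/asboolP => //; apply: PL.
Qed.
Definition submodule_of (V : lmodType A) (P : V -> Prop) (hP : linear_pred P) :=
  Submodule (submodule_of_closed hP).

Lemma submodule_ofP (V : lmodType A) (P : V -> Prop) (hP : linear_pred P) x :
  reflect (P x) (x \in submodule_of hP).
Proof. exact: asboolP. Qed.

Lemma isomorphic_sym (V W : lmodType A) : isomorphic V W -> isomorphic W V.
Proof.
move=> [f [g fK gK]].
have gL : linear g by move=> a x y; apply: (can_inj fK); rewrite linearP !gK.
pose gm := GRing.isLinear.Build A W V _ g gL.
by exists (HB.pack_for {linear W -> V} g gm); exists f.
Qed.

Lemma isomorphic_trans (U V W : lmodType A) :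
  isomorphic U V -> isomorphic V W -> isomorphic U W.
Proof.
move=> [f bf] [g bg].
have gL : linear (g \o f) by move=> a x y; rewrite /= !linearP.
pose gm := GRing.isLinear.Build A U W _ (g \o f) gL.
by exists (HB.pack_for {linear U -> W} (g \o f) gm); exact: (bij_comp bg bf).
Qed.

Lemma simple_dichotomy (V : lmodType A) (P : V -> Prop) : simple V -> linear_pred P ->
  (forall v, P v -> v = 0) \/ (forall v, P v).
Proof.
move=> [_ sV] hP; case: (sV (submodule_of hP)) => H.
  by left=> v Pv; apply/H/submodule_ofP.
by right=> v; apply/(submodule_ofP hP)/H.
Qed.

(* A variant of Schur's lemma, with a linear relation instead of a map. *)
Lemma simple_rel_iso (V W : lmodType A) (R : V -> W -> Prop) v0 w0 :
    simple V -> simple W -> R 0 0 ->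
    (forall a v w v' w', R v w -> R v' w' -> R (a *: v + v') (a *: w + w')) ->
    (forall v, R v 0 -> v = 0) -> v0 != 0 -> R v0 w0 ->
  isomorphic V W.
Proof.
move=> sV sW R0 RL Rv v00 R00.
have RB v w v' w' : R v w -> R v' w' -> R (v - v') (w - w').
  by move=> r r'; have := RL (-1) _ _ _ _ r' r; rewrite !scaleN1r ![- _ + _]addrC.
have Rdom v : exists w, R v w.
  have hP : linear_pred (fun v => exists w, R v w).
    by split=> [|a x y [w rw] [w' rw']]; [exists 0 | exists (a *: w + w'); exact: RL].
  case: (simple_dichotomy sV hP) => // /(_ v0 (ex_intro _ _ R00)) E.
  by rewrite E eqxx in v00.
have Rcod w : exists v, R v w.
  have hP : linear_pred (fun w => exists v, R v w).
    by split=> [|a x y [v rv] [v' rv']]; [exists 0 | exists (a *: v + v'); exact: RL].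
  case: (simple_dichotomy sW hP) => // /(_ w0 (ex_intro _ _ R00)) E.
  by rewrite E in R00; rewrite (Rv _ R00) eqxx in v00.
have Rker w : R 0 w -> w = 0.
  have hP : linear_pred (fun w => R 0 w).
    by split=> // a x y r r'; have := RL a _ _ _ _ r r'; rewrite scaler0 addr0.
  case: (simple_dichotomy sW hP) => [H|H]; first exact: H.
  have := RB _ _ _ _ R00 (H w0); rewrite subr0 subrr => /Rv E.
  by rewrite E eqxx in v00.
have [f fR] := choice Rdom; have [g gR] := choice Rcod.
have fE v w : R v w -> w = f v.
  by move=> r; apply/eqP; rewrite -subr_eq0; apply/eqP/Rker; rewrite -(subrr v); exact: RB.
have gE v w : R v w -> v = g w.
  by move=> r; apply/eqP; rewrite -subr_eq0; apply/eqP/Rv; rewrite -(subrr w); exact: RB.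
have fL : linear f by move=> a x y; apply/esym/fE/RL.
pose fm := GRing.isLinear.Build A V W _ f fL.
exists (HB.pack_for {linear V -> W} f fm); exists g => [v|w] /=.
  exact/esym/gE.
exact/esym/fE.
Qed.

End ModuleGeneralities.

Section DerivationFiltration.
Variables (A : pzRingType) (Z : lmodType A) (der : A -> A) (D : Z -> Z).
Hypotheses (D_zmod : zmod_morphism D)
  (D_scale : forall u z, D (u *: z) = der u *: z + u *: D z).
Variables (S : submodule Z).

HB.instance Definition _ := GRing.isZmodMorphism.Build Z Z D D_zmod.

Let iterD0 j : iter j D 0 = 0.
Proof. by elim: j => //= j ->; rewrite raddf0. Qed.
Let iterDB j x y : iter j D (x - y) = iter j D x - iter j D y.
Proof. by elim: j => //= j ->; rewrite raddfB. Qed.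

(** Membership in S + D S + ... + D^(j-1) S, with the highest power of D split off, which is where
    the inductions start. *)
Fixpoint derived (j : nat) (z : Z) : Prop :=
  if j is i.+1 then exists2 s, s \in S & derived i (z - iter i D s) else z = 0.

Lemma derived0 j : derived j 0.
Proof. by elim: j => //= j IHj; exists 0; rewrite ?rpred0 // iterD0 subr0. Qed.

Lemma derivedB j x y : derived j x -> derived j y -> derived j (x - y).
Proof.
elim: j x y => [|j IHj] x y /=; first by move=> -> ->; rewrite subrr.
move=> [s Ss Mx] [t St My]; exists (s - t); first by rewrite rpredB.
have -> : x - y - iter j D (s - t) = x - iter j D s - (y - iter j D t).
  by rewrite iterDB; zmod_solve.
exact: IHj.
Qed.

Lemma derivedN j x : derived j x -> derived j (- x).
Proof. by move=> Mx; rewrite -sub0r; apply: derivedB => //; exact: derived0. Qed.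

Lemma derivedD j x y : derived j x -> derived j y -> derived j (x + y).
Proof. by move=> Mx My; rewrite -[y]opprK; apply/derivedB/derivedN. Qed.

Lemma derivedMn j x m : derived j x -> derived j (x *+ m).
Proof.
move=> Mx; elim: m => [|m IHm]; first by rewrite mulr0n; exact: derived0.
by rewrite mulrS; exact: derivedD.
Qed.

Lemma derivedS j z : derived j z -> derived j.+1 z.
Proof. by move=> Mz; exists 0; rewrite ?rpred0 // iterD0 subr0. Qed.

Lemma derived_le i j z : (i <= j)%N -> derived i z -> derived j z.
Proof.
move=> ij; rewrite -(subnKC ij); elim: (j - i)%N => [|d IHd]; rewrite ?addn0 // addnS.
by move=> Mz; exact/derivedS/IHd.
Qed.

Lemma derived_D j z : derived j z -> derived j.+1 (D z).
Proof.
elim: j z => [|j IHj] z.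
  by move=> z0; rewrite (z0 : z = 0) raddf0; exact: (derived0 1).
by move=> [s Ss Mz]; exists s => //; have := IHj _ Mz; rewrite raddfB.
Qed.

Lemma derived_iter j s : s \in S -> derived j.+1 (iter j D s).
Proof. by move=> Ss; exists s; rewrite // subrr; exact: derived0. Qed.

(** By the Leibniz rule, moving u past D^j costs only terms with fewer factors D. Thus the steps are
    submodules although D is not linear over the algebra. *)
Lemma derived_comm j u s : s \in S -> derived j (iter j D (u *: s) - u *: iter j D s).
Proof.
move=> Ss; elim: j u => [|j IHj] u; first exact: subrr.
have -> : iter j.+1 D (u *: s) - u *: iter j.+1 D s =
    D (iter j D (u *: s) - u *: iter j D s) + der u *: iter j D s.
  by rewrite raddfB /= D_scale; zmod_solve.
apply: derivedD; first exact/derived_D/IHj.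
exists (der u *: s); first by rewrite rpredZ.
by rewrite -opprB; exact/derivedN/IHj.
Qed.

Lemma derivedZ j u z : derived j z -> derived j (u *: z).
Proof.
elim: j z => [|j IHj] z; first by move=> /= ->; rewrite scaler0.
move=> [s Ss Mz]; exists (u *: s); first by rewrite rpredZ.
have -> : u *: z - iter j D (u *: s) =
    u *: (z - iter j D s) - (iter j D (u *: s) - u *: iter j D s).
  by rewrite scalerBr; zmod_solve.
by apply: derivedB; [exact: IHj|exact: derived_comm].
Qed.

Lemma derived_closed j : linear_pred (derived j).
Proof.
by split=> [|a x y Mx My]; [exact: derived0|apply: derivedD => //; exact: derivedZ].
Qed.

Definition derived_sub j := submodule_of (derived_closed j).

Lemma derived_subP j z : reflect (derived j z) (z \in derived_sub j).
Proof. exact: submodule_ofP. Qed.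

(** The only new term D^p s equals D s, which lies in step 2; hence 1 < p. *)
Lemma derived_stable p z : (1 < p)%N -> (forall z, iter p D z = D z) ->
  derived p z -> derived p (D z).
Proof.
move=> p1 Dp /derived_D[s Ss]; rewrite Dp => Mz; rewrite -(subrK (D s) (D z)).
apply: derivedD => //; apply: (derived_le p1); exact: (derived_iter 1 Ss).
Qed.

Hypothesis S_simple : forall z s, z != 0 -> s \in S -> exists u, s = u *: z.
Hypothesis S_neq0 : exists2 s, s \in S & s != 0.

Lemma simple_sub : simple (sub_of S).
Proof.
have [s Ss s0] := S_neq0; split=> [|T].
  by exists (SubOf Ss); apply: contra s0 => /eqP/(congr1 (@sub_val _ _ S))/=->.
have [[v vT v0]|H] := pselect (exists2 v, v \in T & v != 0); last first.
  by left=> v vT; apply/eqP; apply: contraPT vT => v0 vT; apply: H; exists v.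
right=> w; have v0' : sub_val v != 0.
  by apply: contra v0 => /eqP E; apply/eqP/val_inj; rewrite /= E.
have [u uE] := S_simple v0' (sub_valP w).
have -> : w = u *: v by apply: val_inj.
by rewrite rpredZ.
Qed.

(* [Q z a] means that [a] is the class of [z]. *)
Lemma simple_subquotient p (A0 : lmodType A) (Q : Z -> A0 -> Prop) :
    (forall z, derived p z) -> simple A0 -> Q 0 0 ->
    (forall u z a z' a', Q z a -> Q z' a' -> Q (u *: z + z') (u *: a + a')) ->
    (forall a, Q 0 a -> a = 0) -> (forall a, exists z, Q z a) ->
  isomorphic A0 (sub_of S).
Proof.
move=> full sA Q0 QL Q0a Qex.
(* i + 1 is the first step whose classes in A0 are not all zero. *)
have [i [Hi1 [z [a [Mz Qz a0]]]]] : exists i, (forall z a, derived i z -> Q z a -> a = 0)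
    /\ exists z a, [/\ derived i.+1 z, Q z a & a != 0].
  have [[a a0] _] := sA; have [z Qz] := Qex a; move: (full z).
  elim: p {full} => [|i IHi] in z a a0 Qz *.
    by move=> z0; move: Qz; rewrite (z0 : z = 0) => /Q0a E; rewrite E eqxx in a0.
  move=> Mz; have [[y [b [My Qy b0]]]|H] := pselect (exists y b, [/\ derived i y, Q y b & b != 0]).
    exact: (IHi y b b0 Qy My).
  exists i; split; last by exists z, a.
  by move=> y b My Qy; apply/eqP; apply: contraPT My => b0 My; apply: H; exists y, b.
(* a is related to s if some representative of a is congruent to D^i s modulo step i. By the choice
   of i, only a = 0 is related to s = 0. *)
pose R (a : A0) (s : sub_of S) := exists y, Q y a /\ derived i (y - iter i D (sub_val s)).
have [s Ss Ms] := Mz.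
apply: (@simple_rel_iso _ _ _ R a (SubOf Ss)) => //.
- exact: simple_sub.
- by exists 0; split=> //=; rewrite iterD0 subr0; exact: derived0.
- move=> u b t b' t' [y [Qy My]] [y' [Qy' My']]; exists (u *: y + y'); split; first exact: QL.
  set x := sub_val t in My; set x' := sub_val t' in My'.
  have -> : sub_val (u *: t + t') = u *: x + x' by [].
  have -> : u *: y + y' - iter i D (u *: x + x') = u *: (y - iter i D x) +
      ((y' - iter i D x') - (iter i D (u *: x) - u *: iter i D x)).
    have iterDD y1 y2 : iter i D (y1 + y2) = iter i D y1 + iter i D y2.
      by rewrite -{1}[y2]opprK iterDB -sub0r iterDB iterD0 sub0r opprK.
    by rewrite iterDD scalerBr; zmod_solve.
  apply: derivedD; first exact: derivedZ.
  by apply: derivedB => //; apply: derived_comm; exact: sub_valP.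
- move=> b [y [Qy]]; rewrite iterD0 subr0 => My; exact: Hi1 My Qy.
- by exists z.
Qed.

Lemma factor_iso p (T T' : submodule Z) : (forall z, derived p z) ->
  simple (factor T T') -> isomorphic (factor T T') (sub_of S).
Proof.
move=> full sF; pose U := sub_inter T T'.
apply: (simple_subquotient (Q := fun z a => exists t : sub_of T', sub_val t = z /\ quo_pi U t = a)
  full sF).
- by exists 0; rewrite raddf0.
- move=> u z a z' a' [t [<- <-]] [t' [<- <-]]; exists (u *: t + t').
  by rewrite linearP.
- move=> a [t [t0 <-]]; have -> : t = 0 by apply: val_inj.
  exact: raddf0.
- by move=> a; exists (sub_val (repr a)), (repr a); split=> //; exact: quo_piK.
Qed.

Lemma quo_iso p (N : submodule Z) : (forall z, derived p z) ->
  simple (quo_by N) -> isomorphic (quo_by N) (sub_of S).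
Proof.
move=> full sN; apply: (simple_subquotient (Q := fun z a => quo_pi N z = a) full sN).
- exact: raddf0.
- by move=> u z a z' a' <- <-; rewrite linearP.
- by move=> a <-; exact: raddf0.
- by move=> a; exists (repr a); exact: quo_piK.
Qed.

Section Nontrivial.
Variables (p : nat) (T : {linear Z -> Z}).
Hypotheses (full : forall z, derived p z)
  (p_inv : forall m, (0 < m < p)%N -> exists a : A, forall z : Z, a *: (z *+ m) = z)
  (T_S : forall s, s \in S -> T s = s) (T_D : forall z, T (D z) = D (T z) - T z).

(** As T D = (D - 1) T and T fixes s, T sends D^(j+1) s to (D - 1)^(j+1) s, whose expansion starts
    with D^(j+1) s - (j+1) D^j s. *)
Lemma derived_shift j s : s \in S ->
  derived j (T (iter j.+1 D s) - iter j.+1 D s + iter j D s *+ j.+1).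
Proof.
move=> Ss; elim: j => [|j IHj].
  by rewrite /= T_D T_S // mulr1n; zmod_solve.
have -> : T (iter j.+2 D s) - iter j.+2 D s + iter j.+1 D s *+ j.+2 =
   D (T (iter j.+1 D s) - iter j.+1 D s + iter j D s *+ j.+1)
   - (T (iter j.+1 D s) - iter j.+1 D s + iter j D s *+ j.+1) + iter j D s *+ j.+1.
  rewrite [iter j.+2 D s]iterS T_D raddfD /= raddfB /= raddfMn /= [_ *+ j.+2]mulrS.
  by zmod_solve.
apply: derivedD; last first.
  exact/derivedMn/derived_iter.
by apply: derivedB; [exact: derived_D|exact: derivedS].
Qed.

Lemma derived_nilp j z : derived j.+1 z -> derived j (T z - z).
Proof.
elim: j z => [|j IHj] z [s Ss Mz].
  have -> : z = s by apply/eqP; rewrite -subr_eq0; apply/eqP.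
  by rewrite T_S // subrr.
have := IHj _ Mz; set t := iter _ _ _ => Mt.
have -> : T z - z = (T (z - t) - (z - t)) + ((T t - t + iter j D s *+ j.+1) - iter j D s *+ j.+1).
  by rewrite raddfB; zmod_solve.
apply: derivedD; first exact: derivedS.
apply: derivedB; first by apply: derivedS; exact: derived_shift.
exact/derivedMn/derived_iter.
Qed.

(** If D^(i+1) s is in step i + 1, then T - 1 maps it into step i. But its image is - (i+1) D^i s
    modulo step i, and i + 1 < p is invertible, so D^i s is in step i as well. *)
Lemma derived_strict i s : (i < p)%N -> s \in S -> derived i (iter i D s) -> s = 0.
Proof.
elim: i => [|i IHi] ip Ss //= Ms; apply: IHi => //; first exact: ltnW.
have [a aK] := p_inv (m := i.+1) ip; rewrite -[iter i D s]aK; apply: derivedZ.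
have := derivedB (derived_shift i Ss) (derived_nilp Ms).
by congr (derived _ _); zmod_solve.
Qed.

Lemma derived_simple i : (i < p)%N -> simple (factor (derived_sub i) (derived_sub i.+1)).
Proof.
move=> ip; pose U := sub_inter (derived_sub i) (derived_sub i.+1).
have UP t : reflect (derived i (sub_val t)) (t \in U).
  by rewrite inE; exact: derived_subP.
have piE t : (quo_pi U t == 0) = (t \in U).
  rewrite -(raddf0 (quo_pi U)); apply/eqP/idP => [/quo_piP|tU]; first by rewrite subr0.
  by apply/quo_piP; rewrite subr0.
have inM s (Ss : s \in S) : iter i D s \in derived_sub i.+1.
  exact/derived_subP/derived_iter.
split.
  have [s Ss s0] := S_neq0; exists (quo_pi U (SubOf (inM s Ss))).
  rewrite piE; apply: contra s0 => /UP Ms; apply/eqP; exact: derived_strict Ms.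
move=> V; have [[x xV x0]|H] := pselect (exists2 x, x \in V & x != 0); last first.
  by left=> x xV; apply/eqP; apply: contraPT xV => x0 xV; apply: H; exists x.
right=> y; rewrite -(quo_piK x) in xV x0; rewrite -(quo_piK y).
set t := repr x in xV x0 *; set t' := repr y.
have /derived_subP[s Ss Ms] := sub_valP t; have /derived_subP[s' Ss' Ms'] := sub_valP t'.
have s0 : s != 0.
  by apply: contra x0 => /eqP s0; rewrite piE; apply/UP; rewrite s0 iterD0 subr0 in Ms.
have [u uE] := S_simple s0 Ss'.
have -> : quo_pi U t' = u *: quo_pi U t.
  rewrite -linearZ /=; apply/quo_piP/UP.
  have -> : sub_val (t' - u *: t) = sub_val t' - u *: sub_val t by [].
  move: Ms Ms'; rewrite uE; move: (sub_val t) (sub_val t') => z z' Ms Ms'.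
  have -> : z' - u *: z = (z' - iter i D (u *: s)) - u *: (z - iter i D s) +
      (iter i D (u *: s) - u *: iter i D s).
    by rewrite scalerBr; zmod_solve.
  apply: derivedD; last exact: derived_comm.
  by apply: derivedB => //; exact: derivedZ.
by rewrite rpredZ.
Qed.

Lemma derived_composition_series : composition_series p derived_sub.
Proof.
split=> [v|v|i ip].
- by apply/derived_subP/eqP.
- exact/derived_subP.
- split; last exact: derived_simple.
  by move=> z /derived_subP Mz; apply/derived_subP/derivedS.
Qed.

Lemma derived_reducible : (1 < p)%N -> reducible Z.
Proof.
move=> p1; exists S; have [s Ss s0] := S_neq0; split; first by exists s.
exists (D s); apply: contra s0 => SDs; apply/eqP/(derived_strict p1 Ss).
by exists (D s); rewrite ?subrr.
Qed.

End Nontrivial.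
End DerivationFiltration.

(** * Modules with a unique maximal submodule *)

Section UniqueMaximal.
Variables (A : pzRingType) (Z : lmodType A) (N : submodule Z).
Hypothesis NP : forall z, z \notin N -> forall y, exists u, y = u *: z.
Hypothesis N_proper : exists v, v \notin N.

Lemma unique_maximal_intro : unique_maximal N.
Proof.
have sub (S : submodule Z) z : z \in S -> z \notin N -> forall y, y \in S.
  by move=> Sz Nz y; have [u ->] := NP Nz y; rewrite rpredZ.
split.
  split=> // S NS; have [[z Sz Nz]|H] := pselect (exists2 z, z \in S & z \notin N).
    by right; exact: sub Sz Nz.
  left=> z; apply/idP/idP => [Sz|/NS//].
  by apply: contraPT Sz => Nz Sz; apply: H; exists z.
move=> N' [[v N'v] maxN'].
have N'N : {subset N' <= N}.
  move=> z N'z; apply: contraT => Nz; have := sub _ _ N'z Nz v.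
  by rewrite (negbTE N'v).
have [w Nw] := N_proper; case: (maxN' N N'N) => [E z|/(_ w)]; first by rewrite E.
by rewrite (negbTE Nw).
Qed.

Lemma simple_quo : simple (quo_by N).
Proof.
have piE z : (quo_pi N z == 0) = (z \in N).
  rewrite -(raddf0 (quo_pi N)); apply/eqP/idP => [/quo_piP|Nz]; first by rewrite subr0.
  by apply/quo_piP; rewrite subr0.
split; first by have [v Nv] := N_proper; exists (quo_pi N v); rewrite piE.
move=> V; have [[x xV x0]|H] := pselect (exists2 x, x \in V & x != 0); last first.
  by left=> x xV; apply/eqP; apply: contraPT xV => x0 xV; apply: H; exists x.
right=> y; rewrite -(quo_piK x) piE in x0; have [u uE] := NP x0 (repr y).
by rewrite -(quo_piK y) uE linearZ /= quo_piK rpredZ.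
Qed.

End UniqueMaximal.

(** * Eigenvectors with nonzero eigenvalue in the prime field *)

Section PrimeFieldEigenvector.
Variables (K : fieldType) (V : lmodType K) (f : {linear V -> V}).

Lemma pactMX q z : pact f (q * 'X) z = pact f q (f z).
Proof.
have [->|q0] := eqVneq q 0; first by rewrite mul0r !(@pactE _ _ _ 0) ?size_poly0 // !big_ord0.
rewrite /pact size_mulX // big_ord_recl coefMX /= scale0r add0r.
by apply: eq_bigr => i _; rewrite coefMX /= -iterSr.
Qed.

(** The product of the f - m for 0 < m < p kills f z. When its factors are applied one by one, the
    last nonzero vector is an eigenvector. Starting from f z instead of z disposes of the eigenvalue
    0. *)
Lemma prime_field_eigenvector p (P : V -> Prop) z : p \in [pchar K] ->
    subspace P -> (forall y, P y -> P (f y)) -> P z -> f z != 0 -> iter p f z = f z ->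
  exists c y, [/\ in_prime_field c, c != 0, P y, y != 0 & f y = c *: y].
Proof.
move=> hp sP Pf Pz fz0 fp; pose l := iota 1 p.-1.
have p_gt0 : (0 < p)%N by rewrite prime_gt0 ?(pcharf_prime hp).
have : pact f (\prod_(m <- l) ('X - (m%:R)%:P)) (f z) = 0.
  rewrite -pactMX mulrC -[X in X * _]subr0 -(big_cons _ _ 0%N (iota 1 p.-1) xpredT).
  rewrite -[0%N :: l]/(iota 0 p.-1.+1) prednK // -(prod_prime_field hp).
  by rewrite pactB pactXn -['X]mulr1 pactXM (pactC f 1) scale1r fp subrr.
have : {subset l <= [pred m | (0 < m < p)%N]}.
  by move=> m; rewrite mem_iota inE; lia.
rewrite pact_prod; elim: l => [|m l IHl] lp /= E0; first by rewrite E0 eqxx in fz0.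
set y := foldr _ _ l in E0; have [y0|y0] := eqVneq y 0.
  by apply: IHl => // k kl; apply: lp; rewrite inE kl orbT.
have /andP[m0 mp] : (0 < m < p)%N by apply: lp; rewrite mem_head.
exists m%:R, y; split=> //; first exact: in_prime_field_nat.
- by rewrite -(dvdn_pcharf hp) gtnNdvd.
- rewrite /y; elim: {IHl lp E0 y y0} l => /= [|k l IHl]; first exact: Pf.
  by apply: (subspaceB sP); [exact: Pf|exact: subspaceZ].
- by apply/eqP; rewrite -subr_eq0 E0.
Qed.

End PrimeFieldEigenvector.

Section SlHighestWeight.
Variables (K : fieldType) (p : nat) (n : nat) (V : lmodType K).
Variable E : 'I_n -> 'I_n -> {linear V -> V}.
Hypotheses (hp : p \in [pchar K]) (rep : gl_rep p E).
Variables (o : 'I_n) (nu : 'I_n -> K).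

(* Highest weight vectors for sl_n: only the differences of the diagonal weights
   are prescribed. *)
Definition sl_hw (z : V) := (forall i, E i i z = E o o z + nu i *: z) /\
  (forall i j : 'I_n, (i < j)%N -> E i j z = 0).

Lemma sl_hw_subspace : subspace sl_hw.
Proof.
split; first by split=> [i|i j _]; rewrite !raddf0 ?scaler0 ?addr0.
move=> c y z [yd yu] [zd zu]; split=> [i|i j ij]; last by rewrite linearP /= yu ?zu // scaler0 addr0.
rewrite !linearP /= yd zd !scalerDr !scalerA; zmod_solve.
Qed.

Lemma sl_hw_diag z : sl_hw z -> sl_hw (E o o z).
Proof.
move=> [zd zu]; split=> [i|i j ij].
  rewrite (gl_bracket rep) zd linearD linearZ_LR /= [i == o]eq_sym.
  by case: eqP => [->|_]; rewrite ?mulr0n ?subr0 ?addr0 //; zmod_solve.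
rewrite (gl_bracket rep) zu // raddf0 add0r.
have -> : E i o z *+ (j == o) = 0.
  by case: eqP => [jo|_]; rewrite ?mulr0n // mulr1n zu // -jo.
have -> : E o j z *+ (o == i) = 0; last by rewrite subr0.
by case: eqP => [oi|_]; rewrite ?mulr0n // mulr1n zu // oi.
Qed.

Lemma hw_sl_hw c z : hw E (fun i => nu i + c) z -> nu o = 0 -> sl_hw z.
Proof.
move=> [zd zu] no; split=> [i|//]; by rewrite !zd no add0r scalerDl addrC.
Qed.

Lemma sl_hw_eigen mu v z : hw E mu v -> generates E v -> in_prime_field (mu o) ->
    sl_hw z -> E o o z != 0 ->
  exists c y, [/\ in_prime_field c, c != 0, y != 0 & hw E (fun i => nu i + c) y].
Proof.
move=> hv gv Fo zh Ez; have Dp := diag_pow hp rep hv gv Fo z.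
have [c [y [Fc c0 [yd yu] y0 ye]]] :=
  prime_field_eigenvector hp sl_hw_subspace sl_hw_diag zh Ez Dp.
by exists c, y; split=> //; split=> // i; rewrite yd ye scalerDl addrC.
Qed.

End SlHighestWeight.

(** * Socle and radical of a cyclic highest weight module *)

Section CyclicModule.
Variables (K : fieldType) (p : nat) (hp : p \in [pchar K]) (n : nat) (o : 'I_n).
Variables (chi : 'Hom(subvs_of (sl n hp), K^o)) (chiP : regular_nilpotent chi).
Let A := Uchi chi.
Notation gen := (Uchi_gen chi).
Notation scal := (Uchi_scal chi).
Notation slg := (slg o chi).
Notation der := (Uchi_der hp (@e_sl K p hp n o)).
Variables (Z : lmodType A) (D : Z -> Z).
Hypotheses (D_zmod : zmod_morphism D)
  (D_scale : forall u z, D (u *: z) = der u *: z + u *: D z).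
Let E := gl_E D_zmod D_scale.
Let Zk := restrict_scalars Z scal.
Let rep : gl_rep p E := gl_E_rep chiP D_zmod D_scale.
Variables (mu : 'I_n -> K) (v : Zk).
Hypotheses (hv : hw E mu v) (gv : generates E v) (v0 : v != 0) (mu_o : mu o = 0).
Hypothesis mu_prime : forall i, in_prime_field (mu i).

Lemma gl_EE i j (z : Z) : E i j z = slg (delta_mx i j) *: z + scal (i == j)%:R *: D z :> Z.
Proof. by rewrite [LHS]/(sl_act _ _ _ _) /= /sl_act /gl_act mxtrace_delta. Qed.

Lemma gl_E_offdiag i j (z : Z) : i != j -> E i j z = slg (delta_mx i j) *: z :> Z.
Proof. by move=> /negbTE ij; rewrite gl_EE ij rmorph0 scale0r addr0. Qed.

Lemma gl_E_oo (z : Z) : E o o z = D z :> Z. Proof. exact: sl_act_e. Qed.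

Lemma closed_subspace (P : Z -> Prop) : linear_pred P -> subspace (P : Zk -> Prop).
Proof. by move=> [P0 PL]; split=> // c y z; exact: PL. Qed.

Lemma closed_lower_stable (P : Z -> Prop) : linear_pred P -> lower_stable E P.
Proof.
move=> cP; have sP := closed_subspace cP; split=> // a z la Pz.
apply: (subspaceB sP); last exact: (subspaceZ _ sP).
rewrite gl_E_offdiag; last by apply/eqP => Ea; move: la; rewrite /lower Ea ltnn.
have [P0 PL] := cP; have := PL (slg (delta_mx a.1 a.2)) z 0 Pz P0.
by rewrite addr0.
Qed.

Lemma closed_stable (P : Z -> Prop) : linear_pred P -> (forall z, P z -> P (D z)) ->
  stable E P.
Proof.
move=> cP PD; split; first exact: closed_subspace.
have [P0 PL] := cP => i j z Pz; rewrite gl_EE; apply: (PL) => //.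
by rewrite -[X in P X]addr0; apply: (PL) => //; exact: PD.
Qed.

Lemma cyclic_closed (z : Z) : linear_pred (fun y => exists u : A, y = u *: z).
Proof.
split=> [|a x y [u ->] [u' ->]]; first by exists 0; rewrite scale0r.
by exists (a * u + u'); rewrite scalerDl scalerA.
Qed.

Definition socle : submodule Z := submodule_of (cyclic_closed (tau p E v)).

Lemma socle_simple (z s : Z) : z != 0 -> s \in socle -> exists u : A, s = u *: z.
Proof.
move=> z0 /submodule_ofP[u ->].
have Pz : exists u : A, z = u *: z by exists 1; rewrite scale1r.
have [u' E'] := lower_stable_tau hp rep hv gv v0
  (closed_lower_stable (cyclic_closed z)) Pz z0.
by exists (u * u'); rewrite -scalerA -E'.
Qed.

Lemma tau_socle : tau p E v \in socle.
Proof. by apply/(submodule_ofP (cyclic_closed _)); exists 1; rewrite scale1r. Qed.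

Let tv0 : tau p E v != 0 := tau_v_neq0 hp rep hv gv v0.

Lemma socle_neq0 : exists2 s : Z, s \in socle & s != 0.
Proof. exists (tau p E v); [exact: tau_socle|exact: tv0]. Qed.

Lemma radical_closed : linear_pred (fun z : Z => forall u : A, tau p E (u *: z) = 0).
Proof.
split=> [u|a x y Hx Hy u]; first by rewrite scaler0 raddf0.
by rewrite scalerDr scalerA raddfD /= Hx Hy addr0.
Qed.

Definition radical : submodule Z := submodule_of radical_closed.

Lemma radical_gen (z : Z) : z \notin radical -> forall y, exists u : A, y = u *: z.
Proof.
move=> /submodule_ofP/existsNP[u /eqP tu].
have Pz : exists u' : A, u *: z = u' *: z by exists u.
exact: (tau_neq0_full hp rep hv gv v0 (closed_lower_stable (cyclic_closed z)) Pz tu).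
Qed.

Lemma radical_proper : exists z : Z, z \notin radical.
Proof.
exists v; apply/submodule_ofP => /(_ 1); rewrite scale1r; exact/eqP/tv0.
Qed.

Let p_gt1 : (1 < p)%N := p_gt1 hp.

Let Dp (z : Z) : iter p D z = D z.
Proof.
have iterE k : iter k D z = iter k (E o o) z :> Z.
  by elim: k => // k IHk; rewrite !iterS IHk gl_E_oo.
by rewrite iterE -gl_E_oo; exact: (diag_pow hp rep hv gv (mu_prime o)).
Qed.

Lemma derived_socle_full (z : Z) : derived D socle p z.
Proof.
have sP : stable E (derived D socle p).
  apply: closed_stable; first exact: (derived_closed D_zmod D_scale).
  by move=> y; apply: (derived_stable D_zmod p_gt1 Dp).
apply: (stable_full hp rep hv gv v0 sP (z := tau p E v)) => //.
apply: (derived_le D_zmod (ltnW p_gt1)).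
exact: (derived_iter D_zmod 0 tau_socle).
Qed.

Lemma factor_iso_quo (M M' : submodule Z) : simple (factor M M') ->
  isomorphic (factor M M') (quo_by radical).
Proof.
move=> sF; apply: isomorphic_trans (isomorphic_sym _).
  exact: (factor_iso D_zmod D_scale socle_simple socle_neq0 derived_socle_full sF).
apply: (quo_iso D_zmod D_scale socle_simple socle_neq0 derived_socle_full).
exact: (simple_quo radical_gen radical_proper).
Qed.

Lemma radical_unique_maximal : unique_maximal radical.
Proof. exact: (unique_maximal_intro radical_gen radical_proper). Qed.

Lemma socle_full_simple : (forall z : Z, z \in socle) -> simple Z.
Proof.
move=> full; split; first by exists v.
move=> S; have [[x xS x0]|H] := pselect (exists2 x, x \in S & x != 0); last first.
  by left=> x xS; apply/eqP; apply: contraPT xS => x0 xS; apply: H; exists x.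
by right=> y; have [u ->] := socle_simple x0 (full y); rewrite rpredZ.
Qed.

Lemma sl_hwP (z : Z) : sl_hw E o mu z <->
  (forall i, slg (delta_mx i i) *: z = scal (mu i) *: z) /\
  (forall i j : 'I_n, (i < j)%N -> slg (delta_mx i j) *: z = 0).
Proof.
have diag i : (E i i z = E o o z + mu i *: (z : Zk)) <->
    slg (delta_mx i i) *: z = scal (mu i) *: z.
  rewrite gl_E_oo gl_EE eqxx rmorph1 scale1r addrC; split=> [/addrI//|H].
  by congr (_ + _).
have off (i j : 'I_n) : (i < j)%N -> E i j z = slg (delta_mx i j) *: z :> Z.
  by move=> ij; rewrite gl_E_offdiag //; apply/eqP => Eij; rewrite Eij ltnn in ij.
split=> -[Hd Hu]; split=> [i|i j ij].
- exact/diag/Hd.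
- by rewrite -off // Hu.
- exact/diag/Hd.
- by rewrite off // Hu.
Qed.

Lemma hw_shift (z : Z) c : hw E (fun i => mu i + c) z -> sl_hw E o mu z /\ D z = scal c *: z.
Proof.
move=> hz; split; first exact: hw_sl_hw hz mu_o.
by rewrite -gl_E_oo hz.1 mu_o add0r.
Qed.

(** The quotient by the radical is isomorphic to the socle, and the image of v there is a highest
    weight vector for sl_n. D cannot kill it: the submodule it generates would be D-stable, hence
    all of Z, and so would be the socle. So D has an eigenvector with nonzero eigenvalue among the
    sl_n highest weight vectors. *)
Lemma nonsimple_hw : ~ simple Z ->
  exists c (y : Zk), [/\ in_prime_field c, c != 0, y != 0 & hw E (fun i => mu i + c) y].
Proof.
move=> nsZ; have [x xS] : exists x, x \notin socle.
  apply: contrapT => H; apply/nsZ/socle_full_simple => z.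
  by apply: contraT => zS; case: H; exists z.
have sN := simple_quo radical_gen radical_proper.
have [f [g fK gK]] := quo_iso D_zmod D_scale socle_simple socle_neq0 derived_socle_full sN.
pose h (z : Z) : Z := sub_val (f (quo_pi radical z)).
have hZ (u : A) z : h (u *: z) = u *: h z by rewrite /h !linearZ.
have hv0 : h v != 0.
  apply/eqP => hv0.
  have pv : quo_pi radical v = 0.
    by apply: (can_inj fK); rewrite raddf0; exact: val_inj.
  have /quo_piP : quo_pi radical v = quo_pi radical 0 by rewrite pv raddf0.
  rewrite subr0 => /submodule_ofP/(_ 1); by rewrite scale1r => E0; move: tv0; rewrite E0 eqxx.
have hh : sl_hw E o mu (h v).
  have /sl_hwP[vd vu] : sl_hw E o mu v.
    by apply: (hw_sl_hw (c := 0)) => //; split=> [i|]; rewrite ?addr0; [exact: hv.1|exact: hv.2].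
  apply/sl_hwP; split=> [i|i j ij]; first by rewrite -hZ vd hZ.
  by rewrite -hZ vu // /h !raddf0.
have Dh : E o o (h v) != 0.
  apply: contra xS => /eqP Dh0; rewrite gl_E_oo in Dh0.
  have sP : stable E (fun y : Z => exists u : A, y = u *: h v).
    apply: closed_stable (cyclic_closed _) _ => y [u ->]; exists (der u).
    by rewrite D_scale Dh0 scaler0 addr0.
  have [|u ->] := stable_full hp rep hv gv v0 sP (z := h v) _ hv0 x.
    by exists 1; rewrite scale1r.
  by rewrite rpredZ // sub_valP.
exact: (sl_hw_eigen hp rep hv gv (mu_prime o) hh Dh).
Qed.

Lemma nonsimple_weights : ~ simple Z -> exists c,
  [/\ in_prime_field c, c != 0 & \prod_(i < n) ('X - (mu i - i%:R)%:P) =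
     \prod_(i < n) ('X - (mu i - i%:R + c)%:P)].
Proof.
move=> /nonsimple_hw[c [y [Fc c0 y0 hy]]]; exists c; split=> //.
have gy : generates E y by move=> P sP Py; exact: (stable_full hp rep hv gv v0 sP Py y0).
have := weight_poly_eq hp rep hv gv v0 hy gy; rewrite /weight_poly => ->.
by apply: eq_bigr => i _; rewrite addrAC.
Qed.

Hypothesis v_universal : forall z : Z, sl_hw E o mu z -> exists T : {linear Z -> Z}, T v = z.

Lemma hw_reducible (y : Zk) : hw E (fun i => mu i + 1) y -> y != 0 ->
  reducible Z /\ exists M : nat -> submodule Z, composition_series p M.
Proof.
move=> hy y0; have [hs Dy] := hw_shift hy; rewrite rmorph1 scale1r in Dy.
have Dv : D v = 0 by rewrite -gl_E_oo hv.1 mu_o scale0r.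
have [T Tv] := v_universal hs.
have v_ind (P : Z -> Prop) : linear_pred P -> (forall z, P z -> P (D z)) -> P v -> forall z, P z.
  by move=> cP PD; exact: (gv (closed_stable cP PD)).
have v_span (z : Z) : exists u : A, z = u *: v.
  apply: (v_ind (fun y => exists u : A, y = u *: v)); first exact: cyclic_closed.
    by move=> _ [u ->]; exists (der u); rewrite D_scale Dv scaler0 addr0.
  by exists 1; rewrite scale1r.
have T_D z : T (D z) = D (T z) - T z.
  have [u ->] := v_span z.
  by rewrite D_scale Dv scaler0 addr0 !linearZ /= Tv D_scale Dy scalerN addrK.
have D0 : D 0 = 0 by have := D_zmod 0 0; rewrite !subrr.
have TU (u : A) z : T (u *: z) = u *: T z by rewrite linearZ.
have shiftedT a (z : Z) : lower a -> shifted E a (T z) = T (shifted E a z) :> Z.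
  move=> la; have ne : a.1 != a.2 by apply/eqP => Ea; move: la; rewrite /lower Ea ltnn.
  by rewrite /shifted !gl_E_offdiag // !restrict_scaleE raddfB /= !TU.
have tauT (z : Z) : tau p E (T z) = T (tau p E z) :> Z.
  rewrite /tau /=; have := powers_lower p.-1 (roots_lower n).
  elim: (powers _ _) => //= a l IHl /andP[la ll].
  by rewrite (IHl ll) shiftedT.
have [c Ec] := whittaker_tau_v hp rep hv gv v0 (whittaker_tau hp rep (T v)).
(* Otherwise the kernel of T, which is D-stable by [T_D], contains [tau v]. As Z is simple over gl_n
   the kernel is Z, contrary to T v = y. *)
have c0 : c != 0.
  apply/eqP => c0; rewrite c0 scale0r tauT in Ec.
  have cP : linear_pred (fun z : Z => T z = 0).
    by split=> [|a x z Tx Tz]; rewrite ?raddf0 // linearP Tx Tz scaler0 addr0.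
  have sP : stable E (fun z : Z => T z = 0).
    by apply: (closed_stable cP) => z Tz; rewrite T_D Tz D0 subrr.
  have := stable_full hp rep hv gv v0 sP Ec tv0 v; rewrite Tv => /eqP.
  by rewrite (negbTE y0).
pose T' (z : Z) : Z := scal c^-1 *: T z.
have T'L : linear T'.
  by move=> u x z; rewrite /T' linearP scalerDr !scalerA Uchi_scalC.
pose T'm := GRing.isLinear.Build A Z Z _ T' T'L.
pose TL : {linear Z -> Z} := HB.pack T' T'm.
have DZ k z : D (scal k *: z) = scal k *: D z.
  by rewrite D_scale Uchi_der_scal scale0r add0r.
have T_S s : s \in socle -> TL s = s.
  move=> /submodule_ofP[u ->]; rewrite linearZ /=; congr (_ *: _).
  rewrite /T' -tauT Ec [c *: _]restrict_scaleE scalerA -rmorphM mulVf // rmorph1.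
  exact: scale1r.
have TL_D z : TL (D z) = D (TL z) - TL z.
  by rewrite /TL /= /T' T_D DZ scalerBr.
have p_inv m : (0 < m < p)%N -> exists a : A, forall z : Z, a *: (z *+ m) = z.
  move=> /andP[m0 mp]; have m1 : (m%:R : K) != 0 by rewrite -(dvdn_pcharf hp) gtnNdvd.
  exists (scal (m%:R)^-1) => z; rewrite -scaler_nat scalerA -(rmorph_nat scal) -rmorphM.
  by rewrite mulVf // rmorph1 scale1r.
split.
  exact: (derived_reducible D_zmod D_scale socle_neq0 p_inv T_S TL_D).
exists (derived_sub D_zmod D_scale socle).
exact: (derived_composition_series D_zmod D_scale socle_simple socle_neq0 derived_socle_full p_inv T_S TL_D).
Qed.

End CyclicModule.

(** * The dot orbit of zero *)

Section DotOrbit.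
Variables (K : fieldType) (p : nat) (hp : p \in [pchar K]) (n : nat) (o : 'I_n).
Implicit Type lam : 'Hom(subvs_of (cartan n hp), K^o).

Lemma gl_weightE lam (H : subvs_of (cartan n hp)) :
  lam H = \sum_i vsval H i i * gl_weight o lam i.
Proof.
have -> : \sum_i vsval H i i * gl_weight o lam i =
    lam (\sum_i vsval H i i *: cartan_diff hp o i).
  by rewrite raddf_sum /=; apply: eq_bigr => i _; rewrite linearZ.
congr (lam _); apply: val_inj; rewrite /= raddf_sum /=.
under [RHS]eq_bigr => i _ do rewrite cartan_diffK scalerBr.
have := subvsP H; rewrite /= mem_h => /andP[/eqP tr0 /is_diag_mxP dH].
rewrite sumrB -scaler_suml -[\sum_i vsval H i i]/(\tr (vsval H)) tr0 scale0r subr0.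
rewrite {1}[vsval H]matrix_sum_delta; apply: eq_bigr => i _.
rewrite (bigD1 i) //= big1 ?addr0 // => j ji.
by rewrite dH ?scale0r // eq_sym.
Qed.

(** On matrices of trace zero, rho is minus the sum of the i eps_i, with indices from 0. *)
Lemma dot0E (w : 'S_n) (H : subvs_of (cartan n hp)) :
  dot w 0 H = \sum_i vsval H i i * (i%:R - (w^-1%g i)%:R).
Proof.
have rhoE' (G : subvs_of (cartan n hp)) : rho n hp G = - \sum_i vsval G i i * i%:R.
  have := subvsP G; rewrite /= mem_h => /andP[/eqP tr0 _].
  have -> : - \sum_i vsval G i i * i%:R =
      \sum_i vsval G i i * (n%:R - 1) - \sum_i vsval G i i * i%:R.
    by rewrite -mulr_suml -[\sum_i vsval G i i]/(\tr (vsval G)) tr0 mul0r sub0r.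
  rewrite /rho sum_lfunE -sumrB.
  apply: eq_bigr => i _; rewrite scale_lfunE epsE -[_ *: _]/(_ * _).
  by rewrite natrB // -[i.+1]addn1 natrD; ring.
rewrite /dot add0r add_lfunE opp_lfunE weylE !rhoE' opprK.
under eq_bigr => i _ do rewrite weyl_conjE.
rewrite (reindex_inj (@perm_inj _ w^-1%g)) /= addrC -sumrB.
by apply: eq_bigr => i _; rewrite permKV mulrBr.
Qed.

Lemma dot_orbit_weight lam (s : 'S_n) :
  (forall i, gl_weight o lam i - i%:R = - (s i)%:R) -> in_dot_orbit0 lam.
Proof.
move=> sE; exists s^-1%g; apply/lfunP => H; rewrite gl_weightE dot0E invgK.
by apply: eq_bigr => i _; rewrite -sE; congr (_ * _); rewrite addrC subrK.
Qed.

Lemma weight_dot_orbit lam : o = 0%N :> nat -> in_dot_orbit0 lam ->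
  exists s : 'S_n, forall i, gl_weight o lam i - i%:R = (s o)%:R - (s i)%:R.
Proof.
move=> o0 [w ->]; exists w^-1%g => i; rewrite /gl_weight dot0E cartan_diffK.
have sum_delta (l : 'I_n) (f : 'I_n -> K) : \sum_k (delta_mx l l : 'M[K]_n) k k * f k = f l.
  rewrite (bigD1 l) //= big1 => [|k /negbTE kl]; last by rewrite mxE kl mul0r.
  by rewrite mxE eqxx mul1r addr0.
under eq_bigr => k _ do rewrite [X in X * _]mxE [X in (_ + X) * _]mxE mulrBl.
by rewrite sumrB !sum_delta o0; ring.
Qed.

(** t sends i to the index at which [s] takes the cyclically preceding value; wrapping around from 0
    to n - 1 is harmless because n = 0 in K. *)
Lemma shift_perm (s : 'S_n) : (p %| n)%N ->
  exists t : 'S_n, forall i, (s (t i))%:R = (s i)%:R - 1 :> K.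
Proof.
move=> pn; exists (s * perm (@ord_pred_inj n) * s^-1)%g => i.
rewrite !permM permKV permE /=; set k := s i.
have n0 : (n%:R : K) = 0 by apply/eqP; rewrite -(dvdn_pcharf hp).
have kn : (0 < k + n)%N by have := ltn_ord k; lia.
have : ((k + n).-1%:R : K) = k%:R - 1.
  have : ((k + n)%:R : K) = (k + n).-1%:R + 1 by rewrite -{1}(prednK kn) -addn1 natrD.
  by rewrite natrD n0 addr0 => ->; rewrite addrK.
by rewrite {1}(divn_eq (k + n).-1 n) natrD natrM n0 mulr0 add0r.
Qed.

End DotOrbit.

Theorem theorem0p4 (K : closedFieldType) (p : nat) (hp : p \in [pchar K])
    (n : nat) (n_ge2 : (2 <= n)%N) (p_dvd_n : (p %| n)%N)
    (chi : 'Hom(subvs_of (sl n hp), K^o)) (chiP : regular_nilpotent chi)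
    (lam : 'Hom(subvs_of (cartan n hp), K^o)) (lamP : restricted_weight lam) :
  let Z := baby_verma (regular_nilpotent_b0 chiP) lamP in
  (in_dot_orbit0 lam ->
     reducible Z /\
     exists N : submodule Z,
       unique_maximal N /\
       (exists M : nat -> submodule Z, composition_series p M) /\
       (forall (l : nat) (M : nat -> submodule Z), composition_series l M ->
          forall i : nat, (i < l)%N ->
            isomorphic (factor (M i) (M i.+1)) (quo_by N))) /\
  (~ in_dot_orbit0 lam -> simple Z).
Proof.
move=> Z; pose o := Ordinal (ltnW n_ge2); have o0 : o = 0%N :> nat by [].
have [D [D_zmod D_scale D0]] := verma_der_exists o chiP lamP.
pose v : Z := verma_gen chiP lamP; have v0 : v != 0 := verma_gen_neq0 chiP lamP o0.
have hv := hw_verma D_zmod D_scale D0.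
have gv : generates (gl_E D_zmod D_scale) v by exact: generates_verma.
have mu_o := gl_weight_o o lam.
have mu_prime := gl_weight_prime_field o lamP.
pose mu := gl_weight o lam; pose b i := mu i - i%:R.
have Fb i : in_prime_field (b i).
  by apply: (in_prime_fieldB hp); [exact: mu_prime|exact: in_prime_field_nat].
split=> [orb|norb]; last first.
  apply: contrapT => nZ.
  have [c [Fc c0 wE]] := nonsimple_weights chiP hv gv v0 mu_o mu_prime nZ.
  have [s sE] := shift_invariant_perm hp p_dvd_n Fb Fc c0 wE.
  by apply/norb/(dot_orbit_weight (o := o) (s := s)).
(* Here b_i = s(o) - s(i) in K, so composing b with t adds 1 to every entry, and the vector y
   obtained by reflections has weight mu + (1, ..., 1). *)
have [s sE] := weight_dot_orbit o0 orb; have [t tE] := shift_perm hp s p_dvd_n.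
have hb : shifted_hw (gl_E D_zmod D_scale) b v.
  by split=> [i|]; [rewrite /b subrK; exact: hv.1|exact: hv.2].
have Fbb k l : in_prime_field (b k - b l) by apply: (in_prime_fieldB hp).
have rep := gl_E_rep chiP D_zmod D_scale.
have [y hy y0] := shifted_hw_perm hp rep t Fbb hb v0.
have hy' : hw (gl_E D_zmod D_scale) (fun i => mu i + 1) y.
  split=> [i|]; last exact: hy.2.
  have := hy.1 i; suff -> : (b \o t) i + i%:R = mu i + 1 by [].
  by rewrite /= /b !sE tE -[mu i](subrK i%:R) sE; ring.
have univ z : sl_hw (gl_E D_zmod D_scale) o mu z -> exists T : {linear Z -> Z}, T v = z.
  by move=> /sl_hwP[Hd Hu]; have H := hw_verma_gen chiP lamP Hu Hd; exact: H.
have [redZ serZ] := hw_reducible chiP hv gv v0 mu_o mu_prime univ hy' y0.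
split=> //; exists (radical D_zmod D_scale).
split; first exact: (radical_unique_maximal chiP hv gv v0).
split=> // l M [_ _ Ms] i il; have [_ sF] := Ms i il.
exact: (factor_iso_quo chiP hv gv v0 mu_prime).
Qed.
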